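(* Let $P\subseteq\mathbb{R}^2$ be a non-hollow lattice polygon with $k\ge2$ interior lattice points. Then $\mu(P,\mathbb{Z}^2)\le\frac12+\frac1{k+1}$, with equality if and only if $P$ is the direct sum of two lattice segments of lattice lengths $2$ and $k+1$.
   Context: $\mu(P,\mathbb{Z}^2)=\min\{\mu\ge0:\mu P+\mathbb{Z}^2=\mathbb{R}^2\}$. A lattice polygon has vertices in $\mathbb{Z}^2$; non-hollow means its interior contains a lattice point. The lattice length of a lattice segment is the number of lattice points on it minus one. The direct sum of two non-parallel segments $K,L$ meeting in a common point $c$ is $c+\big((K-c)\oplus(L-c)\big)=\operatorname{conv}(K\cup L)$, where for sets $A,B$ containing the origin in complementary lines $A\oplus B=\{\lambda a+(1-\lambda)b:a\in A,b\in B,\lambda\in[0,1]\}$.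
   Formalization: The direct sum is also required to split the lattice (Z^2 is the sum of its intersections with the two segment directions); otherwise the ''if'' part fails, e.g. conv{(0,0),(4,0),(0,4)} with k=3, segments [(2,0),(0,4)] and [(0,0),(4,0)], where the covering radius is at most 1/2. *)

(* Defs.v *)
From HB Require Import structures.
From mathcomp Require Import all_boot all_order all_algebra.
From mathcomp Require Import all_classical all_reals all_analysis.
From mathcomp Require Import ring lra.
Set Implicit Arguments.
Unset Strict Implicit.
Unset Printing Implicit Defensive.
Import Order.TTheory GRing.Theory Num.Theory.
Import numFieldNormedType.Exports.
Local Open Scope classical_set_scope.
Local Open Scope ring_scope.

Section PlaneLattice.
Variable R : realType.
Local Notation plane := 'rV[R]_2.
Implicit Types (P K L A B : set plane) (p q c : plane).

Definition Z2 : set plane := [set x | x \is a mxOver Num.int].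

Definition conv A : set plane := smallest (@convex_set R plane) A.

(* Degenerate hulls (points, segments) are included here; [non_hollow] below
   rules them out. *)
Definition lattice_polygon P :=
  exists s : seq plane, [set` s] `<=` Z2 /\ P = conv [set` s].

Definition interior_lattice_points P : set plane := interior P `&` Z2.

Definition non_hollow P := interior_lattice_points P !=set0.

Definition covers (mu : R) P :=
  [set mu *: p + z | p in P & z in Z2] = [set: plane].

(* [inf] stands for the usual min; it is attained for non-hollow lattice
   polygons, see [covering_radius_min]. *)
Definition covering_radius P : R := inf [set mu | 0 <= mu /\ covers mu P].

Definition segment p q : set plane := conv [set p; q].

(* [l] is the number of lattice points minus one; intended for lattice
   segments. *)
Definition lattice_length A (l : nat) := (A `&` Z2 #= `I_l.+1)%card.

Definition oplus A B : set plane :=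
  [set x | exists a b (t : R),
     [/\ A a, B b, 0 <= t <= 1 & x = t *: a + (1 - t) *: b]].

(* Z^2 is the direct sum of its intersections with the lines R u and R v. *)
Definition Z2_splits (u v : plane) :=
  forall z, Z2 z -> exists a b : R,
    [/\ Z2 (a *: u), Z2 (b *: v) & z = a *: u + b *: v].

(* [row_free] says that the directions are linearly independent: both segments
   are non-degenerate and they are not parallel.
   The sum is one of segments together with their lattices, hence [Z2_splits].
   Without it the equality criterion for the covering radius fails: for
   K = [(2,0), (0,4)], of lattice length 2, and L = [(0,0), (4,0)], of lattice
   length 4, meeting in c = (2,0), the set conv (K `|` L) is the triangle
   (0,0), (4,0), (0,4), which has 3 interior lattice points, but its covering
   radius is at most 1/2 since half of it contains the unit square. *)
Definition direct_sum_of_lattice_segments P (m n : nat) :=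
  exists p q r s c : plane,
    let K := segment p q in let L := segment r s in
    [/\ [/\ Z2 p, Z2 q, Z2 r & Z2 s],
        lattice_length K m /\ lattice_length L n,
        row_free (col_mx (q - p) (s - r)) /\ Z2_splits (q - p) (s - r),
        K c /\ L c &
        P = [set c + x | x in oplus [set y - c | y in K] [set y - c | y in L]]].

Lemma convex_setP A : @convex_set R plane A <->
  (forall x y (t : R), A x -> A y -> 0 <= t <= 1 -> A (t *: x + (1 - t) *: y)).
Proof.
split=> [cA x y t Ax Ay /andP[t0 t1]|cA x y l].
  by have /set_mem := cA x y (Itv01 t0 t1) (mem_set Ax) (mem_set Ay).
move=> /set_mem Ax /set_mem Ay; apply/mem_set/cA => //.
by apply/andP; split.
Qed.

Lemma conv_convex A x y (t : R) :
  conv A x -> conv A y -> 0 <= t <= 1 -> conv A (t *: x + (1 - t) *: y).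
Proof.
move=> Ax Ay t01 C [/[dup] /convex_setP cC cC' AC].
by apply: cC => //; [apply: Ax|apply: Ay].
Qed.

Lemma sub_conv A : A `<=` conv A.
Proof. exact: sub_gen_smallest. Qed.

Lemma conv_sub A B :
  (forall x y (t : R), B x -> B y -> 0 <= t <= 1 ->
     B (t *: x + (1 - t) *: y)) ->
  A `<=` B -> conv A `<=` B.
Proof. by move=> /convex_setP cB AB; apply: smallest_sub. Qed.

Lemma conv_cons p q (s : seq plane) :
  conv [set` p :: q :: s] =
  (fun u : R * plane => u.1 *: p + (1 - u.1) *: u.2) @`
    (`[0, 1] `*` conv [set` q :: s]).
Proof.
apply/seteqP; split; last first.
  move=> _ [[t y] [/= t01 Qy] <-]; apply: conv_convex.
  - by apply: sub_conv; rewrite /= inE eqxx.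
  - move: Qy; apply: conv_sub => [*|z /= zs]; first exact: conv_convex.
    by apply: sub_conv; rewrite /= inE zs orbT.
  - by move: t01; rewrite in_itv.
apply: conv_sub => [_ _ l [[t y] [/= + Qy] <-] [[u z] [/= + Qz] <-] l01|x /=].
  rewrite !in_itv/= => t01 u01.
  pose w := l * t + (1 - l) * u.
  have [w1|w1] := eqVneq w 1.
    exists (1, y) => /=; first by rewrite in_itv/= ler01 lexx.
    have e1 : l * (1 - t) = 0 by move: w1; rewrite /w; nra.
    have e2 : (1 - l) * (1 - u) = 0 by move: w1; rewrite /w; nra.
    rewrite subrr scale0r addr0 scale1r !scalerDr !scalerA e1 e2 !scale0r !addr0.
    by rewrite -scalerDl -/w w1 scale1r.
  have w0 : 1 - w != 0 by rewrite subr_eq0 eq_sym.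
  have w01 : 0 <= w <= 1 by rewrite /w; nra.
  have w0' : 0 < 1 - w by rewrite lt_neqAle eq_sym w0 subr_ge0; case/andP: w01.
  pose v := l * (1 - t) / (1 - w).
  exists (w, v *: y + (1 - v) *: z) => /=.
    split; first by rewrite /= in_itv.
    apply: conv_convex => //; rewrite /v divr_ge0 ?ler_pdivrMr//=; last 2 first.
    - by nra.
    - exact: ltW.
    by rewrite /w; nra.
  have e1 : (1 - w) * v = l * (1 - t) by rewrite /v mulrC divfK.
  have e2 : (1 - w) * (1 - v) = (1 - l) * (1 - u).
    by rewrite mulrBr e1 /w; ring.
  rewrite !scalerDr !scalerA e1 e2 /w scalerDl.
  by rewrite addrACA.
rewrite inE => /predU1P[->|xs].
  exists (1, q) => /=.
    split; first by rewrite /= in_itv/= ler01 lexx.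
    by apply: sub_conv; rewrite /= mem_head.
  by rewrite scale1r subrr scale0r addr0.
exists (0, x) => /=; last by rewrite scale0r subr0 scale1r add0r.
by split; [rewrite /= in_itv/= ler01 lexx|apply: sub_conv].
Qed.

Lemma conv_seq_compact (s : seq plane) : compact (conv [set` s]).
Proof.
case: s => [|p s].
  rewrite (_ : conv _ = set0); first exact: compact0.
  by rewrite -subset0; apply: conv_sub.
elim: s p => [|q s IH] p.
  rewrite (_ : conv _ = [set p]); first exact: compact_set1.
  apply/seteqP; split=> [|_ ->]; last by apply: sub_conv; rewrite /= mem_head.
  apply: conv_sub => [x y t -> -> _|x /=]; last by rewrite inE => /eqP.
  by rewrite -scalerDl addrC subrK scale1r.
rewrite conv_cons; apply: continuous_compact.
  apply: continuous_subspaceT => u.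
  apply: cvgD; apply: cvgZ.
  - exact: cvg_fst.
  - exact: cvg_cst.
  - by apply: cvgB; [exact: cvg_cst|exact: cvg_fst].
  - exact: cvg_snd.
by apply: compact_setX; [exact: segment_compact|exact: IH].
Qed.

Lemma closed_Z2 : closed Z2.
Proof.
have cZ : closed [set x : R | x \is a Num.int].
  move=> x clx; apply/negPn/negP => /= xN.
  have /andP[f1 f2] := floor_itv x.
  have f1' : (Num.floor x)%:~R < x by rewrite lt_neqAle f1 -intrEfloor xN.
  pose e := Num.min (x - (Num.floor x)%:~R) ((Num.floor x + 1)%:~R - x).
  have e0 : 0 < e by rewrite lt_min !subr_gt0 f1' f2.
  have [y [/intrP[m ->]]] := clx _ (nbhsx_ballx x e e0).
  rewrite -ball_normE/= lt_min => /andP[h1 h2].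
  have [mf|mf] := leP m (Num.floor x).
    have : (m%:~R : R) <= (Num.floor x)%:~R by rewrite ler_int.
    have := ler_norm (x - m%:~R); lra.
  have : (Num.floor x + 1)%:~R <= (m%:~R : R) by rewrite ler_int lezD1.
  have := ler_norm (m%:~R - x); rewrite distrC; lra.
rewrite (_ : Z2 = \bigcap_(j in [set: 'I_2])
    (fun v : plane => v ord0 j) @^-1` [set x : R | x \is a Num.int]).
  apply: closed_bigI => j _; apply: closed_comp => // v _.
  exact: coord_continuous.
apply/seteqP; split=> v; first by move=> /mxOverP vZ j _; apply: vZ.
by move=> vZ; apply/mxOverP => i j; rewrite ord1; apply: vZ.
Qed.

Lemma covers_ex P : non_hollow P -> exists2 mu, 0 <= mu & covers mu P.
Proof.
move=> [c [/nbhs_ballP[r /= r0 rP] _]].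
have r2 : 0 < r / 2 by rewrite divr_gt0.
have r2n := lt0r_neq0 r2.
exists (r / 2)^-1; first by rewrite invr_ge0 ltW.
apply/seteqP; split=> // x _; set mu := _^-1.
have mu0 : mu != 0 by rewrite invr_eq0.
pose z : plane := map_mx (fun t => (Num.floor t)%:~R) (x - mu *: c).
exists (mu^-1 *: (x - z)).
  apply: rP; rewrite -ball_normE/= /Num.Def.normr/= mx_normrE.
  apply/bigmax_ltP; split=> // -[i j] _ /=.
  rewrite !mxE; set a := x i j.
  have /andP[] := floor_itv (a - mu * c i j).
  rewrite intrD; set f := (Num.floor _)%:~R => h1 h2.
  have -> : c i j - mu^-1 * (a - f) = - (mu^-1 * (a - mu * c i j - f)).
    by field.
  rewrite normrN normrM /mu invrK [`|r / 2|]gtr0_norm//.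
  rewrite ger0_norm ?subr_ge0//; fold mu; nra.
exists z.
  by apply/mxOverP => i j; rewrite mxE intr_int.
by rewrite scalerA mulfV ?invr_eq0// scale1r subrK.
Qed.

Lemma covering_radius_min P : lattice_polygon P -> non_hollow P ->
  [/\ 0 <= covering_radius P, covers (covering_radius P) P &
      forall mu, 0 <= mu -> covers mu P -> covering_radius P <= mu].
Proof.
move=> [s [_ Ps]] nhP; have cP : compact P by rewrite Ps; exact: conv_seq_compact.
pose S := [set mu | 0 <= mu /\ covers mu P].
have S0 : S !=set0 by have [mu] := covers_ex nhP; exists mu.
have lS : has_lbound S by exists 0 => mu [].
split.
- by apply: lb_le_inf => // mu [].
- rewrite /covering_radius -/S; set m := inf S.
  apply/seteqP; split=> // x _.
  pose f (u : R * plane) := x - u.1 *: u.2.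
  have fc : continuous f.
    move=> u; apply: cvgB; first exact: cvg_cst.
    by apply: cvgZ; [exact: cvg_fst|exact: cvg_snd].
  have cT : compact ((`[m, m + 1] `*` P) `&` f @^-1` Z2).
    apply: compact_closedI.
      by apply: compact_setX => //; exact: segment_compact.
    by apply: closed_comp closed_Z2 => u _; exact: fc.
  have cfT : compact (fst @` ((`[m, m + 1] `*` P) `&` f @^-1` Z2)).
    apply: continuous_compact => //; apply: continuous_subspaceT => u.
    exact: cvg_fst.
  have /compact_closed clT := cfT.
  have [|[u p] [[_ /= Pp] fZ] /= um] := clT (@Rhausdorff R) m.
    move=> B /nbhs_ballP[e /= e0 eB].
    have e1 : 0 < Num.min e 1 by rewrite lt_min e0 ltr01.
    have [mu [mu0 cmu]] := inf_adherent e1 (conj S0 lS).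
    rewrite -/m => mlt.
    have mmu : m <= mu by apply: ge_inf.
    exists mu; split; last first.
      apply: eB; rewrite -ball_normE/= distrC ger0_norm ?subr_ge0//.
      by move: mlt; rewrite -ltrBlDl lt_min => /andP[].
    have [p Pp [z Zz xE]] : [set mu *: p + z | p in P & z in Z2] x.
      by rewrite cmu.
    exists (mu, p) => //; split.
      split => //=; rewrite in_itv/= mmu/=.
      by move: mlt; rewrite -ltrBlDl lt_min => /andP[_ /ltW]; rewrite lerBlDl.
    by rewrite /= /f/= -xE addrC addKr.
  exists p => //; exists (x - m *: p); first by rewrite -um.
  by rewrite addrC subrK.
- by move=> mu mu0 cmu; apply: ge_inf.
Qed.

End PlaneLattice.

(* Main.v *)
(* Write c = 1/mu, so that the claim is about the tiling scale c for which
   P + c Z^2 is the plane, with critical value 2(k+1)/(k+3).  In coordinates where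
   some horizontal line carries the maximal number m of interior lattice points,
   P + c Z^2 is the plane as soon as P has horizontal chords of length c at two
   heights differing by c; chord lengths are concave in the height.  If w is the
   difference between the extreme heights of P, an edge meets a lattice row at an
   abscissa of denominator at most w, so the chord through the m points has length
   at least m - 1 + 2/w.

   If all interior lattice points lie on one line, P lies in the strip |y| <= 1 and
   the chord y = 0 ends in lattice points or midpoints of edges.  Two lattice points
   give the critical scale from the chord of length k + 1 alone, with room to
   spare unless P is the convex hull of that chord and two vertices whose midpoint
   is a lattice point, which is the direct sum.  Otherwise w >= 3, k <= m(w - 1),
   and the chord estimates exceed the critical value when m >= 3.  For m = 2 the
   interior lattice points form a unit triangle, possibly with a fourth point
   completing it to a unit square or to a triangle with its centroid. *)

Require Import Defs.
From mathcomp Require Import all_boot all_order all_algebra.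
From mathcomp Require Import all_classical all_reals all_analysis.
From mathcomp Require Import ring lra zify.
Set Implicit Arguments.
Unset Strict Implicit.
Unset Printing Implicit Defensive.
Import Order.TTheory GRing.Theory Num.Theory.
Import numFieldNormedType.Exports.
Local Open Scope classical_set_scope.
Local Open Scope ring_scope.

(** * Coverings from chords *)

Section Coverings.
Variable R : realType.
Implicit Types (Q : R -> R -> Prop) (a b c d l r t x y z L : R).

(** The critical scale comes from a rhombus: one chord of length L in a body of height w makes c a
    tiling scale as soon as c (L + w) <= L w, that is 1/L + 1/w <= 1/c, and L = k + 1, w = 2 give
    the bound. Two shapes with collinear interior points escape this argument. If the midpoint of
    the two apexes is half-integral, one chord gives the critical value without slack; if exactly
    one end of the long chord is half-integral, it falls short. There the heights without a chord of
    length c are covered by overlapping two layers of the tiling. Every estimate outside the direct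
    sum is strict, and this is what characterises equality. The lower bound for a direct sum with
    lattice lengths m and n splits mu into a part for each segment: when mu < 1/m + 1/n, some point
    lies in a gap of both lattice directions at once and stays uncovered. *)

Definition convex2 Q := forall x y x' y' t,
  Q x y -> Q x' y' -> 0 <= t <= 1 -> Q (t * x + (1 - t) * x') (t * y + (1 - t) * y').

(* [Q] is kept fixed and the lattice is scaled: [c] is the inverse of the dilation
   factor [mu] of the covering. *)
Definition tcover Q c := forall X Y, exists x y (i j : int),
  [/\ Q x y, X = x + c * i%:~R & Y = y + c * j%:~R].

(** The strict form: it yields a covering radius strictly below [c^-1] and so excludes equality. *)
Definition scover Q c := exists2 c', c < c' & tcover Q c'.

(** [d] is only a lower bound for the length; [chord Q y 0] just says that [Q] reaches the height
    [y]. *)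
Definition chord Q y d := exists l r, [/\ Q l y, Q r y & d <= r - l].

Lemma floor_mod c a Y : 0 < c ->
  exists2 j : int, a <= Y - c * j%:~R & Y - c * j%:~R < a + c.
Proof.
move=> c0; exists (Num.floor ((Y - a) / c)).
  have := floor_le ((Y - a) / c); rewrite ler_pdivlMr //; lra.
have := floorD1_gt ((Y - a) / c); rewrite ltr_pdivrMr // intrD mulrDl; lra.
Qed.

Lemma convex_comb2 Q x y x' y' t z (w : R) : convex2 Q -> Q x y -> Q x' y' ->
  0 <= t <= 1 -> z = t * x + (1 - t) * x' -> w = t * y + (1 - t) * y' -> Q z w.
Proof. by move=> cQ h h' t01 -> ->; apply: cQ. Qed.

Lemma unit_interp a b z : a <= z <= b -> a < b ->
  exists2 t, 0 <= t <= 1 & z = t * a + (1 - t) * b.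
Proof.
move=> /andP[az zb] ab; exists ((b - z) / (b - a)); last by field; lra.
by apply/andP; split; [apply: divr_ge0|rewrite ler_pdivrMr]; lra.
Qed.

Lemma convex2_between Q l r y x : convex2 Q -> Q l y -> Q r y -> l <= x <= r -> Q x y.
Proof.
move=> cQ Ql Qr lxr; have [lr|rl] := ltP l r.
  have [t t01 ->] := unit_interp lxr lr.
  by apply: (convex_comb2 cQ Ql Qr t01) => //; ring.
by have -> : x = l by lra.
Qed.

Lemma chord_comb Q y d y' d' t : convex2 Q -> chord Q y d -> chord Q y' d' ->
  0 <= t <= 1 -> chord Q (t * y + (1 - t) * y') (t * d + (1 - t) * d').
Proof.
move=> cQ [l [r [Ql Qr lr]]] [l' [r' [Ql' Qr' lr']]] t01.
exists (t * l + (1 - t) * l'), (t * r + (1 - t) * r'); split; [exact: cQ|exact: cQ|].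
by nra.
Qed.

Lemma chordW Q y d d' : chord Q y d -> d' <= d -> chord Q y d'.
Proof. by move=> [l [r [Ql Qr lr]]] d'd; exists l, r; split=> //; lra. Qed.

Lemma chord_between Q y0 y1 y d : convex2 Q -> chord Q y0 d -> chord Q y1 d ->
  y0 <= y <= y1 -> chord Q y d.
Proof.
move=> cQ h0 h1 yy; have [lt|le] := ltP y0 y1; last first.
  by have -> : y = y0 by lra.
have [t t01 ->] := unit_interp yy lt.
by apply: chordW (chord_comb cQ h0 h1 t01) _; lra.
Qed.

Lemma chord_mod Q y c X : convex2 Q -> 0 < c -> chord Q y c ->
  exists x (i : int), Q x y /\ X = x + c * i%:~R.
Proof.
move=> cQ c0 [l [r [Ql Qr lr]]].
have [i il ir] := floor_mod l X c0.
exists (X - c * i%:~R), i; split; last by rewrite subrK.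
by apply: (convex2_between cQ Ql Qr); lra.
Qed.

(** By convexity every height between [y0] and [y1] carries a chord of length [c]: reduce [Y] modulo
    [c] into that strip, then [X] modulo [c] into the chord. *)
Lemma tcover_chords Q y0 y1 c : convex2 Q -> 0 < c ->
  chord Q y0 c -> chord Q y1 c -> c <= y1 - y0 -> tcover Q c.
Proof.
move=> cQ c0 h0 h1 cy X Y.
have [j jl jr] := floor_mod y0 Y c0.
have hy : chord Q (Y - c * j%:~R) c by apply: (chord_between cQ h0 h1); lra.
have [x [i [Qx Xx]]] := chord_mod X cQ c0 hy.
by exists x, (Y - c * j%:~R), i, j; split=> //; rewrite subrK.
Qed.

Lemma scover_chords Q y0 y1 d0 d1 c : convex2 Q -> 0 < c ->
  chord Q y0 d0 -> chord Q y1 d1 -> c < d0 -> c < d1 -> c < y1 - y0 -> scover Q c.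
Proof.
move=> cQ c0 h0 h1 cd0 cd1 cy.
pose c' := Num.min d0 (Num.min d1 (y1 - y0)).
have cc' : c < c' by rewrite !lt_min cd0 cd1.
have [h2 h3] : c' <= d0 /\ c' <= d1 by rewrite !ge_min !lexx /= orbT.
exists c' => //; apply: (@tcover_chords Q y0 y1) => //; first by lra.
- exact: chordW h0 _.
- exact: chordW h1 _.
- by rewrite !ge_min lexx !orbT.
Qed.

(* At heights between [y0] and [y1] a chord of length [c] may be missing; there
   the chord [[l, r]] and the translate by [(j * c, c)] of the chord [[l', r']]
   at height [y - c] overlap and together span [c]. *)
Lemma tcover_two_layers Q c y0 y1 (j : int) l0 r0 l1 r1 l0' r0' l1' r1' :
  convex2 Q -> 0 < c -> y1 - c <= y0 -> y0 <= y1 ->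
  Q l0 y0 -> Q r0 y0 -> Q l1 y1 -> Q r1 y1 ->
  Q l0' (y0 - c) -> Q r0' (y0 - c) -> Q l1' (y1 - c) -> Q r1' (y1 - c) ->
  c <= r0 - l0 -> c <= r1' - l1' ->
  j%:~R * c <= r0 - l0' -> (1 - j%:~R) * c <= r0' - l0 ->
  j%:~R * c <= r1 - l1' -> (1 - j%:~R) * c <= r1' - l1 ->
  tcover Q c.
Proof.
move=> cQ c0 y10 y01 Ql0 Qr0 Ql1 Qr1 Ql0' Qr0' Ql1' Qr1' h0 h1 a0 b0 a1 b1 X Y.
have [k kl kr] := floor_mod (y1 - c) Y c0; set y := Y - _ in kl kr.
have [yy0|y0y] := leP y y0.
  have hy : chord Q y c.
    apply: (@chord_between Q (y1 - c) y0) => //; last by lra.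
      by exists l1', r1'; split=> //; lra.
    by exists l0, r0.
  have [x [i [Qx Xx]]] := chord_mod X cQ c0 hy.
  by exists x, y, i, k; split=> //; rewrite subrK.
have [t t01 yE] : exists2 t, 0 <= t <= 1 & y = t * y0 + (1 - t) * y1.
  by apply: unit_interp; lra.
pose l := t * l0 + (1 - t) * l1; pose r := t * r0 + (1 - t) * r1.
pose l' := t * l0' + (1 - t) * l1'; pose r' := t * r0' + (1 - t) * r1'.
have Ql : Q l y by apply: (convex_comb2 cQ Ql0 Ql1 t01).
have Qr : Q r y by apply: (convex_comb2 cQ Qr0 Qr1 t01).
have Ql' : Q l' (y - c) by apply: (convex_comb2 cQ Ql0' Ql1' t01); rewrite ?yE //; ring.
have Qr' : Q r' (y - c) by apply: (convex_comb2 cQ Qr0' Qr1' t01); rewrite ?yE //; ring.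
have a : j%:~R * c <= r - l' by rewrite /r /l'; nra.
have b : (1 - j%:~R) * c <= r' - l by rewrite /r' /l; nra.
have [i il ir] := floor_mod l X c0; set x := X - _ in il ir.
have [xr|rx] := leP x r.
  exists x, y, i, k; split; rewrite ?subrK //.
  by apply: (convex2_between cQ Ql Qr); lra.
exists (x - j%:~R * c), (y - c), (i + j), (k + 1); split.
- by apply: (convex2_between cQ Ql' Qr'); lra.
- by rewrite /x intrD; ring.
- by rewrite /y intrD; ring.
Qed.

(* Chord lengths interpolate linearly between the four heights, so that chords of
   length [c] occur on an interval of heights of length
   [(c / L) * (h2 - h1) + (1 - c / L) * (h3 - h0)]. *)
Lemma tcover_trapezoid Q h0 h1 h2 h3 L c : convex2 Q -> 0 < c -> c <= L ->
  chord Q h0 0 -> chord Q h1 L -> chord Q h2 L -> chord Q h3 0 ->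
  c * (L + (h3 - h0) - (h2 - h1)) <= (h3 - h0) * L -> tcover Q c.
Proof.
move=> cQ c0 cL H0 H1 H2 H3 H; have L0 : 0 < L by lra.
pose t := c / L; have t01 : 0 <= t <= 1.
  by rewrite /t divr_ge0 ?ler_pdivrMr //; lra.
have tL : t * L = c by rewrite divfK //; lra.
apply: (@tcover_chords Q (t * h1 + (1 - t) * h0) (t * h2 + (1 - t) * h3)) => //.
- by apply: chordW (chord_comb cQ H1 H0 t01) _; lra.
- by apply: chordW (chord_comb cQ H2 H3 t01) _; lra.
suff : 0 <= L * (t * h2 + (1 - t) * h3 - (t * h1 + (1 - t) * h0) - c).
  by rewrite pmulr_rge0 //; lra.
by move: H; rewrite -tL; nra.
Qed.

Lemma scover_trapezoid Q h0 h1 h2 h3 L c : convex2 Q -> 0 < c -> c < L ->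
  chord Q h0 0 -> chord Q h1 L -> chord Q h2 L -> chord Q h3 0 ->
  0 < L + (h3 - h0) - (h2 - h1) ->
  c * (L + (h3 - h0) - (h2 - h1)) < (h3 - h0) * L -> scover Q c.
Proof.
move=> cQ c0 cL H0 H1 H2 H3 D0 H.
pose c' := Num.min L ((h3 - h0) * L / (L + (h3 - h0) - (h2 - h1))).
have cc' : c < c' by rewrite lt_min cL ltr_pdivlMr.
exists c' => //; apply: (tcover_trapezoid cQ _ _ H0 H1 H2 H3).
- by lra.
- by rewrite ge_min lexx.
- by rewrite -ler_pdivlMr // ge_min lexx orbT.
Qed.

(** The right-hand side of the last hypothesis is the length of the interval of heights on which the
    interpolated chord lengths, rising from 0 to [L] and then falling to [L'], are at least [c]. *)
Lemma scover_two_slopes Q h0 h1 h2 L L' c : convex2 Q -> 0 < c -> c < L -> L' < c ->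
  h0 <= h1 <= h2 -> chord Q h0 0 -> chord Q h1 L -> chord Q h2 L' ->
  c < (h2 - h1) * (L - c) / (L - L') + (h1 - h0) * (1 - c / L) -> scover Q c.
Proof.
move=> cQ c0 cL L'c hh H0 H1 H2.
set F := _ + _ => cF.
(* Replacing [c] by [c + e] shortens that interval by [e * (K - 1)] and asks for [e] more, hence the
   budget [e * K <= F - c]. *)
pose K := (h2 - h1) / (L - L') + (h1 - h0) / L + 1.
have K1 : 1 <= K by rewrite /K lerDr addr_ge0 // divr_ge0 //; lra.
pose e := Num.min (L - c) ((F - c) / K).
have e0 : 0 < e by rewrite lt_min subr_gt0 cL divr_gt0 //; lra.
have eL : e <= L - c by rewrite ge_min lexx.
have eF : e * K <= F - c by rewrite -ler_pdivlMr ?ge_min ?lexx ?orbT //; lra.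
exists (c + e); first by lra.
pose s := (c + e - L') / (L - L'); have s01 : 0 <= s <= 1.
  by rewrite /s divr_ge0 ?ler_pdivrMr //; lra.
pose t := (c + e) / L; have t01 : 0 <= t <= 1.
  by rewrite /t divr_ge0 ?ler_pdivrMr //; lra.
apply: (@tcover_chords Q (t * h1 + (1 - t) * h0) (s * h1 + (1 - s) * h2)) => //.
- by lra.
- apply: chordW (chord_comb cQ H1 H0 t01) _.
  by rewrite /t divfK; lra.
- apply: chordW (chord_comb cQ H1 H2 s01) _.
  by rewrite /s le_eqVlt; apply/orP; left; apply/eqP; field; lra.
- rewrite -subr_ge0.
  have -> : s * h1 + (1 - s) * h2 - (t * h1 + (1 - t) * h0) - (c + e) =
            F - c - e * K by rewrite /s /t /F /K; field; lra.
  by lra.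
Qed.

End Coverings.

(** * Lattice polygons and unimodular frames *)

Record frame := Frame { forg : int * int; fst_dir : int * int; snd_dir : int * int }.

Definition frame_det (T : frame) : int :=
  (fst_dir T).1 * (snd_dir T).2 - (fst_dir T).2 * (snd_dir T).1.

Definition unimodular (T : frame) := frame_det T * frame_det T = 1.

Definition frame_app (T : frame) (z : int * int) : int * int :=
  ((forg T).1 + z.1 * (fst_dir T).1 + z.2 * (snd_dir T).1,
   (forg T).2 + z.1 * (fst_dir T).2 + z.2 * (snd_dir T).2).

(** A determinant of square 1 is its own inverse, so the adjugate times [d] inverts the linear part
    without division. *)
Definition frame_inv (T : frame) : frame :=
  let: Frame (p1, p2) (u1, u2) (v1, v2) := T in
  let d := frame_det T in
  Frame (- d * (v2 * p1 - v1 * p2), - d * (u1 * p2 - u2 * p1))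
        (d * v2, - d * u2) (- d * v1, d * u1).

Definition frame_comp (T T' : frame) : frame :=
  let: Frame (p1, p2) (u1, u2) (v1, v2) := T in
  let: Frame (p1', p2') (u1', u2') (v1', v2') := T' in
  Frame (p1 + p1' * u1 + p2' * v1, p2 + p1' * u2 + p2' * v2)
        (u1' * u1 + u2' * v1, u1' * u2 + u2' * v2)
        (v1' * u1 + v2' * v1, v1' * u2 + v2' * v2).

Lemma unimodular_comp T T' : unimodular T -> unimodular T' -> unimodular (frame_comp T T').
Proof.
case: T => [[p1 p2] [u1 u2] [v1 v2]]; case: T' => [[p1' p2'] [u1' u2'] [v1' v2']].
rewrite /unimodular /frame_det /= => h h'.
by rewrite -[RHS](mulr1 (1 : int)) -{1}h -h'; ring.
Qed.

Lemma frame_invK T : unimodular T -> cancel (frame_app (frame_inv T)) (frame_app T).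
Proof.
case: T => [[p1 p2] [u1 u2] [v1 v2]].
rewrite /unimodular /frame_app /frame_inv /frame_det /= => h [x y] /=.
set d := u1 * v2 - u2 * v1 in h *; congr (_, _).
- by transitivity (p1 + (x - p1) * (d * d)); [rewrite /d|rewrite h]; ring.
- by transitivity (p2 + (y - p2) * (d * d)); [rewrite /d|rewrite h]; ring.
Qed.

Lemma frame_appK T : unimodular T -> cancel (frame_app T) (frame_app (frame_inv T)).
Proof.
case: T => [[p1 p2] [u1 u2] [v1 v2]].
rewrite /unimodular /frame_app /frame_inv /frame_det /= => h [x y] /=.
set d := u1 * v2 - u2 * v1 in h *; congr (_, _).
- by transitivity (x * (d * d)); [rewrite /d|rewrite h]; ring.
- by transitivity (y * (d * d)); [rewrite /d|rewrite h]; ring.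
Qed.

(** Dividing [b - a] by the gcd [g] of its coordinates gives a primitive direction, which the Bezout
    coefficients complete to a basis. *)
Lemma frame_through (a b : int * int) : a != b ->
  exists T (g : nat), [/\ unimodular T, (0 < g)%N,
    frame_app T (0, 0) = a & frame_app T (g%:Z, 0) = b].
Proof.
case: a b => [a1 a2] [b1 b2] ab.
pose g := gcdz (b1 - a1) (b2 - a2).
have g0 : g != 0.
  apply: contra ab; rewrite gcdz_eq0 !subr_eq0 => /andP[/eqP -> /eqP ->]; exact: eqxx.
have [x [y xy]] := Bezoutz (b1 - a1) (b2 - a2); rewrite -/g in xy.
have /dvdzP[u1 u1E] : (g %| b1 - a1)%Z by exact: dvdz_gcdl.
have /dvdzP[u2 u2E] : (g %| b2 - a2)%Z by exact: dvdz_gcdr.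
have gE : g = (absz g)%:Z by [].
exists (Frame (a1, a2) (u1, u2) (- y, x)), (absz g); split.
- rewrite /unimodular /frame_det /=.
  suff -> : u1 * x - u2 * - y = 1 by [].
  by apply: (mulfI g0); rewrite mulr1 -[RHS]xy u1E u2E; ring.
- by rewrite absz_gt0.
- by rewrite /frame_app /= !mul0r !addr0.
- by rewrite /frame_app /= -gE !mul0r !addr0 ![g * _]mulrC -u1E -u2E; congr (_, _); ring.
Qed.

Section Polygons.
Variable R : realType.
Implicit Types (Q : R -> R -> Prop) (c x y : R) (S E : seq (int * int)) (T : frame).

Definition pull T Q x y :=
  Q ((forg T).1%:~R + x * (fst_dir T).1%:~R + y * (snd_dir T).1%:~R)
    ((forg T).2%:~R + x * (fst_dir T).2%:~R + y * (snd_dir T).2%:~R).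

Definition inner Q x y :=
  exists2 e : R, 0 < e & forall x' y', `|x' - x| < e -> `|y' - y| < e -> Q x' y'.

(* [Q] is the convex hull of [S] and [E] enumerates the lattice points in its
   interior. *)
Record lattice_body Q S E := LatticeBody {
  lb_convex : convex2 Q;
  lb_vertex : forall s, s \in S -> Q s.1%:~R s.2%:~R;
  lb_support : forall a b r : R,
    (forall s, s \in S -> a * s.1%:~R + b * s.2%:~R <= r) ->
    forall x y, Q x y -> a * x + b * y <= r;
  lb_uniq : uniq E;
  lb_inner : forall z, z \in E <-> inner Q z.1%:~R z.2%:~R }.

Lemma pull_app T Q (z : int * int) :
  pull T Q z.1%:~R z.2%:~R = Q (frame_app T z).1%:~R (frame_app T z).2%:~R.
Proof. by rewrite /pull /frame_app /= !intrD !intrM. Qed.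

Lemma unimodularR T : unimodular T ->
  ((fst_dir T).1%:~R * (snd_dir T).2%:~R - (fst_dir T).2%:~R * (snd_dir T).1%:~R) ^+ 2 = 1 :> R.
Proof. by move=> h; rewrite -!intrM -intrB expr2 -intrM -/(frame_det T) h. Qed.

Lemma pull_inv T Q x y : unimodular T -> pull (frame_inv T) (pull T Q) x y = Q x y.
Proof.
move=> /unimodularR; case: T => [[p1 p2] [u1 u2] [v1 v2]] /= h.
rewrite /pull /frame_inv /frame_det /= !(intrM, intrN, intrD).
congr Q.
- transitivity (p1%:~R + (x - p1%:~R) * (u1%:~R * v2%:~R - u2%:~R * v1%:~R) ^+ 2 : R).
    by ring.
  by rewrite h; ring.
- transitivity (p2%:~R + (y - p2%:~R) * (u1%:~R * v2%:~R - u2%:~R * v1%:~R) ^+ 2 : R).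
    by ring.
  by rewrite h; ring.
Qed.

Lemma pull_comp T T' Q : pull T' (pull T Q) = pull (frame_comp T T') Q.
Proof.
case: T => [[p1 p2] [u1 u2] [v1 v2]]; case: T' => [[p1' p2'] [u1' u2'] [v1' v2']].
apply/funext => x; apply/funext => y; rewrite /pull /= !(intrM, intrD).
by congr Q; ring.
Qed.

Lemma unimodular_inv T : unimodular T -> unimodular (frame_inv T).
Proof.
case: T => [[p1 p2] [u1 u2] [v1 v2]]; rewrite /unimodular /frame_inv /frame_det /= => h.
set d := u1 * v2 - u2 * v1 in h *.
by transitivity (d * d * (d * d) * (d * d)); [rewrite /d|rewrite h]; ring.
Qed.

Lemma pull_convex T Q : convex2 Q -> convex2 (pull T Q).
Proof.
move=> cQ x y x' y' t h h' t01.
by apply: (convex_comb2 cQ h h' t01); ring.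
Qed.

Lemma inner_pull_of T Q x y :
  inner Q ((forg T).1%:~R + x * (fst_dir T).1%:~R + y * (snd_dir T).1%:~R)
          ((forg T).2%:~R + x * (fst_dir T).2%:~R + y * (snd_dir T).2%:~R) ->
  inner (pull T Q) x y.
Proof.
case: T => [[p1 p2] [u1 u2] [v1 v2]] /= [e e0 he].
pose K : R := `|u1%:~R| + `|u2%:~R| + `|v1%:~R| + `|v2%:~R| + 1.
have nn (z : R) : 0 <= `|z| := normr_ge0 z.
have K0 : 0 < K.
  have := nn u1%:~R; have := nn u2%:~R; have := nn v1%:~R; have := nn v2%:~R.
  by rewrite /K; lra.
exists (e / K) => [|x' y' hx hy]; first exact: divr_gt0.
have key (a b : R) : `|a| + `|b| <= K - 1 ->
    forall o, `|o + x' * a + y' * b - (o + x * a + y * b)| < e.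
  move=> ab o.
  have -> : o + x' * a + y' * b - (o + x * a + y * b) = (x' - x) * a + (y' - y) * b by ring.
  have eK : e / K * K = e by rewrite divfK //; lra.
  have := ler_normD ((x' - x) * a) ((y' - y) * b); rewrite !normrM.
  have := nn a; have := nn b; have := nn (x' - x); have := nn (y' - y).
  have : 0 < e / K by exact: divr_gt0.
  by move: hx hy; set g := e / K in eK *; move: `|x' - x| `|y' - y| => hx' hy'; nra.
have h1 := nn u1%:~R; have h2 := nn u2%:~R; have h3 := nn v1%:~R; have h4 := nn v2%:~R.
by apply: he; apply: key; rewrite /K; lra.
Qed.

Lemma inner_pull T Q x y : unimodular T ->
  inner (pull T Q) x y <->
  inner Q ((forg T).1%:~R + x * (fst_dir T).1%:~R + y * (snd_dir T).1%:~R)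
          ((forg T).2%:~R + x * (fst_dir T).2%:~R + y * (snd_dir T).2%:~R).
Proof.
move=> uT; split; last exact: inner_pull_of.
set X := _ + _ + _; set Y := (X in inner Q _ X) => h.
have QE : Q = pull (frame_inv T) (pull T Q).
  by apply/funext => a; apply/funext => b; rewrite pull_inv.
rewrite QE; apply: inner_pull_of; rewrite /X /Y; clear QE X Y.
move: h uT => + /unimodularR; case: T => [[p1 p2] [u1 u2] [v1 v2]] /= h d1.
rewrite /frame_inv /frame_det /= !(intrM, intrN, intrD).
congr (inner _ _ _): h.
- transitivity (x * (u1%:~R * v2%:~R - u2%:~R * v1%:~R) ^+ 2 : R).
    by rewrite d1 mulr1.
  by ring.
- transitivity (y * (u1%:~R * v2%:~R - u2%:~R * v1%:~R) ^+ 2 : R).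
    by rewrite d1 mulr1.
  by ring.
Qed.

Lemma inner_pull_app T Q (z : int * int) : unimodular T ->
  inner (pull T Q) z.1%:~R z.2%:~R <-> inner Q (frame_app T z).1%:~R (frame_app T z).2%:~R.
Proof. by move=> uT; rewrite inner_pull // /frame_app /= !intrD !intrM. Qed.

(** The linear part of a unimodular frame maps [c] Z^2 onto itself, so tilings are transported at
    the same scale. *)
Lemma tcover_pull T Q c : unimodular T -> tcover (pull T Q) c -> tcover Q c.
Proof.
move=> /unimodularR; case: T => [[p1 p2] [u1 u2] [v1 v2]] /= h hc X Y.
pose d : R := u1%:~R * v2%:~R - u2%:~R * v1%:~R.
have [x [y [i [j [Qxy xE yE]]]]] :=
  hc (d * (v2%:~R * (X - p1%:~R) - v1%:~R * (Y - p2%:~R)))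
     (d * (u1%:~R * (Y - p2%:~R) - u2%:~R * (X - p1%:~R))).
exists (p1%:~R + x * u1%:~R + y * v1%:~R), (p2%:~R + x * u2%:~R + y * v2%:~R).
exists (i * u1 + j * v1), (i * u2 + j * v2); split; first exact: Qxy.
- transitivity (p1%:~R + (x + c * i%:~R) * u1%:~R + (y + c * j%:~R) * v1%:~R).
    rewrite -xE -yE; transitivity (p1%:~R + d ^+ 2 * (X - p1%:~R)); last by rewrite /d; ring.
    by rewrite h; ring.
  by rewrite !(intrM, intrD); ring.
- transitivity (p2%:~R + (x + c * i%:~R) * u2%:~R + (y + c * j%:~R) * v2%:~R).
    rewrite -xE -yE; transitivity (p2%:~R + d ^+ 2 * (Y - p2%:~R)); last by rewrite /d; ring.
    by rewrite h; ring.
  by rewrite !(intrM, intrD); ring.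
Qed.

Lemma scover_pull T Q c : unimodular T -> scover (pull T Q) c -> scover Q c.
Proof. by move=> uT [c' cc' /(tcover_pull uT)]; exists c'. Qed.

Lemma lattice_body_pull T Q S E : unimodular T -> lattice_body Q S E ->
  lattice_body (pull T Q) (map (frame_app (frame_inv T)) S) (map (frame_app (frame_inv T)) E).
Proof.
move=> uT [cQ vQ sQ uE iE].
have inj := can_inj (frame_invK uT).
split.
- exact: pull_convex.
- by move=> _ /mapP[s sS ->]; rewrite pull_app frame_invK //; apply: vQ.
- move=> a b r h x y; rewrite /pull => Qxy.
  have d1 := unimodularR uT.
  case: T uT inj h Qxy d1 => [[p1 p2] [u1 u2] [v1 v2]] /= uT _ h Qxy d1.
  pose d : R := u1%:~R * v2%:~R - u2%:~R * v1%:~R.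
  pose A := d * (a * v2%:~R - b * u2%:~R); pose B := d * (b * u1%:~R - a * v1%:~R).
  have := sQ A B (r + A * p1%:~R + B * p2%:~R) _ _ _ Qxy.
  have -> : A * (p1%:~R + x * u1%:~R + y * v1%:~R) + B * (p2%:~R + x * u2%:~R + y * v2%:~R) =
            d ^+ 2 * (a * x + b * y) + A * p1%:~R + B * p2%:~R.
    by rewrite /A /B /d; ring.
  rewrite d1 mul1r !lerD2r; apply=> s sS.
  have := h _ (map_f (frame_app (frame_inv (Frame (p1, p2) (u1, u2) (v1, v2)))) sS).
  rewrite /frame_app /frame_inv /frame_det /= !(intrM, intrN, intrD) /A /B /d.
  by rewrite -[X in X <= _ -> _]subr0 -[X in _ -> X <= _]subr0 => hh; lra.
- by rewrite map_inj_uniq // => x y /(can_inj (frame_appK (unimodular_inv uT))) ; apply.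
- move=> z; rewrite inner_pull_app // -iE.
  by rewrite -{1}(frame_appK uT z) mem_map.
Qed.

End Polygons.

(** * Extending the chords beyond the interior lattice points *)

Lemma seq_argmax (T : eqType) d (O : orderType d) (f : T -> O) (s : seq T) x : x \in s ->
  exists2 m, m \in s & forall y, y \in s -> (f y <= f m)%O.
Proof.
elim: s x => // a [|b s] IH x _.
  by exists a; rewrite ?mem_head // => y; rewrite inE => /eqP ->.
have [m ms hm] := IH b (mem_head _ _).
case: (leP (f m) (f a)) => [le|lt].
  exists a; rewrite ?mem_head // => y; rewrite inE => /predU1P[-> //|/hm h].
  exact: le_trans h le.
exists m; first by rewrite inE ms orbT.
by move=> y; rewrite inE => /predU1P[->|/hm //]; exact: ltW.
Qed.

Section Extensions.
Variable R : realType.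
Implicit Types (Q : R -> R -> Prop) (c t x y : R) (S E : seq (int * int)) (T : frame).

Lemma inner_sub Q x y : inner Q x y -> Q x y.
Proof. by move=> [e e0 h]; apply: h; rewrite subrr normr0. Qed.

Lemma inner_comb Q x y x' y' t (z w : R) : convex2 Q -> inner Q x y -> Q x' y' -> 0 < t <= 1 ->
  z = t * x + (1 - t) * x' -> w = t * y + (1 - t) * y' -> inner Q z w.
Proof.
move=> cQ [e e0 h] Q' /andP[t0 t1] -> ->.
exists (t * e) => [|a b ha hb]; first exact: mulr_gt0.
have tn : t != 0 by exact: lt0r_neq0.
have near (u v v' : R) : `|u - (t * v + (1 - t) * v')| < t * e ->
    `|v + (u - (t * v + (1 - t) * v')) / t - v| < e.
  by rewrite (addrC v) addrK normrM normfV (gtr0_norm t0) ltr_pdivrMr // [e * t]mulrC.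
by apply: (convex_comb2 (t := t) cQ (h _ _ (near _ _ _ ha) (near _ _ _ hb)) Q');
  [apply/andP; split; lra|field|field].
Qed.

Lemma inner_segment Q (l r : R) y x : convex2 Q -> inner Q l y -> inner Q r y -> l <= x <= r ->
  inner Q x y.
Proof.
move=> cQ il ir lxr; have [lr|rl] := ltP l r; last by have -> : x = l by lra.
have [t t01 xE] := unit_interp lxr lr.
have [t0|t0] := eqVneq t 0; first by have -> : x = r by rewrite xE t0; ring.
apply: (inner_comb (t := t) cQ il (inner_sub ir)) => //; last by ring.
by rewrite lt_neqAle eq_sym t0.
Qed.

(** A small step from the interior point along [(a, b)] stays in [Q] and strictly increases the
    functional. *)
Lemma inner_support Q S E x y (a b : R) : lattice_body Q S E -> inner Q x y -> (a, b) != (0, 0) ->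
  exists2 s, s \in S & a * x + b * y < a * s.1%:~R + b * s.2%:~R.
Proof.
move=> lQ [e e0 h] ab.
apply/hasP; apply/negPn/negP => /hasPn H.
have H' s : s \in S -> a * s.1%:~R + b * s.2%:~R <= a * x + b * y.
  by move=> /H; rewrite -leNgt.
pose K := `|a| + `|b| + 1; have K0 : 0 < K.
  by have := normr_ge0 a; have := normr_ge0 b; rewrite /K; lra.
pose d := e / K; have d0 : 0 < d by exact: divr_gt0.
have near (u v : R) : `|u| < K -> `|v + d * u - v| < e.
  move=> uK; rewrite (addrC v) addrK normrM (gtr0_norm d0).
  have dK : d * K = e by rewrite /d divfK // gt_eqF.
  by rewrite -dK ltr_pM2l.
have := lb_support lQ H' (h (x + d * a) (y + d * b) (near _ _ _) (near _ _ _)).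
have := normr_ge0 a; have := normr_ge0 b => nb na.
rewrite /K => -/(_ ltac:(lra) ltac:(lra)).
have : 0 < a ^+ 2 + b ^+ 2.
  by rewrite lt_neqAle addr_ge0 ?sqr_ge0 // andbT eq_sym paddr_eq0 ?sqr_ge0 // !sqrf_eq0.
nra.
Qed.

(** A point of [S] maximising the functional cannot be interior, since [inner_support] would exceed
    it. *)
Lemma inner_support_boundary Q S E x y (a b : R) : lattice_body Q S E -> inner Q x y ->
  (a, b) != (0, 0) ->
  exists s, [/\ s \in S, s \notin E & a * x + b * y < a * s.1%:~R + b * s.2%:~R].
Proof.
move=> lQ ixy ab; have [s0 s0S h0] := inner_support lQ ixy ab.
have [s sS smax] := seq_argmax (fun s => a * s.1%:~R + b * s.2%:~R) s0S.
exists s; split=> //; last exact: lt_le_trans h0 (smax _ s0S).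
apply/negP => /(lb_inner lQ) si; have [s' s'S] := inner_support lQ si ab.
by rewrite ltNge smax.
Qed.

Lemma separating_threshold (A B : seq R) : (forall a b, a \in A -> b \in B -> a <= b) ->
  exists t, (forall a, a \in A -> a <= t) /\ (forall b, b \in B -> t <= b).
Proof.
case: A => [|a A] h.
  case: B h => [|b B] _; first by exists 0.
  have [m _ hm] := seq_argmax (fun x : R => - x) (mem_head b B).
  by exists m; split=> // x /hm; rewrite lerN2.
have [m mA hm] := seq_argmax id (mem_head a A).
by exists m; split=> // b bB; apply: h.
Qed.

(* A half-plane through the origin missing the point exists as soon as every
   segment between vertices on both sides of the axis crosses it to the right. *)
Lemma left_crossing Q S E x : lattice_body Q S E -> Q x 0 -> x < 0 ->
  (exists2 s, s \in S & s.2 = 0 /\ s.1 < 0) \/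
  (exists s s', [/\ s \in S, s' \in S, 0 < s.2, s'.2 < 0 & s.2 * s'.1 - s'.2 * s.1 < 0]).
Proof.
move=> lQ Qx x0; apply: contrapT => /not_orP[H0 H1].
(* The half-plane x + t y >= 0 contains all vertices off the axis exactly when [t] is at least every
   element of [A] and at most every element of [B]. *)
pose A : seq R := [seq - s.1%:~R / s.2%:~R | s <- S & 0 < s.2].
pose B : seq R := [seq s.1%:~R / - s.2%:~R | s <- S & s.2 < 0].
have AB a b : a \in A -> b \in B -> a <= b.
  move=> /mapP[s + ->] /mapP[s' + ->]; rewrite !mem_filter => /andP[s2 sS] /andP[s2' s'S].
  have a0 : (0 : R) < s.2%:~R by rewrite ltr0z.
  have b0 : (0 : R) < - s'.2%:~R by rewrite oppr_gt0 ltrz0.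
  rewrite ler_pdivlMr // mulrAC ler_pdivrMr // -subr_ge0.
  have : 0 <= s.2 * s'.1 - s'.2 * s.1.
    by rewrite leNgt; apply/negP => h; apply: H1; exists s, s'.
  by rewrite -(ler0z R) !(intrB, intrM); lra.
have [t [ht1 ht2]] := separating_threshold AB.
have := lb_support (a := -1) (b := - t) (r := 0) lQ _ Qx.
suff H s : s \in S -> -1 * s.1%:~R + - t * s.2%:~R <= 0 by move=> /(_ H); lra.
move=> sS; have [s2|s2|s2] := ltgtP 0 s.2.
- have s2R : (0 : R) < s.2%:~R by rewrite ltr0z.
  have : - s.1%:~R / s.2%:~R <= t.
    by apply: ht1; apply/mapP; exists s; rewrite ?mem_filter ?s2.
  by rewrite ler_pdivrMr //; lra.
- have s2R : (0 : R) < - s.2%:~R by rewrite oppr_gt0 ltrz0.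
  have : t <= s.1%:~R / - s.2%:~R.
    by apply: ht2; apply/mapP; exists s; rewrite ?mem_filter ?s2.
  by rewrite ler_pdivlMr //; lra.
- rewrite -s2 mulr0 addr0 mulN1r oppr_le0 ler0z leNgt; apply/negP => s1.
  by apply: H0; exists s.
Qed.

Definition heights S (lo hi : int) := forall s, s \in S -> lo <= s.2 <= hi.

Lemma inner_height Q S E x (y lo hi : int) : lattice_body Q S E -> heights S lo hi ->
  inner Q x y%:~R -> lo < y < hi.
Proof.
move=> lQ hS ixy.
have [|s sS] := inner_support (a := 0) (b := 1) lQ ixy; first by rewrite xpair_eqE oner_eq0 andbF.
have [|s' s'S] := inner_support (a := 0) (b := -1) lQ ixy.
  by rewrite xpair_eqE oppr_eq0 oner_eq0 andbF.
rewrite !mul0r !add0r !mulN1r ltrN2 !mul1r !ltr_int => h h'.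
by have := hS _ sS; have := hS _ s'S; lia.
Qed.

(** A segment between vertices on both sides of the axis crosses it at a negative integer divided by
    its height difference. Unless it spans all of [lo, hi], that denominator is at most hi - lo - 1;
    if it does, its end points are the second alternative. *)
Lemma left_extension_span Q S E lo hi : lattice_body Q S E -> heights S lo hi ->
  inner Q 0 0 ->
  Q (- (hi - lo - 1)%:~R^-1) 0 \/
  exists a b : int, [/\ Q a%:~R hi%:~R, Q b%:~R lo%:~R & hi * b - lo * a < 0].
Proof.
move=> lQ hS i0; have cQ := lb_convex lQ; have Q0 := inner_sub i0.
have lohi : lo < 0 < hi by apply: (inner_height (x := 0) lQ hS).
have [e e0 he] := i0.
have Qe : Q (- (e / 2)) 0 by apply: he; rewrite subr0 ?normr0 // normrN gtr0_norm; lra.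
have reach x : x <= - (hi - lo - 1)%:~R^-1 -> Q x 0 -> Q (- (hi - lo - 1)%:~R^-1) 0.
  move=> xle Qx; apply: (convex2_between cQ Qx Q0); rewrite xle /= oppr_le0 invr_ge0 ler0z; lia.
have w1 : (1 : R) <= (hi - lo - 1)%:~R by rewrite -[1]/(1%:~R) ler_int; lia.
have w0 : (0 : R) < (hi - lo - 1)%:~R by lra.
have [|[s sS [s2 s1]]|[s [s' [sS s'S s2 s2' cr]]]] := left_crossing lQ Qe; first by lra.
  left; apply: (reach s.1%:~R); last by rewrite -[0]/(0%:~R) -s2; apply: (lb_vertex lQ).
  have : s.1%:~R <= (-1 : int)%:~R :> R by rewrite ler_int; lia.
  have : (hi - lo - 1)%:~R^-1 <= 1 :> R by rewrite invf_le1.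
  by rewrite intrN; lra.
have [hs hs'] := (hS _ sS, hS _ s'S).
have [/andP[/eqP sE /eqP sE']|ne] := boolP ((s.2 == hi) && (s'.2 == lo)).
  right; exists s.1, s'.1; split; rewrite -?sE -?sE' //; exact: (lb_vertex lQ).
left; pose d : R := (s.2 - s'.2)%:~R.
have d0 : 0 < d by rewrite ltr0z; lia.
have dle : d <= (hi - lo - 1)%:~R by rewrite ler_int; move: ne; lia.
apply: (reach ((s.2 * s'.1 - s'.2 * s.1)%:~R / d)).
  have : (s.2 * s'.1 - s'.2 * s.1)%:~R <= (-1 : int)%:~R :> R by rewrite ler_int; lia.
  rewrite intrN ler_pdivrMr // mulNr => h.
  have : (hi - lo - 1)%:~R^-1 * d <= 1 by rewrite mulrC ler_pdivrMr ?mul1r.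
  by lra.
apply: (convex_comb2 (t := - s'.2%:~R / d) cQ (lb_vertex lQ sS) (lb_vertex lQ s'S)).
- rewrite divr_ge0 ?ler_pdivrMr ?mul1r //; last exact: ltW.
    by rewrite /d intrB -subr_ge0 opprK subrK ler0z; lia.
  by rewrite -intrN ler0z; lia.
- by move: d0; rewrite /d !(intrB, intrM) => d0; field; exact: lt0r_neq0.
- by move: d0; rewrite /d !(intrB, intrM) => d0; field; exact: lt0r_neq0.
Qed.

Lemma left_extension Q S E lo hi : lattice_body Q S E -> heights S lo hi ->
  inner Q 0 0 -> Q (- (hi - lo)%:~R^-1) 0.
Proof.
move=> lQ hS i0; have cQ := lb_convex lQ; have Q0 := inner_sub i0.
have lohi : lo < 0 < hi by apply: (inner_height (x := 0) lQ hS).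
have w2 : (2%:~R : R) <= (hi - lo)%:~R by rewrite ler_int; lia.
have w0 : (0 : R) < (hi - lo)%:~R by lra.
have v0 : (0 : R) < (hi - lo)%:~R^-1 by rewrite invr_gt0.
case: (left_extension_span lQ hS i0) => [h|[a [b [Qa Qb ab]]]].
  apply: (convex2_between cQ h Q0); rewrite lerN2 oppr_le0 invr_ge0 [(_ - 1)%:~R]intrB.
  by rewrite lef_pV2 ?posrE; lra.
have h : (hi * b - lo * a)%:~R <= (-1 : int)%:~R :> R by rewrite ler_int; lia.
apply: (convex2_between (l := (hi * b - lo * a)%:~R / (hi - lo)%:~R) cQ _ Q0); last first.
  by rewrite ler_pdivrMr // mulNr mulVf ?gt_eqF //; lra.
apply: (convex_comb2 (t := - lo%:~R / (hi - lo)%:~R) cQ Qa Qb).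
- rewrite divr_ge0 ?ler_pdivrMr ?mul1r //; last exact: ltW.
    by rewrite -intrN ler_int; lia.
  by rewrite -intrN ler0z; lia.
- by move: w0; rewrite !(intrB, intrM) => d0; field; exact: lt0r_neq0.
- by move: w0; rewrite !(intrB, intrM) => d0; field; exact: lt0r_neq0.
Qed.

Lemma heights_pull T S lo hi (k : int) :
  (forall s, (frame_app (frame_inv T) s).2 = s.2 - k) -> heights S lo hi ->
  heights (map (frame_app (frame_inv T)) S) (lo - k) (hi - k).
Proof. by move=> h hS _ /mapP[s sS ->]; rewrite h !lerD2r; exact: hS. Qed.

Definition left_frame (a i : int) := Frame (a, i) (1, 0) (0, 1).
Definition right_frame (a i : int) := Frame (a, i) (-1, 0) (0, 1).

Lemma chord_inner Q S E lo hi (a b i : int) : lattice_body Q S E -> heights S lo hi ->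
  inner Q a%:~R i%:~R -> inner Q b%:~R i%:~R ->
  chord Q i%:~R ((b - a)%:~R + 2 / (hi - lo)%:~R).
Proof.
move=> lQ hS ia ib.
have w (k : int) : hi - k - (lo - k) = hi - lo by ring.
exists (a%:~R - (hi - lo)%:~R^-1), (b%:~R + (hi - lo)%:~R^-1); split.
- have u : unimodular (left_frame a i) by [].
  have i0 : inner (pull (left_frame a i) Q) 0 0.
    by apply: inner_pull_of; rewrite /= !(mulr1, mulr0, mul0r, addr0).
  have hh s : (frame_app (frame_inv (left_frame a i)) s).2 = s.2 - i.
    by case: s => s1 s2; rewrite /frame_app /= /frame_det /=; ring.
  have := left_extension (lattice_body_pull u lQ) (heights_pull hh hS) i0.
  by rewrite w /pull /= !(mulr1, mulr0, mul0r, addr0).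
- have u : unimodular (right_frame b i) by [].
  have i0 : inner (pull (right_frame b i) Q) 0 0.
    by apply: inner_pull_of; rewrite /= !(mulr1, mulr0, mul0r, addr0).
  have hh s : (frame_app (frame_inv (right_frame b i)) s).2 = s.2 - i.
    by case: s => s1 s2; rewrite /frame_app /= /frame_det /=; ring.
  have := left_extension (lattice_body_pull u lQ) (heights_pull hh hS) i0.
  by rewrite w /pull /= !(mulr1, mulr0, mul0r, addr0, mulrN1, opprK).
- by rewrite intrB; lra.
Qed.

(** If neither end gains the smaller denominator, segments of full span bound both ends and give
    chords at the heights [hi] and [lo]. Their mean with weights -lo and hi is at least [r] + 2/(hi
    - lo), so one of them is that long. *)
Lemma chord_inner_span Q S E lo hi (r : int) : lattice_body Q S E -> heights S lo hi ->
  inner Q 0 0 -> inner Q r%:~R 0 ->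
  [\/ chord Q 0 (r%:~R + (hi - lo)%:~R^-1 + (hi - lo - 1)%:~R^-1),
      chord Q hi%:~R (r%:~R + 2 / (hi - lo)%:~R) |
      chord Q lo%:~R (r%:~R + 2 / (hi - lo)%:~R)].
Proof.
move=> lQ hS ia ib; have cQ := lb_convex lQ.
have lohi : lo < 0 < hi by apply: (inner_height (x := 0) lQ hS).
have w2 : (2%:~R : R) <= (hi - lo)%:~R by rewrite ler_int; lia.
have Ql := left_extension lQ hS ia.
have u : unimodular (right_frame r 0) by [].
have hh s : (frame_app (frame_inv (right_frame r 0)) s).2 = s.2 - 0.
  by case: s => s1 s2; rewrite /frame_app /= /frame_det /=; ring.
have hS' := heights_pull hh hS; rewrite !subr0 in hS'.
have ib' : inner (pull (right_frame r 0) Q) 0 0.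
  by apply: inner_pull_of; rewrite /= !(mulr1, mulr0, mul0r, addr0).
have lQ' := lattice_body_pull u lQ.
have Qr := left_extension lQ' hS' ib'.
have pE x y : pull (right_frame r 0) Q x y = Q (r%:~R - x) y.
  by rewrite /pull /= !(mulr1, mulr0, mul0r, addr0, mulrN1, add0r).
rewrite pE opprK in Qr.
have vle : (hi - lo)%:~R^-1 <= (hi - lo - 1)%:~R^-1 :> R.
  by rewrite [(_ - 1)%:~R]intrB lef_pV2 ?posrE; lra.
case: (left_extension_span lQ hS ia) => [h|[a [b [Qa Qb ab]]]].
  by apply: Or31; do 2 eexists; split; [exact: h|exact: Qr|lra].
case: (left_extension_span lQ' hS' ib') => [|[a' [b' [Qa' Qb' ab']]]].
  by rewrite pE opprK => h; apply: Or31; do 2 eexists; split; [exact: Ql|exact: h|lra].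
rewrite !pE -!intrB in Qa' Qb'.
have key : r * (hi - lo) + 2 <= hi * (r - b' - b) - lo * (r - a' - a) by lia.
set w : R := (hi - lo)%:~R in w2 *.
have [h|h] := leP (r%:~R + 2 / w) (r - a' - a)%:~R.
  by apply: Or32; do 2 eexists; split; [exact: Qa|exact: Qa'|rewrite -intrB].
apply: Or33; do 2 eexists; split; [exact: Qb|exact: Qb'|rewrite -intrB].
rewrite leNgt; apply/negP => h'.
have : w * (r%:~R + 2 / w) <= hi%:~R * (r - b' - b)%:~R - lo%:~R * (r - a' - a)%:~R.
  have w0 : w != 0 by apply: lt0r_neq0; apply: lt_le_trans w2; rewrite ltr0z.
  rewrite mulrDr mulrCA mulfV // mulr1.
  by rewrite -!intrM -intrB (_ : 2 = 2%:~R) // -intrD ler_int; lia.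
have hi0 : (0 : R) < hi%:~R by rewrite ltr0z; lia.
have lo0 : (lo%:~R : R) < 0 by rewrite ltrz0; lia.
set z := r%:~R + _ in h h' *.
have -> : w * z = hi%:~R * z - lo%:~R * z by rewrite /w intrB; ring.
rewrite -(ltr_nM2l lo0) in h; rewrite -(ltr_pM2l hi0) in h'.
by rewrite leNgt => /negP; apply; lra.
Qed.

(* The section at height 1 of the triangle [(0, 0)], [(1, 0)], [(a, h)] is
   [[a / h, (a + h - 1) / h]], which contains an integer. *)
Lemma inner_band Q (a h : int) : convex2 Q -> inner Q 0 0 -> inner Q 1 0 ->
  Q a%:~R h%:~R -> 2 <= h -> exists j : int, inner Q j%:~R 1.
Proof.
move=> cQ i0 i1 Qa h2; pose j' := ((a + h - 1) %/ h)%Z; pose m := ((a + h - 1) %% h)%Z.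
have jE : a + h - 1 = j' * h + m by exact: divz_eq.
have m0 : 0 <= m by apply: modz_ge0; lia.
have mh : m < h by apply: ltz_pmod; lia.
exists j'.
have h0 : (0 : R) < h%:~R by rewrite ltr0z; lia.
have hn := lt0r_neq0 h0.
pose x : R := (h - 1 - m)%:~R / (h - 1)%:~R.
have h1 : (0 : R) < (h - 1)%:~R by rewrite ltr0z; lia.
have x01 : 0 <= x <= 1.
  by rewrite /x divr_ge0 ?ler0z ?ler_pdivrMr ?mul1r ?ler_int //; lia.
have ix : inner Q x 0 by apply: (inner_segment cQ i0 i1).
apply: (inner_comb (t := (h - 1)%:~R / h%:~R) cQ ix Qa).
- by rewrite divr_gt0 //= ler_pdivrMr // mul1r ler_int; lia.
- have -> : j'%:~R = (a + h - 1 - m)%:~R / h%:~R :> R.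
    by rewrite jE addrK intrM mulfK.
  move: h1; rewrite /x !(intrB, intrD) => h1; field.
  by rewrite hn; exact: lt0r_neq0.
- by rewrite intrB; field.
Qed.

End Extensions.

(** * Collinear interior lattice points *)

Section CollinearInterior.
Variable R : realType.
Implicit Types (Q : R -> R -> Prop) (c t x y : R) (S E : seq (int * int)) (T : frame).

(* The inverse of [1/2 + 1/(k+1)]. *)
Definition threshold (k : nat) : R := 2 * (k%:R + 1) / (k%:R + 3).

Lemma threshold_gt0 k : 0 < threshold k.
Proof. by rewrite divr_gt0 // ?mulr_gt0 // ltr_wpDl. Qed.

Lemma threshold_lt2 k : threshold k < 2.
Proof.
have k0 : 0 <= k%:R :> R by [].
by rewrite ltr_pdivrMr; lra.
Qed.

Lemma threshold_ltP k (A B : R) :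
  2 * (k%:R + 1) * A < (k%:R + 3) * B -> threshold k * A < B.
Proof.
have k0 : 0 <= k%:R :> R by [].
by move=> h; rewrite mulrAC ltr_pdivrMr; lra.
Qed.

Lemma threshold_le k m : (k <= m)%N -> threshold k <= threshold m.
Proof.
rewrite -(ler_nat R) => km; have k0 : 0 <= k%:R :> R by [].
have h1 : (0 : R) < k%:R + 3 by lra.
have h2 : (0 : R) < m%:R + 3 by lra.
rewrite -subr_ge0.
have -> : threshold m - threshold k = 4 * (m%:R - k%:R) / ((k%:R + 3) * (m%:R + 3)).
  by rewrite /threshold; field; rewrite !lt0r_neq0.
by rewrite divr_ge0 // mulr_ge0; lra.
Qed.

(* The direct sum, at the common point [(a, 0)], of the segments
   [[(-1, 0), (k, 0)]] and [[(a, -1), (a, 1)]]. *)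
Definition cross_sum Q k := exists2 a : int, -1 <= a <= k%:Z & forall x y, Q x y <->
  exists t (e f : R), [/\ 0 <= t <= 1, -1 - a%:~R <= e <= k%:R - a%:~R, -1 <= f <= 1,
    x = a%:~R + t * e & y = (1 - t) * f].

(** The dichotomy behind the equality case; the second alternative keeps the covering itself because
    the bound is still due there. *)
Definition small_or_cross Q k := scover Q (threshold k) \/
  tcover Q (threshold k) /\ exists2 T, unimodular T & cross_sum (pull T Q) k.

Lemma small_or_cross_pull T Q k : unimodular T ->
  small_or_cross (pull T Q) k -> small_or_cross Q k.
Proof.
move=> uT [/(scover_pull uT)|[/(tcover_pull uT) h [T' uT' cr]]]; first by left.
right; split=> //; exists (frame_comp T T'); first exact: unimodular_comp.
by rewrite -pull_comp.
Qed.

Definition flip_frame := Frame (0, 0) (1, 0) (0, -1).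
Definition shear_frame (a : int) := Frame (0, 0) (1, 0) (a, 1).

Lemma pull_right Q (a : int) x y : pull (right_frame a 0) Q x y = Q (a%:~R - x) y.
Proof. by rewrite /pull /= !(mulr1, mulr0, mul0r, addr0, mulrN1, add0r). Qed.

Lemma pull_flip Q x y : pull flip_frame Q x y = Q x (- y).
Proof. by rewrite /pull /= !(mulr1, mulr0, mul0r, addr0, mulrN1, add0r). Qed.

Lemma pull_shear Q (a : int) x y : pull (shear_frame a) Q x y = Q (x + y * a%:~R) y.
Proof. by rewrite /pull /= !(mulr1, mulr0, mul0r, addr0, mulrN1, add0r). Qed.

Lemma chord0 Q x y : Q x y -> chord Q y 0.
Proof. by move=> h; exists x, x; split; rewrite ?subrr. Qed.

Lemma chord_points Q x x' y d : Q x y -> Q x' y -> d <= x' - x -> chord Q y d.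
Proof. by move=> h h' dx; exists x, x'. Qed.

(* The constant [c] makes the chords at the heights [K / (K + 2)] and
   [- K / (K + 2)] have length exactly [c]. *)
Lemma small_triangle Q k : (2 <= k)%N -> convex2 Q -> Q 0 1 -> Q (-1) (-1) -> Q k%:R 0 ->
  scover Q (threshold k).
Proof.
rewrite -(ler_nat R) => k2 cQ QA QB QC; set K : R := k%:R in k2 QC *.
have K2 : 0 < K + 2 by lra.
have K2n := lt0r_neq0 K2.
pose c := (2 * K + 1) / (K + 2).
have left y : -1 <= y <= 1 -> Q (- (1 - y) / 2) y.
  by move=> y1; apply: (convex_comb2 (t := (1 + y) / 2) cQ QA QB); [|field..]; lra.
have up y : 0 <= y <= 1 -> Q (K * (1 - y)) y.
  by move=> y1; apply: (convex_comb2 (t := y) cQ QA QC); [|ring..]; lra.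
have dn y : 0 <= y <= 1 -> Q (K - (K + 1) * y) (- y).
  by move=> y1; apply: (convex_comb2 (t := y) cQ QB QC); [|ring..]; lra.
have e0 : K / (K + 2) - c = - ((K + 1) / (K + 2)) by rewrite /c; field.
have e1 : (K + 1) / (K + 2) - c = - (K / (K + 2)) by rewrite /c; field.
have b0 : 0 <= K / (K + 2) <= 1.
  by rewrite divr_ge0 ?ler_pdivrMr //=; lra.
have b1 : 0 <= (K + 1) / (K + 2) <= 1.
  by rewrite divr_ge0 ?ler_pdivrMr //=; lra.
have ge (u v w : R) : v - u = w / (K + 2) -> 0 <= w -> u <= v.
  by move=> uv w0; rewrite -subr_ge0 uv divr_ge0 //; lra.
exists c.
  have K3 : 0 < K + 3 by lra.
  rewrite -subr_gt0.
  have -> : c - threshold k = (K - 1) / ((K + 2) * (K + 3)).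
    by rewrite /threshold /c -/K; field; rewrite !lt0r_neq0.
  by rewrite divr_gt0 ?mulr_gt0 //; lra.
(* Modulo [c], chords of length [c] are missing only between the heights K/(K + 2) and (K + 1)/(K +
   2). *)
apply: (tcover_two_layers (j := 1) (y0 := K / (K + 2)) (y1 := (K + 1) / (K + 2)) cQ
  _ _ _ (left _ _) (up _ _) (left _ _) (up _ _) (left _ _) _ (left _ _) _
  (r0' := K - (K + 1) * ((K + 1) / (K + 2))) (r1' := K - (K + 1) * (K / (K + 2)))).
- by rewrite divr_gt0 //; lra.
- by rewrite e1; lra.
- by rewrite ler_pM2r ?invr_gt0 //; lra.
- by lra.
- exact: b0.
- by lra.
- exact: b1.
- by rewrite e0; lra.
- by rewrite e0; apply: dn.
- by rewrite e1; lra.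
- by rewrite e1; apply: dn.
- by apply: (ge _ _ 0) => //; rewrite /c; field.
- by apply: (ge _ _ 0) => //; rewrite e1 /c; field.
- by apply: (ge _ _ (K + 1/2)); [rewrite e0 /c; field|lra].
- by apply: (ge _ _ 0) => //; rewrite /c; field.
- by apply: (ge _ _ 0) => //; rewrite e1 /c; field.
- by apply: (ge _ _ (K + 1/2)); [rewrite /c; field|lra].
Qed.

(* The constant [c] is the largest one for which the two layers overlap at both
   extreme positions [d = 0] and [d = k] of the lower vertex. *)
Lemma small_skew_quadrangle Q k (d : int) : (2 <= k)%N -> convex2 Q -> 0 <= d <= k%:Z ->
  Q 0 1 -> Q (2 * d%:~R - 1) (-1) -> Q (-1) 0 -> Q k%:R 0 -> scover Q (threshold k).
Proof.
rewrite -(ler_nat R) => k2 cQ dk QA QB QL QR; set K : R := k%:R in k2 QR *.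
(* [b] is odd: the midpoint of the two apexes is (d - 1/2, 0), which is not a lattice point. *)
set b := 2 * d%:~R - 1 in QB.
have d0 : (0 : R) <= d%:~R by rewrite ler0z; lia.
have dK : (d%:~R : R) <= K by rewrite /K pmulrn ler_int; lia.
pose D := K ^+ 2 + 3 * K + 1.
have D0 : 0 < D by rewrite /D; nra.
have Dn := lt0r_neq0 D0.
(* The chords at the heights [th] and [- th] have length exactly [c], and [th + u = c] identifies
   [u] with [- th] modulo [c]. *)
pose c := (2 * K + 1) * (K + 1) / D; pose th := K * (K + 1) / D; pose u := (K + 1) ^+ 2 / D.
have thu : th + u = c by rewrite /th /u /c; field.
have th01 : 0 <= th <= 1.
  by rewrite /th divr_ge0 ?ler_pdivrMr //= ?mul1r /D; nra.
have u01 : 0 <= u <= 1.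
  by rewrite /u divr_ge0 ?ler_pdivrMr ?sqr_ge0 //= ?mul1r /D; nra.
have ul y : 0 <= y <= 1 -> Q (- (1 - y)) y.
  by move=> y1; apply: (convex_comb2 (t := y) cQ QA QL); [|ring..]; lra.
have ur y : 0 <= y <= 1 -> Q (K * (1 - y)) y.
  by move=> y1; apply: (convex_comb2 (t := y) cQ QA QR); [|ring..]; lra.
have dl y : 0 <= y <= 1 -> Q (- (1 - y) + b * y) (- y).
  by move=> y1; apply: (convex_comb2 (t := y) cQ QB QL); [|ring..]; lra.
have dr y : 0 <= y <= 1 -> Q (K * (1 - y) + b * y) (- y).
  by move=> y1; apply: (convex_comb2 (t := y) cQ QB QR); [|ring..]; lra.
have e0 : th - c = - u by lra.
have e1 : u - c = - th by lra.
have ge (p q w : R) : q - p = w / D -> 0 <= w -> p <= q.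
  by move=> uv w0; rewrite -subr_ge0 uv divr_ge0 //; lra.
have K1d : 0 <= (K + 1) * d%:~R by apply: mulr_ge0; lra.
have K1d' : 0 <= (K + 1) * (K - d%:~R) by apply: mulr_ge0; lra.
exists c.
  have K3 : 0 < K + 3 by lra.
  rewrite -subr_gt0.
  have -> : c - threshold k = (K + 1) ^+ 2 / (D * (K + 3)).
    by move: Dn; rewrite /threshold /c /D -/K => Dn; field; rewrite Dn lt0r_neq0.
  by rewrite divr_gt0 ?mulr_gt0 //; lra.
(* The shift [1 - d] leaves the margins (K + 1) (K - d) / D and (K + 1) d / D in the overlaps,
   nonnegative because 0 <= d <= K. *)
apply: (tcover_two_layers (j := 1 - d) (y0 := th) (y1 := u) cQ _ _ _
  (ul th th01) (ur th th01) (ul u u01) (ur u u01)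
  (l0' := - (1 - u) + b * u) (r0' := K * (1 - u) + b * u)
  (l1' := - (1 - th) + b * th) (r1' := K * (1 - th) + b * th)).
- by rewrite divr_gt0 // mulr_gt0 //; lra.
- by lra.
- by apply: (ge _ _ (K + 1)); [rewrite /th /u; field|lra].
- by rewrite e0; apply: dl.
- by rewrite e0; apply: dr.
- by rewrite e1; apply: dl.
- by rewrite e1; apply: dr.
- by apply: (ge _ _ 0) => //; rewrite /th /c /D; field.
- by apply: (ge _ _ 0) => //; rewrite /th /c /D; field.
- by apply: (ge _ _ ((K + 1) * (K - d%:~R))) => //; rewrite intrB /th /u /c /b /D; field.
- by apply: (ge _ _ ((K + 1) * d%:~R)) => //; rewrite intrB /th /u /c /b /D; field.
- by apply: (ge _ _ ((K + 1) * d%:~R)) => //; rewrite intrB /th /u /c /b /D; field.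
- by apply: (ge _ _ ((K + 1) * (K - d%:~R))) => //; rewrite intrB /th /u /c /b /D; field.
Qed.

(** The unit chord at height 1 makes the chords above the axis shrink more slowly than in the
    rhombus, where the threshold is attained exactly. *)
Lemma small_two_tops Q k (b t : R) : (2 <= k)%N -> convex2 Q ->
  Q (-1) 0 -> Q k%:R 0 -> Q b (-1) -> Q t 1 -> Q (t + 1) 1 -> scover Q (threshold k).
Proof.
move=> k2 cQ QL QR Qb Qt Qt'; have := k2; rewrite -(ler_nat R) => k2'.
set K : R := k%:R in k2' QR.
have c1 : 1 < threshold k by rewrite ltr_pdivlMr -/K; lra.
have cE : threshold k * (K + 3) = 2 * (K + 1) by rewrite divfK //; apply: lt0r_neq0; lra.
apply: (scover_two_slopes (h0 := -1) (h1 := 0) (h2 := 1) (L := K + 1) (L' := 1) cQ) => //.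
- exact: threshold_gt0.
- by have := threshold_lt2 k; lra.
- by lra.
- exact: chord0 Qb.
- by apply: (chord_points QL QR); lra.
- by apply: (chord_points Qt Qt'); lra.
set c := threshold k in c1 cE *.
have -> : (1 - 0) * (K + 1 - c) / (K + 1 - 1) + (0 - -1) * (1 - c / (K + 1)) =
  c + ((K + 1 - c) + (2 * (K + 1) - c * (K + 3)) * K) / (K * (K + 1)).
  by field; rewrite !lt0r_neq0 //; lra.
rewrite -cE subrr mul0r addr0 ltrDl divr_gt0 ?mulr_gt0 //; try lra.
have := threshold_lt2 k; rewrite -/c; lra.
Qed.

(** Both ends of the chord on the axis are half-integral, so it has length K. The chords at heights
    1 and -1 have total length 2K, so one of them also reaches K and bounds a plateau of height
    1. *)
Lemma small_trapezoid Q k (t b t' b' : R) : (2 <= k)%N -> convex2 Q ->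
  Q t 1 -> Q b (-1) -> t + b = -1 -> Q t' 1 -> Q b' (-1) -> t' + b' = 2 * k%:R - 1 ->
  scover Q (threshold k).
Proof.
rewrite -(ler_nat R) => k2 cQ Qt Qb tb Qt' Qb' tb'; set K : R := k%:R in k2 tb'.
have c0 := threshold_gt0 k; have c2 := threshold_lt2 k.
have Ql : Q (- (1/2)) 0.
  by apply: (convex_comb2 (t := 1/2) cQ Qt Qb); lra.
have Qr : Q (K - 1/2) 0.
  by apply: (convex_comb2 (t := 1/2) cQ Qt' Qb'); lra.
have h0 : chord Q 0 K by apply: (chord_points Ql Qr); lra.
have key : threshold k * (K + (1 - -1) - (1 - 0)) < (1 - -1) * K.
  by apply: threshold_ltP; rewrite -/K; nra.
have [h|h] := leP K (t' - t).
  have h1 : chord Q 1 K by apply: (chord_points Qt Qt').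
  by apply: (scover_trapezoid (L := K) cQ _ _ (chord0 Qb) h0 h1 (chord0 Qt)); lra.
have h1 : chord Q (-1) K by apply: (chord_points Qb Qb'); lra.
by apply: (scover_trapezoid (L := K) cQ _ _ (chord0 Qb) h1 h0 (chord0 Qt)); lra.
Qed.

End CollinearInterior.

(** * Ends of the long chord, parity of the apexes and the equality case *)

Section CollinearCase.
Variable R : realType.
Implicit Types (Q : R -> R -> Prop) (c t x y : R) (L S E : seq (int * int)) (T : frame).

Lemma inner_band_exists Q S E T (z : int * int) : unimodular T -> lattice_body Q S E ->
  frame_app T (0, 0) \in E -> frame_app T (1, 0) \in E -> Q z.1%:~R z.2%:~R ->
  2 <= (frame_app (frame_inv T) z).2 ->
  exists2 e, e \in E & (frame_app (frame_inv T) e).2 = 1.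
Proof.
move=> uT lQ e0 e1 Qz h2; have lQ' := lattice_body_pull uT lQ.
have i0 : inner (pull T Q) 0 0.
  by apply/(inner_pull_app Q (0, 0) uT)/(lb_inner lQ).
have i1 : inner (pull T Q) 1 0.
  by apply/(inner_pull_app Q (1, 0) uT)/(lb_inner lQ).
have := Qz; rewrite -(frame_invK uT z) -pull_app.
move: h2; case: (frame_app (frame_inv T) z) => a h /= h2 Qah.
have [j] := inner_band (lb_convex lQ') i0 i1 Qah h2.
move=> /(lb_inner lQ' (j, 1))/mapP[e eE eq]; exists e => //.
exact: (esym (congr1 snd eq)).
Qed.

(** By [inner_band], a vertex beyond row 1 would force an interior lattice point in row 1. The
    hypothesis on the list is boolean so that it can be decided by computation on explicit lists. *)
Lemma vertex_band Q S E (L : seq (int * int)) T (s : int * int) :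
  unimodular T -> lattice_body Q S E -> E =i L ->
  [&& frame_app T (0, 0) \in L, frame_app T (1, 0) \in L &
      all (fun e => (frame_app (frame_inv T) e).2 != 1) L] ->
  s \in S -> (frame_app (frame_inv T) s).2 <= 1.
Proof.
move=> uT lQ hE /and3P[]; rewrite -!hE => e0 e1 /allP hL sS; rewrite leNgt; apply/negP => h.
have h2 : 2 <= (frame_app (frame_inv T) s).2 by exact: h.
have [e eE e1'] := inner_band_exists uT lQ e0 e1 (lb_vertex lQ sS) h2.
by rewrite hE in eE; have := hL e eE; rewrite e1' eqxx.
Qed.

Lemma flip_app (z : int * int) : frame_app (frame_inv flip_frame) z = (z.1, - z.2).
Proof. by case: z => a b; rewrite /frame_app /= /frame_det /=; congr (_, _); ring. Qed.

Lemma right_app (r : int) (z : int * int) :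
  frame_app (frame_inv (right_frame r 0)) z = (r - z.1, z.2).
Proof. by case: z => a b; rewrite /frame_app /= /frame_det /=; congr (_, _); ring. Qed.

Lemma shear_app (r : int) (z : int * int) :
  frame_app (frame_inv (shear_frame r)) z = (z.1 - r * z.2, z.2).
Proof. by case: z => a b; rewrite /frame_app /= /frame_det /=; congr (_, _); ring. Qed.

Lemma unimodular_flip : unimodular flip_frame. Proof. by []. Qed.
Lemma unimodular_right r i : unimodular (right_frame r i). Proof. by []. Qed.
Lemma unimodular_shear r : unimodular (shear_frame r).
Proof. by rewrite /unimodular /frame_det /= mul0r subr0. Qed.

Lemma inner_flip Q x : inner Q x 0 -> inner (pull flip_frame Q) x 0.
Proof.
move=> h; apply: inner_pull_of; move: h.
by rewrite /= !(mulr1, mulr0, mul0r, addr0, mulrN1, add0r).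
Qed.

Lemma inner_right Q (r : int) x : inner Q (r%:~R - x) 0 -> inner (pull (right_frame r 0) Q) x 0.
Proof.
move=> h; apply: inner_pull_of; move: h.
by rewrite /= !(mulr1, mulr0, mul0r, addr0, mulrN1, add0r).
Qed.

(** Inside |y| <= 1 a segment crossing the axis joins heights 1 and -1 and meets it at half an
    integer: either at -1 or further left, or at -1/2. *)
Lemma left_end_flat Q S E : lattice_body Q S E -> heights S (-1) 1 -> inner Q 0 0 ->
  Q (-1) 0 \/ exists t b : int, [/\ Q t%:~R 1, Q b%:~R (-1) & t + b = -1].
Proof.
move=> lQ hS i0; have cQ := lb_convex lQ; have Q0 := inner_sub i0.
have [e e0 he] := i0.
have Qe : Q (- (e / 2)) 0 by apply: he; rewrite subr0 ?normr0 // normrN gtr0_norm; lra.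
have reach (a : int) : a <= - 2 -> Q (a%:~R / 2) 0 -> Q (-1) 0.
  rewrite -(ler_int R) intrN => a2 Qa.
  by apply: (convex2_between cQ Qa Q0); lra.
have [|[s sS [s2 s1]]|[s [s' [sS s'S s2 s2' cr]]]] := left_crossing lQ Qe; first by lra.
  left; apply: (reach (2 * s.1)); first by lia.
  have -> : (2 * s.1)%:~R / 2 = s.1%:~R :> R by rewrite intrM mulrC mulKf.
  by have := lb_vertex lQ sS; rewrite s2.
have [hs hs'] := (hS _ sS, hS _ s'S).
have [sE sE'] : s.2 = 1 /\ s'.2 = -1 by lia.
have Qs : Q s.1%:~R 1 by have := lb_vertex lQ sS; rewrite sE.
have Qs' : Q s'.1%:~R (-1) by have := lb_vertex lQ s'S; rewrite sE' intrN.
rewrite sE sE' in cr.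
have [h|h] := leP (s.1 + s'.1) (-2).
  left; apply: (reach (s.1 + s'.1)) => //.
  by apply: (convex_comb2 (t := 1/2) cQ Qs Qs'); rewrite ?intrD; lra.
by right; exists s.1, s'.1; split=> //; lia.
Qed.

Lemma right_end_flat Q S E (r : int) : lattice_body Q S E -> heights S (-1) 1 ->
  inner Q r%:~R 0 ->
  Q (r%:~R + 1) 0 \/ exists t b : int, [/\ Q t%:~R 1, Q b%:~R (-1) & t + b = 2 * r + 1].
Proof.
move=> lQ hS ir; have u := unimodular_right r 0.
have hS' : heights (map (frame_app (frame_inv (right_frame r 0))) S) (-1) 1.
  by move=> _ /mapP[s sS ->]; rewrite right_app /=; exact: hS.
have i0 : inner (pull (right_frame r 0) Q) 0 0 by apply: inner_right; rewrite subr0.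
case: (left_end_flat (lattice_body_pull u lQ) hS' i0) => [|[t [b [Qt Qb tb]]]].
  by rewrite pull_right opprK; left.
right; exists (r - t), (r - b); rewrite !intrB; split.
- by rewrite pull_right in Qt.
- by rewrite pull_right in Qb.
- by lia.
Qed.

(** A point of height y gets weight 1 - |y| on the horizontal segment and |y| at the apex on its
    side of the axis; the supporting half-planes keep its horizontal part within the segment. *)
Lemma cross_sumP Q S E k (a : int) : lattice_body Q S E -> -1 <= a <= k%:Z ->
  (forall s, s \in S -> s = (a, 1) \/ s = (a, -1) \/ s.2 = 0 /\ -1 <= s.1 <= k%:Z) ->
  Q (-1) 0 -> Q k%:R 0 -> Q a%:~R 1 -> Q a%:~R (-1) -> cross_sum Q k.
Proof.
move=> lQ ak SE QL QR Qt Qb; have cQ := lb_convex lQ.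
set K : R := k%:R in QR.
have a1 : -1 <= a%:~R :> R by rewrite -[-1](intrN R 1) ler_int; lia.
have aK : a%:~R <= K by rewrite /K pmulrn ler_int; lia.
exists a => // x y; rewrite -/K; split; last first.
  move=> [t [e [f [t01 eK f1 -> ->]]]].
  have Qe : Q (a%:~R + e) 0 by apply: (convex2_between cQ QL QR); lra.
  have Qf : Q a%:~R f.
    by apply: (convex_comb2 (t := (1 + f) / 2) cQ Qt Qb); lra.
  by apply: (convex_comb2 (t := t) cQ Qe Qf) => //; ring.
move=> Qxy.
have face (u v w : R) : u * -1 <= w -> u * K <= w ->
    u * a%:~R + v <= w -> u * a%:~R - v <= w -> u * x + v * y <= w.
  move=> hL hR ht hb; apply: (lb_support lQ _ Qxy) => s sS.
  case: (SE s sS) => [->|[->|[s2 s1]]]; rewrite /= ?mulr1 //.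
    by rewrite intrN mulrN mulr1.
  rewrite s2 mulr0 addr0.
  have s1R : -1 <= s.1%:~R :> R by rewrite -[-1](intrN R 1) ler_int; lia.
  have s1K : s.1%:~R <= K by rewrite /K pmulrn ler_int; lia.
  have [u0|u0] := leP 0 u.
    by apply: le_trans hR; rewrite ler_wpM2l.
  by apply: le_trans hL; rewrite ler_wnM2l // ltW.
(* The strip |y| <= 1 and the four lines joining (-1, 0) and (K, 0) to the apexes (a, 1) and (a,
   -1). *)
have f1 := face 0 1 1; have f2 := face 0 (-1) 1.
have f3 := face (-1) (a%:~R + 1) 1; have f4 := face (-1) (- (a%:~R + 1)) 1.
have f5 := face 1 (K - a%:~R) K; have f6 := face 1 (- (K - a%:~R)) K.
have {}f1 : y <= 1 by lra.
have {}f2 : -1 <= y by lra.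
have {}f3 : - x + (a%:~R + 1) * y <= 1 by lra.
have {}f4 : - x - (a%:~R + 1) * y <= 1 by lra.
have {}f5 : x + (K - a%:~R) * y <= K by lra.
have {}f6 : x - (K - a%:~R) * y <= K by lra.
pose f : R := if 0 <= y then 1 else -1.
have fy : f * y = `|y|.
  by rewrite /f; case: ger0P => _; rewrite ?mul1r ?mulN1r.
have ff : f * f = 1 by rewrite /f; case: ifP => _; rewrite ?mulr1 ?mulrN1 ?opprK.
have yn : `|y| <= 1 by rewrite ler_norml f2.
have yE : y = `|y| * f by rewrite -fy mulrAC ff mul1r.
have f7 : (a%:~R + 1) * `|y| - 1 <= x by rewrite -fy /f; case: ifP => _; lra.
have f8 : x <= K - (K - a%:~R) * `|y| by rewrite -fy /f; case: ifP => _; lra.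
have [y1|y1] := eqVneq `|y| 1.
  exists 0, 0, f; split; try lra.
  - by rewrite /f; case: ifP => _; lra.
  - by rewrite y1 in f7 f8; lra.
  - by rewrite {1}yE y1; ring.
have y0 : 0 < 1 - `|y| by rewrite subr_gt0 lt_neqAle y1.
have nn := normr_ge0 y.
exists (1 - `|y|), ((x - a%:~R) / (1 - `|y|)), f; split.
- by lra.
- by rewrite ler_pdivlMr // ler_pdivrMr //; lra.
- by rewrite /f; case: ifP => _; lra.
- by field; exact: lt0r_neq0.
- by rewrite {1}yE; ring.
Qed.

Lemma collinear_case Q S E k : (2 <= k)%N -> lattice_body Q S E ->
  inner Q 0 0 -> inner Q (k%:R - 1) 0 ->
  (forall z, z \in E -> z.2 = 0 /\ 0 <= z.1 < k%:Z) -> small_or_cross Q k.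
Proof.
move=> k2 lQ i0 ik hE; have cQ := lb_convex lQ.
have k2R : 2 <= k%:R :> R by rewrite (ler_nat R 2).
have i1 : inner Q 1 0 by apply: (inner_segment cQ i0 ik); lra.
have hS : heights S (-1) 1.
  have e0 : (0, 0) \in E by apply/(lb_inner lQ).
  have e1 : (1, 0) \in E by apply/(lb_inner lQ).
  move=> s sS; apply/andP; split.
    have := vertex_band (T := flip_frame) erefl lQ (fun _ => erefl) _ sS.
    rewrite [frame_app _ s]flip_app lerNl; apply.
    by rewrite e0 e1; apply/allP => z /hE[z2 _]; rewrite flip_app /= z2.
  have := vertex_band (T := Frame (0, 0) (1, 0) (0, 1)) erefl lQ (fun _ => erefl) _ sS.
  have idE (z : int * int) : frame_app (frame_inv (Frame (0, 0) (1, 0) (0, 1))) z = z.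
    by case: z => a b; rewrite /frame_app /= /frame_det /=; congr (_, _); ring.
  rewrite [frame_app _ s]idE; apply.
  by rewrite e0 e1; apply/allP => z /hE[z2 _]; rewrite idE z2.
(* A point of the axis beyond (-1, 0) or (k, 0) would make that lattice point interior. *)
have axis x : Q x 0 -> -1 <= x <= k%:R.
  move=> Qx; apply/andP; split; rewrite leNgt; apply/negP => hx.
    have : inner Q (-1) 0.
      apply: (inner_comb (t := (x + 1) / x) cQ i0 Qx); last by ring.
        by rewrite -mulrNN -invrN divr_gt0 ?ler_pdivrMr; lra.
      by field; rewrite ltr0_neq0 //; lra.
    rewrite -[-1](intrN R 1) -[0]/(0%:~R).
    by move=> /(lb_inner lQ (-1, 0))/hE[_ /=]; lia.
  have : inner Q k%:R 0.
    apply: (inner_comb (t := (x - k%:R) / (x - (k%:R - 1))) cQ ik Qx).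
    - by rewrite divr_gt0 ?ler_pdivrMr; lra.
    - by field; rewrite lt0r_neq0 //; lra.
    - by ring.
  rewrite [k%:R]pmulrn -[0]/(0%:~R).
  by move=> /(lb_inner lQ (k%:Z, 0))/hE[_ /=]; lia.
have [top topS topP] : exists2 s, s \in S & s.2 = 1.
  have [|s sS] := inner_support (a := 0) (b := 1) lQ i0.
    by rewrite xpair_eqE oner_eq0 andbF.
  rewrite !mul0r mulr0 !add0r mul1r ltr0z => s0; exists s => //.
  by have := hS s sS; lia.
have [bot botS botP] : exists2 s, s \in S & s.2 = -1.
  have [|s sS] := inner_support (a := 0) (b := -1) lQ i0.
    by rewrite xpair_eqE oppr_eq0 oner_eq0 andbF.
  rewrite !mul0r mulr0 !add0r mulN1r oppr_gt0 ltrz0 => s0; exists s => //.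
  by have := hS s sS; lia.
pose t := top.1; pose b := bot.1.
have Qt : Q t%:~R 1 by have := lb_vertex lQ topS; rewrite topP.
have Qb : Q b%:~R (-1) by have := lb_vertex lQ botS; rewrite botP intrN.
have ir : inner Q (k%:Z - 1)%:~R 0 by rewrite intrB.
have rE : (k%:Z - 1)%:~R + 1 = k%:R :> R by rewrite intrB subrK.
case: (left_end_flat lQ hS i0) => [QL|[tl [bl [Qtl Qbl tbl]]]]; last first.
  left; case: (right_end_flat lQ hS ir) => [|[tr [br [Qtr Qbr tbr]]]].
    rewrite rE => QR.
    apply: (scover_pull (unimodular_shear tl)).
    apply: small_triangle => //; first exact: pull_convex.
    - by rewrite pull_shear mul1r add0r.
    - rewrite pull_shear; congr Q: Qbl; rewrite mulN1r.
      by have -> : bl = - 1 - tl by [lia]; rewrite intrB intrN.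
    - by rewrite pull_shear mul0r addr0.
  apply: (small_trapezoid k2 cQ Qtl Qbl _ Qtr Qbr).
    by rewrite -intrD tbl.
  by rewrite -intrD tbr intrD intrM intrB; ring.
case: (right_end_flat lQ hS ir) => [|[tr [br [Qtr Qbr tbr]]]]; last first.
  left; apply: (scover_pull (unimodular_right (k%:Z - 1) 0)).
  apply: (scover_pull (unimodular_shear (k%:Z - 1 - tr))).
  apply: small_triangle => //; first by do 2 apply: pull_convex.
  - rewrite pull_shear pull_right; congr Q: Qtr; rewrite !intrB; ring.
  - rewrite pull_shear pull_right; congr Q: Qbr.
    have -> : br = 2 * k%:Z - 1 - tr by lia.
    by rewrite !(intrB, intrM) /=; ring.
  - rewrite pull_shear pull_right mul0r addr0; congr Q: QL.
    by rewrite intrB; ring.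
rewrite rE => QR.
(* With two lattice end points the chord of length k + 1 and the height 2 give exactly the
   threshold. *)
have tcov : tcover Q (threshold R k).
  have h : chord Q 0 (k%:R + 1) by apply: (chord_points QL QR); lra.
  apply: (tcover_trapezoid cQ _ _ (chord0 Qb) h h (chord0 Qt)).
  - exact: threshold_gt0.
  - by have := threshold_lt2 R k; lra.
  - rewrite /threshold le_eqVlt; apply/orP; left; apply/eqP; field.
    by rewrite lt0r_neq0 //; lra.
have neighbours (Q' : R -> R -> Prop) (u v : int) : convex2 Q' -> u <> v ->
    Q' u%:~R 1 -> Q' v%:~R 1 -> exists2 m : R, Q' m 1 & Q' (m + 1) 1.
  move=> cQ' uv Qu Qv; have [h|h] := leP (u + 1) v.
    exists u%:~R => //; apply: (convex2_between cQ' Qu Qv).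
    by rewrite lerDl ler01 -[1]/(1%:~R) -intrD ler_int.
  exists v%:~R => //; apply: (convex2_between cQ' Qv Qu).
  by rewrite lerDl ler01 -[1]/(1%:~R) -intrD ler_int; lia.
have [[s [sS s2 st]]|notop] := pselect (exists s, [/\ s \in S, s.2 = 1 & s.1 <> t]).
  have Qs : Q s.1%:~R 1 by have := lb_vertex lQ sS; rewrite s2.
  have [m Qm Qm'] := neighbours Q _ _ cQ st Qs Qt.
  by left; apply: (small_two_tops k2 cQ QL QR Qb Qm Qm').
have [[s [sS s2 sb]]|nobot] := pselect (exists s, [/\ s \in S, s.2 = -1 & s.1 <> b]).
  have Qs : Q s.1%:~R (-1) by have := lb_vertex lQ sS; rewrite s2 intrN.
  left; apply: (scover_pull unimodular_flip).
  have cQ' : convex2 (pull flip_frame Q) by exact: pull_convex.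
  have [m Qm Qm'] : exists2 m : R, pull flip_frame Q m 1 & pull flip_frame Q (m + 1) 1.
    by apply: (neighbours _ _ _ cQ' sb); rewrite pull_flip.
  by apply: (small_two_tops (b := t%:~R) k2 cQ' _ _ _ Qm Qm'); rewrite pull_flip ?oppr0 ?opprK.
have SE s : s \in S -> s = (t, 1) \/ s = (b, -1) \/ s.2 = 0 /\ -1 <= s.1 <= k%:Z.
  move=> sS; have hs := hS s sS; have Qs := lb_vertex lQ sS.
  case: s sS hs Qs => s1 s2 /= sS hs Qs.
  have [E1|n1] := eqVneq s2 1.
    by left; congr (_, _) => //; apply: contrapT => h; apply: notop; exists (s1, s2).
  have [E2|n2] := eqVneq s2 (-1).
    by right; left; congr (_, _) => //; apply: contrapT => h; apply: nobot; exists (s1, s2).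
  right; right; have s0 : s2 = 0 by lia.
  split=> //; rewrite s0 in Qs; have /andP[] := axis _ Qs.
  by rewrite -[-1](intrN R 1) [k%:R]pmulrn !ler_int => -> ->.
(* The midpoint of the apexes lies on the axis, which confines [t + b] and hence the integer [a]
   below. *)
have mid : -1 <= (t%:~R + b%:~R : R) / 2 <= k%:R.
  by apply: axis; apply: (convex_comb2 (t := 1/2) cQ Qt Qb); lra.
have tb1 : - 2 <= t + b.
  by rewrite -(ler_int R) intrD intrN; lra.
have tb2 : t + b <= 2 * k%:Z.
  by rewrite -(ler_int R) intrD intrM -pmulrn; lra.
(* The parity of [t + b] decides: a lattice midpoint gives the direct sum, a half-integral one the
   skew quadrangle. *)
have [a [aE|aE]] : exists a : int, t + b = 2 * a \/ t + b = 2 * a - 1.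
- by exists ((t + b + 1) %/ 2)%Z; lia.
- right; split=> //; exists (shear_frame (t - a)); first exact: unimodular_shear.
  have lQ' := lattice_body_pull (unimodular_shear (t - a)) lQ.
  apply: (cross_sumP (a := a) lQ'); rewrite ?pull_shear ?mul0r ?addr0 //.
  + by lia.
  + move=> _ /mapP[s sS ->]; rewrite shear_app.
    case: (SE s sS) => [->|[->|[s2 s1]]] /=.
    * by left; congr (_, _); ring.
    * by right; left; congr (_, _); lia.
    * by right; right; rewrite s2 mulr0 subr0.
  + by congr Q: Qt; rewrite intrB; ring.
  + by congr Q: Qb; have -> : b = 2 * a - t by [lia]; rewrite !(intrB, intrM); ring.
- left; apply: (scover_pull (unimodular_shear t)).
  apply: (small_skew_quadrangle (d := a) k2); rewrite ?pull_shear ?mul0r ?addr0 //.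
  + exact: pull_convex.
  + by lia.
  + by rewrite mul1r add0r.
  + by congr Q: Qb; have -> : b = 2 * a - 1 - t by [lia]; rewrite !(intrB, intrM); ring.
Qed.

End CollinearCase.

(** * At least four interior lattice points on a line *)

Lemma size_int_range (s : seq int) (a b : int) : uniq s ->
  (forall x, x \in s -> a <= x <= b) -> (size s <= (absz (b - a)%R).+1)%N.
Proof.
move=> us h; have [ab|ba] := leP a b; last first.
  by case: s us h => // x s _ /(_ x (mem_head _ _)); lia.
have : {subset s <= [seq a + i%:Z | i <- iota 0 (absz (b - a)).+1]}.
  move=> x /h xab; apply/mapP; exists (absz (x - a)%R); last by lia.
  by rewrite mem_iota; lia.
by move=> /(uniq_leq_size us); rewrite size_map size_iota.
Qed.

Definition row (E : seq (int * int)) (h : int) := count (fun e => e.2 == h) E.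

Lemma size_rows (hs : seq int) (E : seq (int * int)) c :
  (forall e, e \in E -> e.2 \in hs) -> (forall h, h \in hs -> (row E h <= c)%N) ->
  (size E <= c * size hs)%N.
Proof.
elim: hs E => [|h hs IH] E hE hc.
  by case: E hE {hc} => // e E /(_ e (mem_head _ _)).
rewrite -(count_predC (fun e => e.2 == h)) /= mulnS leq_add ?hc ?mem_head //.
rewrite -size_filter; apply: IH => [e|h' h'hs].
  by rewrite mem_filter => /andP[/= /negPf eh /hE]; rewrite inE eh.
apply: leq_trans (hc h' _); last by rewrite inE h'hs orbT.
by rewrite /row count_filter; apply: sub_count => e /= /andP[].
Qed.

Section Rows.
Variable R : realType.
Implicit Types (Q : R -> R -> Prop) (c t x y L : R) (S E : seq (int * int)) (T : frame).

(** Some line, in any lattice direction, carries [n + 1] consecutive interior lattice points. *)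
Definition collinear_inner Q (n : nat) := exists T,
  [/\ unimodular T, inner (pull T Q) 0 0 & inner (pull T Q) n%:R 0].

Lemma row_extent Q S E (h : int) : lattice_body Q S E -> (0 < row E h)%N ->
  exists a b : int, [/\ inner Q a%:~R h%:~R, inner Q b%:~R h%:~R &
    (row E h)%:Z - 1 <= b - a].
Proof.
move=> lQ r0; pose F := [seq e.1 | e <- E & e.2 == h].
have FE (x : int) : x \in F -> inner Q x%:~R h%:~R.
  case/mapP=> -[u v]; rewrite mem_filter /= => /andP[/eqP -> uE] ->.
  exact: (lb_inner lQ (u, h)).1 uE.
have sF : size F = row E h by rewrite size_map size_filter.
have uF : uniq F.
  rewrite map_inj_in_uniq ?filter_uniq ?(lb_uniq lQ) //.
  move=> [u v] [u' v']; rewrite !mem_filter /= => /andP[/eqP -> _] /andP[/eqP -> _].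
  by move=> ->.
have [x xF] : exists x : int, x \in F.
  by case: F sF {FE uF} => [/= e|x F _]; [rewrite -e in r0|exists x; exact: mem_head].
have [b bF hb] := seq_argmax id xF.
have [a aF ha] := seq_argmax (fun z : int => - z) xF.
exists a, b; split; [exact: FE|exact: FE|].
have := @size_int_range F a b uF _; rewrite sF.
have ab : a <= b by exact: hb.
have h' z : z \in F -> a <= z <= b by move=> zF; rewrite hb // -lerN2 ha.
by move=> /(_ h'); lia.
Qed.

Lemma row_chord Q S E lo hi (h : int) : lattice_body Q S E -> heights S lo hi ->
  (0 < row E h)%N -> chord Q h%:~R ((row E h)%:R - 1 + 2 / (hi - lo)%:~R).
Proof.
move=> lQ hS /(row_extent lQ)[a [b [ia ib ab]]].
apply: chordW (chord_inner lQ hS ia ib) _.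
by rewrite lerD2r pmulrn -[1]/(1%:~R) -intrB ler_int.
Qed.

Lemma row_le Q S E r (h : int) : lattice_body Q S E ->
  (forall n, collinear_inner Q n -> (n <= r)%N) -> (row E h <= r.+1)%N.
Proof.
move=> lQ hr; have [->//|r0] := posnP (row E h).
have [a [b [ia ib ab]]] := row_extent lQ r0.
have ba : (b - a)%:~R = (absz (b - a))%:R :> R by rewrite pmulrn; congr intr; lia.
suff : collinear_inner Q (absz (b - a)) by move=> /hr; lia.
exists (left_frame a h); split=> //; apply: inner_pull_of => /=.
  by rewrite !(mulr1, mulr0, mul0r, addr0).
by rewrite !(mulr1, mulr0, mul0r, addr0) -ba intrB addrC subrK.
Qed.

Definition inner_rows (lo hi : int) : seq int :=
  [seq lo + 1 + i%:Z | i <- iota 0 (absz (hi - lo)).-1].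

Lemma mem_inner_rows (lo hi h : int) : lo <= hi -> (h \in inner_rows lo hi) = (lo < h < hi).
Proof.
move=> lohi; apply/mapP/idP => [[i]|lh]; first by rewrite mem_iota => ih ->; lia.
by exists (absz (h - lo - 1)%R); [rewrite mem_iota; lia|lia].
Qed.

Lemma uniq_inner_rows lo hi : uniq (inner_rows lo hi).
Proof. by rewrite map_inj_uniq ?iota_uniq // => i j; lia. Qed.

Lemma size_inner_rows lo hi : size (inner_rows lo hi) = (absz (hi - lo)).-1.
Proof. by rewrite size_map size_iota. Qed.

Lemma inner_in_rows Q S E lo hi e : lattice_body Q S E -> heights S lo hi ->
  e \in E -> e.2 \in inner_rows lo hi.
Proof.
move=> lQ hS /(lb_inner lQ)/(inner_height lQ hS) ie.
by rewrite mem_inner_rows //; lia.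
Qed.

Lemma scoverW Q c c' : scover Q c' -> c <= c' -> scover Q c.
Proof. by move=> [d cd h] cc; exists d => //; lra. Qed.

Lemma scover_diamond Q (lo hi : R) L k : convex2 Q -> lo < 0 -> 0 < hi -> threshold R k < L ->
  chord Q lo 0 -> chord Q 0 L -> chord Q hi 0 ->
  2 * (k%:R + 1) * (L + (hi - lo)) < (k%:R + 3) * ((hi - lo) * L) -> scover Q (threshold R k).
Proof.
move=> cQ lo0 hi0 tL h0 h1 h2 H.
have t0 := threshold_gt0 R k.
apply: (scover_trapezoid (L := L) cQ t0 tL h0 h1 h1 h2); first by lra.
by apply: threshold_ltP; rewrite subrr subr0.
Qed.

(* The maximal number [r + 1] of interior lattice points on a line is at least 4. *)
Lemma long_row Q S E lo hi (r k : nat) (tlo thi : R) : lattice_body Q S E -> heights S lo hi ->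
  Q tlo lo%:~R -> Q thi hi%:~R -> inner Q 0 0 -> inner Q r%:R 0 -> 3 <= hi - lo ->
  (3 <= r)%N -> (k <= r.+1 * (absz (hi - lo)).-1)%N -> scover Q (threshold R k).
Proof.
move=> lQ hS Qlo Qhi i0 ir w3 r3 kle; have cQ := lb_convex lQ.
have lohi : lo < 0 < hi by apply: (inner_height (x := 0) lQ hS).
have lo0 : (lo%:~R : R) < 0 by rewrite ltrz0; lia.
have hi0 : (0 : R) < hi%:~R by rewrite ltr0z; lia.
have hc : chord Q 0 (r%:R + 2 / (hi - lo)%:~R).
  have := @chord_inner _ Q S E lo hi 0 r%:Z 0 lQ hS.
  by rewrite subr0 -!pmulrn; apply.
have wE : (hi - lo)%:~R = (absz (hi - lo))%:R :> R by rewrite pmulrn; congr intr; lia.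
set W := absz (hi - lo) in kle wE; have W3 : (3 <= W)%N by rewrite /W; lia.
have w3R : (3 : R) <= W%:R by rewrite (ler_nat R 3).
have r3R : (3 : R) <= r%:R by rewrite (ler_nat R 3).
have k0 : (0 : R) <= k%:R by [].
have wn : (W%:R : R) != 0 by apply: lt0r_neq0; lra.
have w0 : (0 : R) < W%:R^-1 by rewrite invr_gt0; lra.
apply: (scover_diamond cQ lo0 hi0 _ (chord0 Qlo) hc (chord0 Qhi)).
  by have := threshold_lt2 R k; rewrite wE; lra.
rewrite -intrB wE; set w : R := W%:R in w3R wn w0 *; set rr : R := r%:R in r3R *.
set kk : R := k%:R in k0 *.
have kR : kk <= (rr + 1) * (w - 1).
  have -> : w - 1 = W.-1%:R :> R by rewrite -subn1 natrB //; lia.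
  have -> : rr + 1 = r.+1%:R :> R by rewrite -natr1.
  by rewrite -natrM ler_nat.
suff key : 2 * (kk + 1) * (rr * w + 2 + w ^+ 2) < (kk + 3) * (w * (rr * w + 2)).
  rewrite -(ltr_pM2r (x := w)); last by lra.
  have -> : 2 * (kk + 1) * (rr + 2 / w + w) * w = 2 * (kk + 1) * (rr * w + 2 + w ^+ 2).
    by field.
  by have -> : (kk + 3) * (w * (rr + 2 / w)) * w = (kk + 3) * (w * (rr * w + 2)) by field.
(* The hypothesis says that the scale obtained from the single chord is at least 2, which beats
   every threshold whatever [k] is. *)
have big : 2 * w ^+ 2 <= (w - 2) * (rr * w + 2) ->
    2 * (kk + 1) * (rr * w + 2 + w ^+ 2) < (kk + 3) * (w * (rr * w + 2)).
  move=> h; have h' : 2 * (rr * w + 2 + w ^+ 2) <= w * (rr * w + 2) by lra.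
  have h2 : 0 < rr * w + 2 by nra.
  have h3 : 0 < w * (rr * w + 2) by apply: mulr_gt0 => //; lra.
  by nra.
have [W5|W4] := leqP 5 W.
  have w5 : 5 <= w by rewrite /w (ler_nat R 5).
  have h1 : 0 <= (rr - 3) * ((w - 2) * w) by rewrite !mulr_ge0 //; lra.
  have h2 : 0 <= (w - 5) * (w + 1) by rewrite mulr_ge0 //; lra.
  by apply: big; lra.
(* For w = 3 with r in 3..5 and w = 4 with r = 3 the criterion [big] does not apply, and the cap
   [kR] on [k] decides. *)
have [/eqP W3'|W4'] := boolP (W == 3%N).
  rewrite /w W3' in kR *; have [r6|r5] := leqP 6 r.
    have r6R : 6 <= rr by rewrite /rr (ler_nat R 6).
    by rewrite /w W3' in big; apply: big; lra.
  have [e|e|e] : [\/ r = 3%N, r = 4%N | r = 5%N].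
    by case: r r3 r5 {ir hc kle r3R rr kR big} => [|[|[|[|[|[|]]]]]] // _ _;
      [constructor 1|constructor 2|constructor 3].
  - by rewrite /rr e in kR *; lra.
  - by rewrite /rr e in kR *; lra.
  - by rewrite /rr e in kR *; lra.
have W4e : W = 4%N by lia.
rewrite /w W4e in kR *; have [r4|r3'] := leqP 4 r.
  have r4R : 4 <= rr by rewrite /rr (ler_nat R 4).
  by rewrite /w W4e in big; apply: big; lra.
have e : r = 3%N by lia.
by rewrite /rr e in kR *; lra.
Qed.

End Rows.

(** * Three interior lattice points on a line *)

Section ThreeInARow.
Variable R : realType.
Implicit Types (Q : R -> R -> Prop) (c t x y L : R) (S E : seq (int * int)) (T : frame).

(** A longer plateau only helps, so the estimate uses length 1; the cap on [k] comes from at most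
    three points in each inner row. *)
Lemma small_plateau Q (lo hi h1 h2 : R) k : convex2 Q -> chord Q lo 0 -> chord Q hi 0 ->
  lo <= h1 -> h1 + 1 <= h2 -> h2 <= hi -> 3 <= hi - lo -> k%:R <= 3 * (hi - lo - 1) ->
  chord Q h1 (2 + 2 / (hi - lo)) -> chord Q h2 (2 + 2 / (hi - lo)) ->
  scover Q (threshold R k).
Proof.
move=> cQ cl ch l1 l2 l3 w3 kw c1 c2; have t2 := threshold_lt2 R k.
have t0 := threshold_gt0 R k; have k0 : (0 : R) <= k%:R by [].
have g2 : h2 - h1 <= hi - lo by lra.
set w := hi - lo in w3 kw c1 c2 g2.
have w0 : 0 < w by lra.
have iw0 : 0 < 2 / w by rewrite divr_gt0.
apply: (scover_trapezoid cQ t0 _ cl c1 c2 ch); rewrite -/w; try lra.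
have g1 : threshold R k * (2 + 2 / w + w - (h2 - h1)) <= threshold R k * (2 + 2 / w + w - 1).
  by rewrite ler_pM2l //; lra.
apply: le_lt_trans g1 _; apply: threshold_ltP.
rewrite -(ltr_pM2r w0).
have -> : 2 * (k%:R + 1) * (2 + 2 / w + w - 1) * w = 2 * (k%:R + 1) * (w ^+ 2 + w + 2).
  by field; exact: lt0r_neq0.
have -> : (k%:R + 3) * (w * (2 + 2 / w)) * w = (k%:R + 3) * (2 * w ^+ 2 + 2 * w).
  by field; exact: lt0r_neq0.
by have : 0 <= (w - 3) * w by [apply: mulr_ge0; lra]; lra.
Qed.

(** The cap on [k] corresponds to one row of three points, one of at most one and the others of at
    most two. At k = 2 (hi - lo) - 2 a chord of length 2 + 2/(hi - lo) would fall short; the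
    improved denominator at one end makes up for it. *)
Lemma small_span Q (lo hi : R) k : convex2 Q -> chord Q lo 0 -> chord Q hi 0 ->
  lo < 0 -> 0 < hi -> 3 <= hi - lo -> k%:R <= 2 * (hi - lo) - 2 ->
  chord Q 0 (2 + (hi - lo)^-1 + (hi - lo - 1)^-1) -> scover Q (threshold R k).
Proof.
move=> cQ cl ch lo0 hi0 w3 kw c0; have t2 := threshold_lt2 R k.
have k0 : (0 : R) <= k%:R by [].
have w0 : 0 < hi - lo by lra.
have w1 : 0 < hi - lo - 1 by lra.
have i0 : 0 < (hi - lo)^-1 by rewrite invr_gt0.
have i1 : 0 < (hi - lo - 1)^-1 by rewrite invr_gt0.
apply: (scover_diamond cQ lo0 hi0 _ cl c0 ch); first by lra.
set w := hi - lo in w3 kw w0 w1 *.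
rewrite -(ltr_pM2r (mulr_gt0 w0 w1)).
have [wn wn1] := (lt0r_neq0 w0, lt0r_neq0 w1).
have -> : 2 * (k%:R + 1) * (2 + w^-1 + (w - 1)^-1 + w) * (w * (w - 1)) =
  (k%:R + 1) * (2 * w ^+ 3 + 2 * w ^+ 2 - 2) by field; rewrite wn wn1.
have -> : (k%:R + 3) * (w * (2 + w^-1 + (w - 1)^-1)) * (w * (w - 1)) =
  (k%:R + 3) * (2 * w ^+ 3 - w) by field; rewrite wn wn1.
have h1 : 0 <= (2 * w - 2 - k%:R) * (2 * w ^+ 2 + w - 2).
  by apply: mulr_ge0; nra.
by lra.
Qed.

(* One row carries three interior lattice points, and a row next to the top two. *)
Lemma small_slopes Q (lo hi : R) k : convex2 Q -> chord Q lo 0 -> 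
  4 <= hi - lo -> 0 <= hi + lo -> lo < 0 -> k%:R <= 2 * (hi - lo) - 1 ->
  chord Q 0 (2 + 2 / (hi - lo)) -> chord Q (hi - 1) (1 + 2 / (hi - lo)) ->
  scover Q (threshold R k).
Proof.
move=> cQ cl w4 hl lo0 kw c0 c1.
have k0 : (0 : R) <= k%:R by [].
set w := hi - lo in w4 kw c0 c1.
have w0 : 0 < w by lra.
have wn := lt0r_neq0 w0.
have w1 : 0 < w + 1 by lra.
have wn1 := lt0r_neq0 w1.
(* This is the threshold formula at k = 2 w - 1, the largest value allowed. *)
apply: (@scoverW _ Q _ (2 * w / (w + 1))); last first.
  rewrite -subr_ge0.
  have -> : 2 * w / (w + 1) - threshold R k = 2 * (2 * w - 1 - k%:R) / ((w + 1) * (k%:R + 3)).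
    by rewrite /threshold; field; rewrite wn1 lt0r_neq0 //; lra.
  by rewrite divr_ge0 ?mulr_ge0 //; lra.
apply: (scover_two_slopes cQ _ _ _ _ cl c0 c1).
- by rewrite divr_gt0 //; lra.
- rewrite -subr_gt0.
  have -> : 2 + 2 / w - 2 * w / (w + 1) = 2 * (2 * w + 1) / (w * (w + 1)) by field; rewrite wn wn1.
  by rewrite divr_gt0 ?mulr_gt0 //; lra.
- rewrite -subr_gt0.
  have -> : 2 * w / (w + 1) - (1 + 2 / w) = (w ^+ 2 - 3 * w - 2) / (w * (w + 1)).
    by field; rewrite wn wn1.
  by rewrite divr_gt0 ?mulr_gt0 //; nra.
- by rewrite /w in w4; lra.
rewrite -subr_gt0.
have -> : (hi - 1 - 0) * (2 + 2 / w - 2 * w / (w + 1)) / (2 + 2 / w - (1 + 2 / w)) +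
   (0 - lo) * (1 - 2 * w / (w + 1) / (2 + 2 / w)) - 2 * w / (w + 1) =
   (hi * (2 * w + 1) * (w + 2) - 5 * w ^+ 2 - 6 * w - 2) / (w * (w + 1) ^+ 2).
  have -> : lo = hi - w by rewrite /w; ring.
  by field; rewrite wn wn1 /= lt0r_neq0 //; lra.
apply: divr_gt0; last by rewrite mulr_gt0 // exprn_gt0.
have h1 : 0 <= (2 * hi - w) * ((2 * w + 1) * (w + 2)).
  by rewrite mulr_ge0 ?mulr_ge0 // /w; lra.
have h2 : 0 <= (w - 4) * (w * w) by rewrite mulr_ge0 ?mulr_ge0 //; lra.
have h3 : 0 <= (w - 4) * w by rewrite mulr_ge0 //; lra.
by lra.
Qed.

(** In this width the chord 5/3 next to the top exceeds the threshold 3/2, so the usable heights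
    extend above it and [small_slopes] does not apply. *)
Lemma small_width3 Q k : convex2 Q -> (k <= 5)%N -> chord Q (-1) 0 -> chord Q 0 (8 / 3) ->
  chord Q 1 (5 / 3) -> chord Q 2 0 -> scover Q (threshold R k).
Proof.
move=> cQ k5 c1 c2 c3 c4.
apply: (@scoverW _ Q _ (3 / 2)); last first.
  by apply: le_trans (threshold_le _ k5) _; rewrite ler_pdivrMr; lra.
(* The heights -0.42 and 1.09 are 1.51 apart and carry chords longer than 1.51, just above 3/2. *)
have d0 := chord_comb (t := 58 / 100) cQ c2 c1 ltac:(lra).
have d1 := chord_comb (t := 91 / 100) cQ c3 c4 ltac:(lra).
by apply: (scover_chords cQ _ d0 d1); lra.
Qed.

Lemma three_row Q S E (lo hi : int) k (tlo thi : R) : lattice_body Q S E -> heights S lo hi ->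
  Q tlo lo%:~R -> Q thi hi%:~R -> inner Q 0 0 -> inner Q 2 0 ->
  3 <= hi - lo -> 0 <= hi + lo ->
  (forall h, (row E h <= 3)%N) -> size E = k -> scover Q (threshold R k).
Proof.
move=> lQ hS Qlo Qhi i0 i2 w3 hl rE sE; have cQ := lb_convex lQ.
have lohi : lo < 0 < hi by apply: (inner_height (x := 0) lQ hS).
have lo0 : (lo%:~R : R) < 0 by rewrite ltrz0; lia.
have hi0 : (0 : R) < hi%:~R by rewrite ltr0z; lia.
have hl0 : (0 : R) <= hi%:~R + lo%:~R by rewrite -intrD ler0z.
have [cl ch] := (chord0 Qlo, chord0 Qhi).
have w3R : (3 : R) <= hi%:~R - lo%:~R by rewrite -intrB (ler_int R 3).
have c0 : chord Q 0 (2 + 2 / (hi%:~R - lo%:~R)).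
  by have := @chord_inner _ Q S E lo hi 0 2 0 lQ hS; rewrite subr0 intrB; apply.
have kle : (k <= 3 * (absz (hi - lo)).-1)%N.
  rewrite -sE -(size_inner_rows lo hi); apply: size_rows => // e eE.
  exact: (@inner_in_rows R _ _ _ _ _ _ lQ hS).
have wE : (hi%:~R - lo%:~R : R) = (absz (hi - lo)%R)%:R.
  by rewrite -intrB pmulrn; congr intr; lia.
have kR : k%:R <= 3 * (hi%:~R - lo%:~R - 1 : R).
  have -> : hi%:~R - lo%:~R - 1 = (absz (hi - lo)%R).-1%:R :> R.
    by rewrite wE -subn1 natrB //; lia.
  by rewrite -natrM ler_nat.
(* A second chord as long as the one at height 0, at an extreme height or in another row of three
   points, forms a plateau; otherwise the rows are counted. *)
have [|chi|clo] := @chord_inner_span _ Q S E lo hi 2 lQ hS i0 i2; last first.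
- rewrite intrB in clo.
  apply: (small_plateau (h1 := lo%:~R) (h2 := 0) cQ cl ch _ _ _ w3R kR clo c0); try lra.
  by rewrite -[1]/(1%:~R) -intrD lerz0; lia.
- rewrite intrB in chi.
  apply: (small_plateau (h1 := 0) (h2 := hi%:~R) cQ cl ch _ _ _ w3R kR c0 chi); lra.
rewrite !intrB => cs.
have [[h [h0 hr]]|no3] := pselect (exists h : int, h != 0 /\ (3 <= row E h)%N).
  have r0 : (0 < row E h)%N by lia.
  have hlh : lo < h < hi.
    have [a [_ [ia _ _]]] := row_extent lQ r0.
    exact: (inner_height lQ hS ia).
  have rh : row E h = 3%N by have := rE h; lia.
  have hc : chord Q h%:~R (2 + 2 / (hi%:~R - lo%:~R)).
    have := row_chord lQ hS r0; rewrite rh intrB => hc.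
    by apply: chordW hc _; lra.
  have [hneg|hpos|] := ltgtP h 0; last by move/eqP; rewrite (negPf h0).
    apply: (small_plateau cQ cl ch _ _ _ w3R kR hc c0); last by lra.
      by rewrite ler_int; lia.
    by rewrite -[1]/(1%:~R) -intrD lerz0; lia.
  apply: (small_plateau cQ cl ch _ _ _ w3R kR c0 hc); first by lra.
    by rewrite add0r -[1]/(1%:~R) ler_int; lia.
  by rewrite ler_int; lia.
have row2 (h : int) : h != 0 -> (row E h <= 2)%N.
  by move=> h0; rewrite leqNgt; apply/negP => h3; apply: no3; exists h.
pose W := absz (hi - lo)%R.
have W3 : (3 <= W)%N by rewrite /W; lia.
pose E1 : seq (int * int) := [seq e <- E | e.2 != 0 :> int].
pose E2 : seq (int * int) := [seq e <- E1 | e.2 != hi - 1 :> int].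
have s1 : (size E = row E 0 + size E1)%N.
  by rewrite /row /E1 size_filter; symmetry; exact: count_predC.
have row1 : row E1 (hi - 1) = row E (hi - 1).
  rewrite /row /E1 count_filter; apply: eq_count => e /=.
  by case: eqP => //= ->; lia.
have s2 : (size E1 = row E (hi - 1) + size E2)%N.
  by rewrite -row1 /row /E2 size_filter; symmetry; exact: count_predC.
have s3 : (size E2 <= 2 * (W - 3))%N.
  pose hs := rem (hi - 1) (rem 0 (inner_rows lo hi)).
  have u0 := uniq_inner_rows lo hi.
  have in0 : 0 \in inner_rows lo hi by rewrite mem_inner_rows //; lia.
  have in1 : hi - 1 \in rem 0 (inner_rows lo hi).
    by rewrite mem_rem_uniq // !inE mem_inner_rows //; lia.
  have -> : (W - 3 = size hs)%N.
    by rewrite !size_rem // size_inner_rows /W; lia.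
  apply: size_rows => [e|h].
    rewrite !mem_filter => /and3P[e1 e2 eE].
    rewrite mem_rem_uniq ?rem_uniq // inE e1 mem_rem_uniq // inE e2 /=.
    exact: (@inner_in_rows R _ _ _ _ _ _ lQ hS).
  rewrite mem_rem_uniq ?rem_uniq // inE => /andP[h1].
  rewrite mem_rem_uniq // inE => /andP[h2 _].
  apply: leq_trans (row2 h h2).
  by rewrite /row !count_filter; apply: sub_count => e /= /andP[/andP[]].
have r0 := rE 0.
have kW (n : nat) : (k + n <= 2 * W)%N -> k%:R <= 2 * (hi%:~R - lo%:~R) - n%:R :> R.
  by move=> h; rewrite wE -/W lerBrDr -natrD -natrM ler_nat.
(* Of the W - 1 inner rows, row 0 has at most three points and the others at most two: k <= 2W - 2
   if the row below the top has at most one point, and k <= 2W - 1 otherwise. *)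
have [r1|r1] := leqP (row E (hi - 1)) 1.
  by apply: (small_span cQ cl ch lo0 hi0 w3R _ cs); apply: kW; lia.
have r2 : row E (hi - 1) = 2%N by have := row2 (hi - 1); lia.
have c1 : chord Q (hi%:~R - 1) (1 + 2 / (hi%:~R - lo%:~R)).
  have := @row_chord _ Q S E lo hi (hi - 1) lQ hS; rewrite r2 !intrB => /(_ isT) hc.
  by apply: chordW hc _; lra.
have k1 : k%:R <= 2 * (hi%:~R - lo%:~R) - 1 :> R by apply: (kW 1%N); lia.
have [W4|W3'] := leqP 4 W.
  apply: (small_slopes cQ cl _ hl0 lo0 k1 c0 c1).
  by rewrite wE (ler_nat R 4).
have [hiE loE] : hi = 2 /\ lo = -1 by rewrite /W in W3'; lia.
have w3E : hi%:~R - lo%:~R = 3 :> R by rewrite hiE loE intrN; ring.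
have hi1 : hi%:~R - 1 = 1 :> R by rewrite hiE; ring.
rewrite w3E in c0 c1; rewrite hi1 in c1; rewrite hiE in ch; rewrite loE in cl.
apply: (small_width3 cQ _ cl _ _ ch).
- by lia.
- by apply: chordW c0 _; lra.
- by apply: chordW c1 _; lra.
Qed.

Lemma row_flip E h : row (map (frame_app (frame_inv flip_frame)) E) h = row E (- h).
Proof.
rewrite /row count_map; apply: eq_count => e.
by rewrite inE flip_app /= eqr_oppLR.
Qed.

End ThreeInARow.

(** * Two interior lattice points on a line *)

(** Recursion on the bits lets computation decide a statement about all sublists of an explicit
    list. *)
Fixpoint all_masks n (P : pred bitseq) :=
  if n is n'.+1 then all_masks n' (fun m => P (true :: m)) && all_masks n' (fun m => P (false :: m))
  else P [::].

Lemma all_masksP n (P : pred bitseq) m : all_masks n P -> size m = n -> P m.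
Proof.
elim: n P m => [|n IH] P [|[] m] //= /andP[h1 h2] [sm]; [exact: IH h1 sm|exact: IH h2 sm].
Qed.

Definition unit_triangle : seq (int * int) := [:: (0, 0); (1, 0); (0, 1)].

(* The boundary lattice points of the triangle [x, y >= -1], [x + y <= 2]. *)
Definition outer_points : seq (int * int) :=
  [:: (-1, -1); (0, -1); (1, -1); (2, -1); (3, -1); (2, 0); (1, 1); (0, 2); (-1, 3);
      (-1, 2); (-1, 1); (-1, 0)].

Definition triangle_symmetries : seq frame :=
  [:: Frame (0, 0) (1, 0) (0, 1); Frame (0, 0) (0, 1) (1, 0); Frame (1, 0) (-1, 0) (-1, 1);
      Frame (0, 1) (1, -1) (0, -1); Frame (1, 0) (-1, 1) (-1, 0); Frame (0, 1) (0, -1) (1, -1)].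

(* A point of [A] beyond the vertex [h.1] of the triangle in direction [h.2]. *)
Definition beyond (A : seq (int * int)) (h : (int * int) * (int * int)) :=
  has (fun w => h.2.1 * h.1.1 + h.2.2 * h.1.2 < h.2.1 * w.1 + h.2.2 * w.2) A.

(** Interiority provides a vertex strictly beyond in every direction; these six already force an
    enclosing polygon. *)
Definition vertex_directions : seq ((int * int) * (int * int)) :=
  [:: ((0, 0), (-1, -1)); ((0, 0), (-1, 0)); ((0, 0), (0, -1));
      ((1, 0), (1, 0)); ((1, 0), (1, 1)); ((0, 1), (0, 1))].

(* Up to [triangle_symmetries], the minimal sets of outer points whose convex hull
   has the unit triangle in its interior. *)
Definition enclosing_polygons : seq (seq (int * int)) :=
  [:: [:: (-1, -1); (-1, 2); (3, -1)];
      [:: (-1, -1); (-1, 2); (2, 0)];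
      [:: (-1, -1); (-1, 3); (3, -1)];
      [:: (-1, -1); (0, 2); (2, 0)];
      [:: (-1, 0); (0, 2); (2, -1)];
      [:: (-1, 1); (0, -1); (0, 2); (3, -1)];
      [:: (-1, 1); (0, -1); (0, 2); (2, -1)];
      [:: (-1, 0); (-1, 2); (2, -1); (2, 0)]].

Definition encloses (A : seq (int * int)) :=
  has (fun F => has (fun C => all (fun c => frame_app F c \in A) C) enclosing_polygons)
    triangle_symmetries.

(** Runs through all 4096 subsets of the outer points, which establishes the completeness of
    [enclosing_polygons]. *)
Lemma enclosing_check : all_masks 12 (fun m =>
  all (beyond (mask m outer_points)) vertex_directions ==> encloses (mask m outer_points)).
Proof. by vm_compute. Qed.

Lemma beyond_encloses (p : pred (int * int)) :
  all (beyond [seq w <- outer_points | p w]) vertex_directions ->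
  encloses [seq w <- outer_points | p w].
Proof.
rewrite filter_mask; set m := map _ _; apply/implyP.
pose P m := all (beyond (mask m outer_points)) vertex_directions ==> encloses (mask m outer_points).
exact: (@all_masksP 12 P m enclosing_check (size_map _ _)).
Qed.

Lemma enclosesP A : encloses A -> exists F C,
  [/\ unimodular F, C \in enclosing_polygons & forall c, c \in C -> frame_app F c \in A].
Proof.
have hasE (Fs : seq frame) : foldr (fun F acc => unimodular F /\ acc) True Fs ->
    has (fun F => has (fun C => all (fun c => frame_app F c \in A) C) enclosing_polygons) Fs ->
    exists F C,
      [/\ unimodular F, C \in enclosing_polygons & forall c, c \in C -> frame_app F c \in A].
  elim: Fs => // F Fs IH [uF uFs] /orP[/hasP[C CP /allP CA]|/(IH uFs) //].
  by exists F, C.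
by apply: hasE; do !split.
Qed.

Section TwoInARow.
Variable R : realType.
Implicit Types (Q : R -> R -> Prop) (c x y L : R) (S E : seq (int * int)) (T : frame).

Lemma chord_edges Q (xA yA xB yB xC yC xD yD t s : R) y d : convex2 Q ->
  Q xA yA -> Q xB yB -> Q xC yC -> Q xD yD -> 0 <= t <= 1 -> 0 <= s <= 1 ->
  y = t * yA + (1 - t) * yB -> y = s * yC + (1 - s) * yD ->
  d <= (s * xC + (1 - s) * xD) - (t * xA + (1 - t) * xB) -> chord Q y d.
Proof.
move=> cQ QA QB QC QD t01 s01 yt ys dd.
exists (t * xA + (1 - t) * xB), (s * xC + (1 - s) * xD); split=> //.
  exact: convex_comb2 cQ QA QB t01 erefl yt.
exact: convex_comb2 cQ QC QD s01 erefl ys.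
Qed.

Lemma threshold3 : threshold R 3 = 4 / 3.
Proof. by rewrite /threshold; field. Qed.

Lemma threshold4 : threshold R 4 = 10 / 7.
Proof. by rewrite /threshold; field. Qed.

(** Every polygon of the list except the fifth has two horizontal chords longer than 4/3 at heights
    more than 4/3 apart. *)
Lemma scover_enclosing Q C : convex2 Q -> C \in enclosing_polygons ->
  (forall v : int * int, v \in C -> Q v.1%:~R v.2%:~R) -> scover Q (threshold R 3).
Proof.
rewrite threshold3 => cQ; rewrite !inE => hC QC.
have P (v : int * int) : v \in C -> Q v.1%:~R v.2%:~R := QC v.
have two y0 y1 d0 d1 : chord Q y0 d0 -> chord Q y1 d1 -> 4 / 3 < d0 -> 4 / 3 < d1 ->
    4 / 3 < y1 - y0 -> scover Q (4 / 3).
  by apply: scover_chords => //; lra.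
move: hC => /orP[|/orP[|/orP[|/orP[|/orP[|/orP[|/orP[|]]]]]]] /eqP eC;
  rewrite eC in P; clear eC QC.
- have a : Q (-1) (-1) := P (-1, -1) isT; have b : Q (-1) 2 := P (-1, 2) isT.
  have c : Q 3 (-1) := P (3, -1) isT.
  apply: (two (-1) (1/2) 4 2); [..|lra|lra|lra].
    by apply: (chord_edges (t := 1) (s := 1) cQ a a c c); lra.
  by apply: (chord_edges (t := (1/2)) (s := (1/2)) cQ b a c b); lra.
- have a : Q (-1) (-1) := P (-1, -1) isT; have b : Q (-1) 2 := P (-1, 2) isT.
  have c : Q 2 0 := P (2, 0) isT.
  apply: (two (-1/2) 1 (3/2) (3/2)); [..|lra|lra|lra].
    by apply: (chord_edges (t := (1/6)) (s := (1/2)) cQ b a a c); lra.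
  by apply: (chord_edges (t := (2/3)) (s := (1/2)) cQ b a c b); lra.
- have a : Q (-1) (-1) := P (-1, -1) isT; have b : Q (-1) 3 := P (-1, 3) isT.
  have c : Q 3 (-1) := P (3, -1) isT.
  apply: (two (-1) 1 4 2); [..|lra|lra|lra].
    by apply: (chord_edges (t := 1) (s := 1) cQ a a c c); lra.
  by apply: (chord_edges (t := (1/2)) (s := (1/2)) cQ b a c b); lra.
- have a : Q (-1) (-1) := P (-1, -1) isT; have b : Q 0 2 := P (0, 2) isT.
  have c : Q 2 0 := P (2, 0) isT.
  apply: (two (-9/20) (9/10) (22/15) (22/15)); [..|lra|lra|lra].
    by apply: (chord_edges (t := (11/60)) (s := (9/20)) cQ b a a c); lra.
  by apply: (chord_edges (t := (19/30)) (s := (11/20)) cQ b a c b); lra.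
(* The longest horizontal chord is 7/3 and the height is 3, so horizontal chords alone reach only
   21/16 < 4/3; two layers at scale 7/5 are overlapped instead. *)
- have a : Q (-1) 0 := P (-1, 0) isT; have b : Q 0 2 := P (0, 2) isT.
  have c : Q 2 (-1) := P (2, -1) isT.
  exists (7/5); first by lra.
  apply: (@tcover_two_layers R Q (7/5) (4/5) 1 0 (-3/5) (4/5) (-1/2) (2/3)
            (4/5) (26/15) (1/5) (8/5) cQ); rewrite ?mul0r; try lra.
  + by apply: (convex_comb2 (t := 3/5) cQ a b); lra.
  + by apply: (convex_comb2 (t := 2/5) cQ c b); lra.
  + by apply: (convex_comb2 (t := 1/2) cQ a b); lra.
  + by apply: (convex_comb2 (t := 1/3) cQ c b); lra.
  + by apply: (convex_comb2 (t := 2/5) cQ a c); lra.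
  + by apply: (convex_comb2 (t := 13/15) cQ c b); lra.
  + by apply: (convex_comb2 (t := 3/5) cQ a c); lra.
  + by apply: (convex_comb2 (t := 4/5) cQ c b); lra.
- have a : Q (-1) 1 := P (-1, 1) isT; have b : Q 0 (-1) := P (0, -1) isT.
  have c : Q 0 2 := P (0, 2) isT; have d : Q 3 (-1) := P (3, -1) isT.
  apply: (two (-1) 1 3 2); [..|lra|lra|lra].
    by apply: (chord_edges (t := 1) (s := 1) cQ b b d d); lra.
  by apply: (chord_edges (t := 1) (s := (1/3)) cQ a a d c); lra.
- have a : Q (-1) 1 := P (-1, 1) isT; have b : Q 0 (-1) := P (0, -1) isT.
  have c : Q 0 2 := P (0, 2) isT; have d : Q 2 (-1) := P (2, -1) isT.
  apply: (two (-1) 1 2 (5/3)); [..|lra|lra|lra].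
    by apply: (chord_edges (t := 1) (s := 1) cQ b b d d); lra.
  by apply: (chord_edges (t := 1) (s := (1/3)) cQ a a d c); lra.
- have a : Q (-1) 0 := P (-1, 0) isT; have b : Q (-1) 2 := P (-1, 2) isT.
  have c : Q 2 (-1) := P (2, -1) isT; have d : Q 2 0 := P (2, 0) isT.
  apply: (two (-1/2) 1 (3/2) (3/2)); [..|lra|lra|lra].
    by apply: (chord_edges (t := (1/2)) (s := (1/2)) cQ a c c d); lra.
  by apply: (chord_edges (t := (1/2)) (s := (1/2)) cQ b a d b); lra.
Qed.

End TwoInARow.

Section TwoInARowCases.
Variable R : realType.
Implicit Types (Q : R -> R -> Prop) (c x y L : R) (S E : seq (int * int)) (T : frame).

(** The row just outside each side of the triangle contains no interior lattice point, so no vertex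
    lies beyond it. *)
Lemma unit_triangle_vertices Q S E : lattice_body Q S E -> E =i unit_triangle ->
  forall s, s \in S -> [/\ -1 <= s.1, -1 <= s.2 & s.1 + s.2 <= 2].
Proof.
move=> lQ hE s sS.
split.
- have := vertex_band (T := (Frame (0, 0) (0, 1) (-1, 0))) erefl lQ hE isT sS.
  by case: s {sS} => a b; rewrite /frame_app /= /frame_det /=; lia.
- have := vertex_band (T := flip_frame) erefl lQ hE isT sS.
  by case: s {sS} => a b; rewrite /frame_app /= /frame_det /=; lia.
- have := vertex_band (T := (Frame (1, 0) (-1, 1) (1, 0))) erefl lQ hE isT sS.
  by case: s {sS} => a b; rewrite /frame_app /= /frame_det /=; lia.
Qed.

(** Vertices are outer points, and beyond each corner of the unit triangle there is a vertex in
    every listed direction; the outer points in [Q] therefore pass the finite check. *)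
Lemma unit_triangle_case Q S E : lattice_body Q S E -> E =i unit_triangle ->
  scover Q (threshold R 3).
Proof.
move=> lQ hE; have cQ := lb_convex lQ.
have SW (a b : int) : (a, b) \in S -> (a, b) \notin E -> (a, b) \in outer_points.
  move=> sS; have [/=] := unit_triangle_vertices lQ hE sS; rewrite hE => a1 b1 ab.
  have ha : a = -1 \/ a = 0 \/ a = 1 \/ a = 2 \/ a = 3 by lia.
  have hb : b = -1 \/ b = 0 \/ b = 1 \/ b = 2 \/ b = 3 by lia.
  suff : (a + b <= 2) ==> ((a, b) \notin unit_triangle) ==> ((a, b) \in outer_points).
    by move=> /implyP/(_ ab)/implyP.
  by case: ha => [->|[->|[->|[->|->]]]]; case: hb => [->|[->|[->|[->|->]]]].
pose A := [seq w <- outer_points | `[< Q w.1%:~R w.2%:~R >]].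
have [F [C [uF CP CA]]] : exists F C, [/\ unimodular F, C \in enclosing_polygons &
    forall v : int * int, v \in C -> frame_app F v \in A].
  apply: enclosesP.
  apply: beyond_encloses; apply/allP => -[z [a b]] hz.
  have zT : z \in E /\ (a, b) != (0, 0).
    by rewrite hE; move: hz; rewrite !inE; do ?[case/orP]; move=> /eqP[-> -> ->].
  case: zT => /(lb_inner lQ) iz ab.
  have abR : (a%:~R, b%:~R) != (0, 0) :> R * R.
    by move: ab; rewrite !xpair_eqE !intr_eq0.
  have [[u v] [sS sE h]] := inner_support_boundary lQ iz abR.
  apply/hasP; exists (u, v); last first.
    by move: h; rewrite -!intrM -!intrD ltr_int.
  rewrite mem_filter SW // andbT; apply/asboolP; exact: (lb_vertex lQ).
apply: (scover_pull uF); apply: (scover_enclosing _ CP); first exact: pull_convex.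
move=> v /CA; rewrite mem_filter => /andP[/asboolP h _].
by rewrite pull_app.
Qed.

(** The chords 5/3 in both rows give only 15/11 < 10/7. By [chord_inner_span] either both improve to
    11/6, or a chord 5/3 appears at an extreme height, two away from one of the rows. *)
Lemma unit_square_case Q S E : lattice_body Q S E ->
  E =i [:: (0, 0); (1, 0); (0, 1); (1, 1)] -> scover Q (threshold R 4).
Proof.
move=> lQ hE; have cQ := lb_convex lQ.
have hS : heights S (-1) 2.
  move=> s sS; apply/andP; split.
    have := vertex_band (T := flip_frame) erefl lQ hE isT sS.
    by case: s {sS} => a b; rewrite /frame_app /= /frame_det /=; lia.
  have := vertex_band (T := (Frame (0, 1) (1, 0) (0, 1))) erefl lQ hE isT sS.
  by case: s {sS} => a b; rewrite /frame_app /= /frame_det /=; lia.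
have iE (z : int * int) : z \in [:: (0, 0); (1, 0); (0, 1); (1, 1)] -> inner Q z.1%:~R z.2%:~R.
  by rewrite -hE => /(lb_inner lQ).
have i00 : inner Q 0 0 := iE (0, 0) isT.
have i10 : inner Q 1 0 := iE (1, 0) isT.
have i01 : inner Q 0 1 := iE (0, 1) isT.
have i11 : inner Q 1 1 := iE (1, 1) isT.
have w3 : 2 - -1 = 3 :> int by [].
have w3' : 2 - 1 - (-1 - 1) = 3 :> int by [].
have w2 : 3 - 1 = 2 :> int by [].
have c0 : chord Q 0 (5 / 3).
  have := @chord_inner R Q S E (-1) 2 0 1 0 lQ hS i00 i10.
  by rewrite w3 subr0 => h; apply: chordW h _; lra.
have c1 : chord Q 1 (5 / 3).
  have := @chord_inner R Q S E (-1) 2 0 1 1 lQ hS i01 i11.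
  by rewrite w3 subr0 => h; apply: chordW h _; lra.
have [th tl] : (exists x, Q x 2) /\ (exists x, Q x (-1)).
  split.
    have [s sS] := inner_support (a := 0) (b := 1) lQ i01
      ltac:(by rewrite xpair_eqE oner_eq0 andbF).
    rewrite !mul0r !add0r !mul1r (ltr_int R 1) => h; exists s.1%:~R.
    have := lb_vertex lQ sS; have -> // : s.2 = 2.
    by have := hS s sS; lia.
  have [s sS] := inner_support (a := 0) (b := -1) lQ i00
    ltac:(by rewrite xpair_eqE oppr_eq0 oner_eq0 andbF).
  rewrite !mul0r mulr0 !add0r mulN1r oppr_gt0 ltrz0 => h; exists s.1%:~R.
  have := lb_vertex lQ sS; have -> : s.2 = -1 by have := hS s sS; lia.
  by rewrite intrN.
case: th tl => [xt Qt] [xb Qb].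
rewrite threshold4.
have far y y' : chord Q y (5 / 3) -> chord Q y' (5 / 3) -> 2 <= y' - y -> scover Q (10 / 7).
  by move=> h h' yy; apply: (scover_chords cQ _ h h'); lra.
case: (@chord_inner_span R Q S E (-1) 2 1 lQ hS i00 i10) => [d0|d0|d0]; rewrite ?w3 ?w2 in d0.
- have uL : unimodular (left_frame 0 1) by [].
  have lQ' := lattice_body_pull uL lQ.
  have pE x y : pull (left_frame 0 1) Q x y = Q x (1 + y).
    by rewrite /pull /= !(mulr1, mulr0, addr0, add0r).
  have hh s : (frame_app (frame_inv (left_frame 0 1)) s).2 = s.2 - 1.
    by case: s => s1 s2; rewrite /frame_app /= /frame_det /=; ring.
  have chE y d : chord (pull (left_frame 0 1) Q) y d -> chord Q (1 + y) d.
    by move=> [l [r []]]; rewrite !pE => h1 h2 h3; exists l, r.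
  have i0' : inner (pull (left_frame 0 1) Q) 0 0.
    by apply: inner_pull_of; rewrite /= !(mulr1, mulr0, addr0, add0r).
  have i1' : inner (pull (left_frame 0 1) Q) 1 0.
    by apply: inner_pull_of; rewrite /= !(mulr1, mulr0, addr0, add0r).
  case: (@chord_inner_span R _ _ _ (-1 - 1) (2 - 1) 1 lQ' (heights_pull hh hS) i0' i1')
    => /chE d1; rewrite ?w3' ?w2 in d1.
  + apply: (@scover_trapezoid R Q (-1) 0 1 2 (11 / 6) (10 / 7) cQ); try lra.
    * exact: chord0 Qb.
    * by apply: chordW d0 _; lra.
    * rewrite addr0 in d1; apply: chordW d1 _.
      by lra.
    * exact: chord0 Qt.
  + apply: (far 0 2) => //; last by lra.
    have e : 1 + (2 - 1)%:~R = 2 :> R by rewrite intrB; ring.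
    by rewrite e in d1; apply: chordW d1 _; lra.
  + apply: (far (-1) 1) => //; last by lra.
    have e : 1 + (-1 - 1)%:~R = -1 :> R by rewrite intrB intrN; ring.
    rewrite e in d1; apply: chordW d1 _.
    by lra.
- apply: (far 0 2) => //; last by lra.
  by apply: chordW d0 _; lra.
- apply: (far (-1) 1) => //; last by lra.
  by apply: chordW d0 _; lra.
Qed.

(** The bands along the three sides confine the vertices to the triangle (2, 0), (0, 2), (-2, -2),
    and each of these corners must be a vertex; this fixes a chord of length 3 and height 4. *)
Lemma centroid_case Q S E : lattice_body Q S E ->
  E =i [:: (0, 0); (1, 0); (0, 1); (-1, -1)] -> scover Q (threshold R 4).
Proof.
move=> lQ hE; have cQ := lb_convex lQ.
have hS s : s \in S -> [/\ s.1 + s.2 <= 2, s.1 - 2 * s.2 <= 2 & s.2 - 2 * s.1 <= 2].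
  move=> sS; split.
  - have := vertex_band (T := (Frame (1, 0) (-1, 1) (1, 0))) erefl lQ hE isT sS.
    by case: s {sS} => a b; rewrite /frame_app /= /frame_det /=; lia.
  - have := vertex_band (T := (Frame (-1, -1) (2, 1) (1, 0))) erefl lQ hE isT sS.
    by case: s {sS} => a b; rewrite /frame_app /= /frame_det /=; lia.
  - have := vertex_band (T := (Frame (-1, -1) (1, 2) (0, 1))) erefl lQ hE isT sS.
    by case: s {sS} => a b; rewrite /frame_app /= /frame_det /=; lia.
have sup (z : int * int) (a b : int) : z \in E -> (a, b) != (0, 0) ->
    exists2 s, s \in S & a * z.1 + b * z.2 < a * s.1 + b * s.2.
  move=> /(lb_inner lQ) iz ab.
  have abR : (a%:~R, b%:~R) != (0, 0) :> R * R by rewrite xpair_eqE !intr_eq0 -xpair_eqE.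
  have [s sS h] := inner_support lQ iz abR.
  by exists s => //; move: h; rewrite -!intrM -!intrD ltr_int.
have Q20 : Q 2 0.
  have [|[a b] sS /= h] := sup (1, 0) 2 (-1) _ isT; first by rewrite hE.
  have [/= h1 h2 h3] := hS _ sS; have := lb_vertex lQ sS => /=.
  (* [2a - b >= 3] is the sum of [a + b] and [a - 2b], both at most 2 and congruent modulo 3, so
     both equal 2. *)
  by have [-> ->] : a = 2 /\ b = 0 by lia.
have Q02 : Q 0 2.
  have [|[a b] sS /= h] := sup (0, 1) (-1) 2 _ isT; first by rewrite hE.
  have [/= h1 h2 h3] := hS _ sS; have := lb_vertex lQ sS => /=.
  by have [-> ->] : a = 0 /\ b = 2 by lia.
have Qm2 : Q (-2) (-2).
  have [|[a b] sS /= h] := sup (-1, -1) (-1) (-1) _ isT; first by rewrite hE.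
  have [/= h1 h2 h3] := hS _ sS; have := lb_vertex lQ sS => /=.
  by have [-> ->] : a = -2 /\ b = -2 by lia.
have Qm : Q (-1) 0 by apply: (convex_comb2 (t := 1/2) cQ Q02 Qm2); lra.
apply: (@scover_diamond R Q (-2) 2 3 4 cQ); rewrite ?threshold4; try lra.
- exact: chord0 Qm2.
- by apply: (chord_points Qm Q20); lra.
- exact: chord0 Q02.
Qed.

End TwoInARowCases.

(** * Parity classes of the interior lattice points *)

Section Classification.
Variable R : realType.
Implicit Types (Q : R -> R -> Prop) (c x y : R) (S E : seq (int * int)) (T : frame).

Lemma collinear_inner_pull T Q n : unimodular T ->
  collinear_inner (pull T Q) n -> collinear_inner Q n.
Proof.
move=> uT [T' [uT' i0 i1]]; exists (frame_comp T T'); rewrite -pull_comp; split=> //.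
exact: unimodular_comp.
Qed.

Lemma inner_app T Q S E (z : int * int) : unimodular T -> lattice_body Q S E ->
  frame_app T z \in E -> inner (pull T Q) z.1%:~R z.2%:~R.
Proof. by move=> uT lQ /(lb_inner lQ)/(inner_pull_app Q z uT). Qed.

(** Interior lattice points congruent modulo 2 have a lattice midpoint, so without three in a row
    each parity class occurs at most once. *)
Lemma collinear_midpoint Q S E (a m b : int * int) : lattice_body Q S E ->
  a \in E -> b \in E -> a != m -> a.1 + b.1 = 2 * m.1 -> a.2 + b.2 = 2 * m.2 ->
  collinear_inner Q 2.
Proof.
move=> lQ aE bE am e1 e2; have [T [g [uT g0 Ta Tm]]] := frame_through am.
have Tb : frame_app T (2 * g%:Z, 0) = b.
  rewrite [RHS]surjective_pairing; have -> : b.1 = 2 * m.1 - a.1 by lia.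
  have -> : b.2 = 2 * m.2 - a.2 by lia.
  by rewrite -Ta -Tm /frame_app /=; congr (_, _); ring.
have i0 : inner (pull T Q) 0 0 by apply: (@inner_app T Q S E (0, 0) uT lQ); rewrite Ta.
have i2 : inner (pull T Q) (2 * g%:Z)%:~R 0.
  by apply: (@inner_app T Q S E (2 * g%:Z, 0) uT lQ); rewrite Tb.
exists T; split=> //; apply: (inner_segment (pull_convex (lb_convex lQ)) i0 i2).
by rewrite (ler_int R 0 2) (ler_int R 2); lia.
Qed.

Lemma pull_list E F (L : seq (int * int)) : unimodular F -> E =i map (frame_app F) L ->
  map (frame_app (frame_inv F)) E =i L.
Proof.
move=> uF hE x; rewrite -{1}(frame_appK uF x) mem_map; last exact: can_inj (frame_invK uF).
by rewrite hE mem_map //; exact: can_inj (frame_appK uF).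
Qed.

(** The triangle occupies three of the four parity classes; only (odd, odd) is left. *)
Lemma unit_triangle_extra Q S E (z : int * int) : lattice_body Q S E ->
  ~ collinear_inner Q 2 -> {subset unit_triangle <= E} -> z \in E -> z \notin unit_triangle ->
  exists u v : int, z = (2 * u + 1, 2 * v + 1).
Proof.
case: z => a b lQ nc tE zE zT.
have t00 : (0, 0) \in E by apply: tE.
have t10 : (1, 0) \in E by apply: tE.
have t01 : (0, 1) \in E by apply: tE.
have mid (t : int * int) (u v : int) : t \in E -> t \in unit_triangle ->
    t.1 + a = 2 * u -> t.2 + b = 2 * v -> False.
  move=> t1 tT e1 e2; apply: nc.
  apply: (collinear_midpoint (m := (u, v)) lQ t1 zE _ e1 e2).
  apply: contra zT => /eqP te; suff -> : (a, b) = t by [].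
  by move: e1 e2; rewrite te /= => e1 e2; congr (_, _); lia.
exists (a %/ 2)%Z, (b %/ 2)%Z.
have := mid (0, 0) (a %/ 2)%Z (b %/ 2)%Z t00 isT.
have := mid (1, 0) ((1 + a) %/ 2)%Z (b %/ 2)%Z t10 isT.
have := mid (0, 1) (a %/ 2)%Z ((1 + b) %/ 2)%Z t01 isT.
by move=> /= m1 m2 m3; congr (_, _); lia.
Qed.

Lemma two_row_triangle Q S E k : lattice_body Q S E -> ~ collinear_inner Q 2 ->
  {subset unit_triangle <= E} -> size E = k -> scover Q (threshold R k).
Proof.
move=> lQ nc tE sE; have uE := lb_uniq lQ.
have [/hasP[z zE zT]|/hasPn noz] := boolP (has (fun z => z \notin unit_triangle) E); last first.
  have hE : E =i unit_triangle.
    by move=> z; apply/idP/idP => [/noz|/tE //]; rewrite negbK.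
  have -> : k = 3%N by rewrite -sE (perm_size (uniq_perm uE _ hE)).
  exact: unit_triangle_case lQ hE.
(* Two further points would share the class (odd, odd). *)
have uniqz e : e \in E -> e \notin unit_triangle -> e = z.
  move=> eE eT; apply: contrapT => /eqP ez; apply: (nc).
  have [u [v eu]] := unit_triangle_extra lQ nc tE eE eT.
  have [u' [v' zu]] := unit_triangle_extra lQ nc tE zE zT.
  move: zE ez; rewrite zu eu => zE ez; rewrite eu in eE.
  apply: (collinear_midpoint (m := (u + u' + 1, v + v' + 1)) lQ eE zE); last 2 first.
  - by rewrite /=; ring.
  - by rewrite /=; ring.
  - by apply: contra ez => /eqP[h1 h2]; apply/eqP; congr (_, _); lia.
have hE : E =i z :: unit_triangle.
  move=> e; rewrite inE; apply/idP/idP => [eE|/predU1P[->//|/tE //]].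
  by have [//|/(uniqz e eE) ->] := boolP (e \in unit_triangle); rewrite ?orbT ?eqxx.
have -> : k = 4%N by rewrite -sE (perm_size (uniq_perm uE _ hE)) //= zT.
(* The row-1 point produced by [inner_band] is not in the triangle, so it would have to be [z],
   which lies in row 2 or beyond. *)
have band T : unimodular T -> frame_app T (0, 0) \in unit_triangle ->
    frame_app T (1, 0) \in unit_triangle ->
    all (fun e => (frame_app (frame_inv T) e).2 != 1) unit_triangle ->
    (frame_app (frame_inv T) z).2 <= 1.
  move=> uT t0 t1 /allP tT; rewrite leNgt; apply/negP => h.
  have h2 : 2 <= (frame_app (frame_inv T) z).2 by exact: h.
  have Qz := inner_sub ((lb_inner lQ z).1 zE).
  have [e eE e1] := inner_band_exists uT lQ (tE _ t0) (tE _ t1) Qz h2.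
  have [eT|eT] := boolP (e \in unit_triangle); first by have := tT e eT; rewrite e1 eqxx.
  by rewrite (uniqz e eE eT) in e1; rewrite e1 in h.
have [u [v zuv]] := unit_triangle_extra lQ nc tE zE zT.
have b1 := band (Frame (0, 0) (0, 1) (-1, 0)) erefl isT isT isT.
have b2 := band flip_frame erefl isT isT isT.
have b3 := band (Frame (1, 0) (-1, 1) (1, 0)) erefl isT isT isT.
have {b1} b1 : -1 <= u by move: b1; rewrite zuv /frame_app /= /frame_det /=; lia.
have {b2} b2 : -1 <= v by move: b2; rewrite zuv /frame_app /= /frame_det /=; lia.
have {b3} b3 : u + v <= 0 by move: b3; rewrite zuv /frame_app /= /frame_det /=; lia.
have via F (L : seq (int * int)) (P : (R -> R -> Prop) -> Prop) : unimodular F ->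
    perm_eq (z :: unit_triangle) (map (frame_app F) L) ->
    (forall Q' S' E', lattice_body Q' S' E' -> E' =i L -> P Q') -> P (pull F Q).
  move=> uF pL h; apply: (h _ _ _ (lattice_body_pull uF lQ)); apply: (pull_list uF) => e.
  by rewrite hE (perm_mem pL).
have square F : unimodular F ->
    perm_eq (z :: unit_triangle) (map (frame_app F) [:: (0, 0); (1, 0); (0, 1); (1, 1)]) ->
    scover Q (threshold R 4).
  move=> uF pL; apply: (scover_pull uF).
  by apply: (via F _ (fun Q' => scover Q' (threshold R 4)) uF pL); exact: unit_square_case.
have centroid F : unimodular F ->
    perm_eq (z :: unit_triangle) (map (frame_app F) [:: (0, 0); (1, 0); (0, 1); (-1, -1)]) ->
    scover Q (threshold R 4).
  move=> uF pL; apply: (scover_pull uF).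
  by apply: (via F _ (fun Q' => scover Q' (threshold R 4)) uF pL); exact: centroid_case.
have : (u = 0 /\ v = 0) \/ (u = -1 /\ v = 0) \/ (u = 0 /\ v = -1) \/
       (u = -1 /\ v = -1) \/ (u = 1 /\ v = -1) \/ (u = -1 /\ v = 1) by lia.
case=> [[eu ev]|[[eu ev]|[[eu ev]|[[eu ev]|[[eu ev]|[eu ev]]]]]]; rewrite eu ev in zuv.
- by apply: (square (Frame (0, 0) (1, 0) (0, 1))); rewrite ?zuv.
- by apply: (square (Frame (0, 0) (1, 0) (-1, 1))); rewrite ?zuv.
- by apply: (square (Frame (0, 0) (0, 1) (1, -1))); rewrite ?zuv.
- by apply: (centroid (Frame (0, 0) (1, 0) (0, 1))); rewrite ?zuv.
- by apply: (centroid (Frame (1, 0) (-1, 0) (-1, 1))); rewrite ?zuv.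
- by apply: (centroid (Frame (0, 1) (0, -1) (1, -1))); rewrite ?zuv.
Qed.

Lemma mem_pull_list T E z : unimodular T ->
  (z \in map (frame_app (frame_inv T)) E) = (frame_app T z \in E).
Proof.
by move=> uT; rewrite -{1}(frame_appK uT z) mem_map //; exact: can_inj (frame_invK uT).
Qed.

(** [inner_band] brings an interior lattice point into the row next to the unit segment, and a shear
    then moves the three points to the unit triangle. *)
Lemma two_row Q S E k (z : int * int) : lattice_body Q S E -> (0, 0) \in E -> (1, 0) \in E ->
  z \in E -> z.2 != 0 -> ~ collinear_inner Q 2 -> size E = k -> scover Q (threshold R k).
Proof.
wlog z0 : Q S E z / 0 < z.2 => [hw|].
  move=> lQ e0 e1 zE zn nc sE; have [h|h] := leP z.2 0; last exact: (hw Q S E z).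
  have uF : unimodular flip_frame by [].
  apply: (scover_pull uF).
  apply: (hw _ _ _ (frame_app (frame_inv flip_frame) z) _ (lattice_body_pull uF lQ)).
  - by rewrite [frame_app _ _]flip_app /=; move: zn h; case: z.2 => //; lia.
  - by rewrite mem_pull_list.
  - by rewrite mem_pull_list.
  - by rewrite mem_map //; exact: can_inj (frame_invK uF).
  - by rewrite [frame_app _ _]flip_app /= oppr_eq0.
  - by move=> /(collinear_inner_pull uF).
  - by rewrite size_map.
move=> lQ e0 e1 zE _ nc sE.
have [j jE] : exists j, (j, 1) \in E.
  have [z1|z1] := eqVneq z.2 1; first by exists z.1; rewrite -z1 -surjective_pairing.
  have i0 := (lb_inner lQ (0, 0)).1 e0; have i1 := (lb_inner lQ (1, 0)).1 e1.
  have Qz := inner_sub ((lb_inner lQ z).1 zE).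
  have h2 : 2 <= z.2 by move: z0 z1; case: z.2 => //; lia.
  have [j ij] := inner_band (lb_convex lQ) i0 i1 Qz h2.
  by exists j; apply/(lb_inner lQ).
have uF := unimodular_shear j.
apply: (scover_pull uF); apply: (two_row_triangle (lattice_body_pull uF lQ)).
- by move=> /(collinear_inner_pull uF).
- move=> t; rewrite mem_pull_list // !inE => /or3P[]/eqP ->.
  + by rewrite /frame_app /= !(mul0r, addr0).
  + by rewrite /frame_app /= !(mul0r, mul1r, mulr0, addr0, add0r).
  + by rewrite /frame_app /= !(mul0r, mul1r, mulr0, addr0, add0r).
- by rewrite size_map.
Qed.

End Classification.

(** * Classification *)

Section MainAbstract.
Variable R : realType.
Implicit Types (Q : R -> R -> Prop) (c x y : R) (S E : seq (int * int)) (T : frame).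

Lemma collinear_inner_bound Q S E n : lattice_body Q S E -> collinear_inner Q n ->
  (n < size E)%N.
Proof.
move=> lQ [T [uT i0 iN]]; pose L := [seq frame_app T (i%:Z, 0) | i <- iota 0 n.+1].
have cQ := pull_convex (T := T) (lb_convex lQ).
have : {subset L <= E}.
  move=> _ /mapP[i + ->]; rewrite mem_iota add0n ltnS => /andP[_ i_n].
  apply/(lb_inner lQ)/(inner_pull_app Q (i%:Z, 0) uT).
  by apply: (inner_segment cQ i0 iN); rewrite /= -!pmulrn ler0n ler_nat.
move=> /(@uniq_leq_size _ L E _); rewrite size_map size_iota; apply.
rewrite map_inj_uniq ?iota_uniq //.
by move=> i j /(can_inj (frame_appK uT))[].
Qed.

Lemma collinear_inner_line Q S E (a b h : int) : lattice_body Q S E ->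
  inner Q a%:~R h%:~R -> inner Q b%:~R h%:~R -> a <= b -> collinear_inner Q (absz (b - a)).
Proof.
move=> lQ ia ib ab; exists (left_frame a h); split=> //; apply: inner_pull_of => /=.
  by rewrite !(mulr1, mulr0, mul0r, addr0).
have -> : (absz (b - a))%:R = (b - a)%:~R :> R by rewrite pmulrn; congr intr; lia.
by rewrite !(mulr1, mulr0, mul0r, addr0) intrB addrC subrK.
Qed.

Lemma max_collinear Q S E : lattice_body Q S E -> (2 <= size E)%N -> exists r T,
  [/\ (1 <= r)%N, unimodular T, inner (pull T Q) 0 0, inner (pull T Q) r%:R 0 &
      forall n, collinear_inner Q n -> (n <= r)%N].
Proof.
move=> lQ E2.
have [g [g0 hg]] : exists g, (0 < g)%N /\ collinear_inner Q g.
  case: E lQ E2 => [|a [|b E]] // lQ _.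
  have /= /and3P[ab _ _] := lb_uniq lQ.
  have abn : a != b by apply: contra ab => /eqP ->; exact: mem_head.
  have [T [g [uT g0 Ta Tb]]] := frame_through abn.
  exists g; split=> //; exists T; split=> //.
    by apply: (@inner_app _ T _ _ _ (0, 0) uT lQ); rewrite Ta mem_head.
  have := @inner_app _ T _ _ _ (g%:Z, 0) uT lQ.
  by rewrite Tb !inE eqxx orbT => /(_ isT); rewrite /= -pmulrn.
have [||r /asboolP[T [uT i0 ir]] hr] := @ex_maxnP (fun n => `[< collinear_inner Q n >]) (size E).
- by exists g; apply/asboolP.
- by move=> n /asboolP /(collinear_inner_bound lQ) /ltnW.
exists r, T; split=> //.
- by apply: leq_trans g0 _; apply: hr; apply/asboolP.
- by move=> n hn; apply: hr; apply/asboolP.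
Qed.

Lemma extreme_heights Q S E : lattice_body Q S E -> inner Q 0 0 -> exists lo hi (tlo thi : int),
  [/\ heights S lo hi, Q tlo%:~R lo%:~R & Q thi%:~R hi%:~R].
Proof.
move=> lQ i0; have [|s0 s0S _] := inner_support (a := 0) (b := 1) lQ i0.
  by rewrite xpair_eqE oner_eq0 andbF.
have [t tS tmax] := seq_argmax (fun s : int * int => s.2) s0S.
have [b bS bmin] := seq_argmax (fun s : int * int => - s.2) s0S.
exists b.2, t.2, b.1, t.1; split; [|exact: (lb_vertex lQ)|exact: (lb_vertex lQ)].
by move=> s sS; rewrite tmax // andbT -lerN2 bmin.
Qed.

Lemma noncollinear_case Q S E r k (z : int * int) : lattice_body Q S E -> size E = k ->
  (1 <= r)%N -> inner Q 0 0 -> inner Q r%:R 0 ->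
  (forall n, collinear_inner Q n -> (n <= r)%N) -> z \in E -> z.2 != 0 ->
  scover Q (threshold R k).
Proof.
move=> lQ sE r1 i0 ir hr zE z2; have cQ := lb_convex lQ.
have [lo [hi [tlo [thi [hS Qlo Qhi]]]]] := extreme_heights lQ i0.
have lohi : lo < 0 < hi by apply: (inner_height (x := 0) lQ hS).
have zlh : lo < z.2 < hi by apply: (inner_height lQ hS ((lb_inner lQ z).1 zE)).
have w3 : 3 <= hi - lo by move: zlh z2; case: z.2 => //; lia.
(* Maximality over all directions bounds every horizontal row, not only the one on the axis. *)
have rows h := row_le h lQ hr.
have [r3|r2] := leqP 3 r.
  apply: (long_row lQ hS Qlo Qhi i0 ir w3 r3).
  rewrite -sE -(size_inner_rows lo hi); apply: size_rows => // e eE.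
  exact: (inner_in_rows lQ hS).
have [r2'|r1'] := leqP 2 r.
  have r_2 : r = 2%N by lia.
  rewrite r_2 in ir hr rows.
  have [hl|hl] := leP 0 (hi + lo).
    exact: (three_row lQ hS Qlo Qhi i0 ir w3 hl).
  have uF : unimodular flip_frame by [].
  apply: (scover_pull uF).
  apply: (@three_row _ (pull flip_frame Q) _ _ (- hi) (- lo) k thi%:~R tlo%:~R
    (lattice_body_pull uF lQ)).
  - by move=> _ /mapP[s sS ->]; rewrite flip_app /= !lerN2 andbC; exact: hS.
  - by rewrite pull_flip intrN opprK.
  - by rewrite pull_flip intrN opprK.
  - exact: inner_flip.
  - exact: inner_flip.
  - by lia.
  - by lia.
  - by move=> h; rewrite row_flip.
  - by rewrite size_map.
have r_1 : r = 1%N by lia.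
rewrite r_1 in ir hr.
apply: (two_row lQ _ _ zE z2 _ sE).
- by apply/(lb_inner lQ).
- by apply/(lb_inner lQ).
- by move=> /hr.
Qed.

Lemma small_or_cross_of_body Q S E k : lattice_body Q S E -> size E = k -> (2 <= k)%N ->
  small_or_cross Q k.
Proof.
move=> lQ sE k2; have [|r [T [r1 uT i0 ir hr]]] := max_collinear lQ; first by rewrite sE.
apply: (small_or_cross_pull uT); have lQ' := lattice_body_pull uT lQ.
have hr' n : collinear_inner (pull T Q) n -> (n <= r)%N by move=> /(collinear_inner_pull uT)/hr.
have sE' : size (map (frame_app (frame_inv T)) E) = k by rewrite size_map.
move: (pull T Q) (map _ S) (map _ E) lQ' hr' sE' i0 ir => {lQ sE hr uT T S E Q} Q S E lQ.
move=> hr sE i0 ir.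
have [/hasP[z zE z2]|/hasPn flat] := boolP (has (fun z : int * int => z.2 != 0) E).
  by left; exact: (noncollinear_case lQ sE r1 i0 ir hr zE z2).
have flat_ab (a b : int) : (a, b) \in E -> b = 0 /\ 0 <= a < r.+1%:Z.
  move=> abE; have b0 : b = 0 by apply/eqP; move: (flat _ abE); rewrite negbK.
  split=> //; have ia := (lb_inner lQ (a, b)).1 abE; rewrite b0 /= in ia.
  have ir' : inner Q (r%:Z)%:~R 0%:~R by [].
  have i0' : inner Q 0%:~R 0%:~R by [].
  have [a0|a0] := ltP a 0.
    by have := hr _ (collinear_inner_line lQ ia ir' ltac:(lia)); lia.
  by have := hr _ (collinear_inner_line lQ i0' ia a0); lia.
have flat' z : z \in E -> z.2 = 0 /\ 0 <= z.1 < r.+1%:Z.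
  by case: z => a b /flat_ab.
have rk : (r < k)%N.
  have : collinear_inner Q r.
    exists (Frame (0, 0) (1, 0) (0, 1)); split=> //; apply: inner_pull_of => /=;
    by rewrite !(mulr1, mulr0, mul0r, addr0, add0r).
  by move=> /(collinear_inner_bound lQ); rewrite sE.
have kr : k = r.+1.
  apply/eqP; rewrite eqn_leq rk andbT -sE.
  pose L := [seq (i%:Z, 0 : int) | i <- iota 0 r.+1].
  have : {subset E <= L}.
    move=> [a b] /flat_ab[-> a1]; apply/mapP; exists (absz a); last by congr (_, _); lia.
    by rewrite mem_iota; lia.
  by move=> /(uniq_leq_size (lb_uniq lQ)); rewrite size_map size_iota.
rewrite kr; apply: (collinear_case _ lQ i0) => //.
by rewrite -natr1 addrK.
Qed.

End MainAbstract.

(** * Coordinates of the plane *)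

Section Plane.
Variable R : realType.
Local Notation plane := 'rV[R]_2.
Implicit Types (P : set plane) (u v w p q z : plane) (x y t : R).

Definition pt x y : plane := \row_j (if j == ord0 then x else y).
Definition px v := v ord0 ord0.
Definition py v := v ord0 ord_max.

Lemma px_pt x y : px (pt x y) = x. Proof. by rewrite /px mxE. Qed.
Lemma py_pt x y : py (pt x y) = y. Proof. by rewrite /py mxE. Qed.
Lemma pt_coord v : pt (px v) (py v) = v.
Proof.
apply/rowP => j; rewrite mxE /px /py; case: eqP => [->|j0] //.
by congr (v _ _); apply: val_inj; case: j j0 => [[|[|]]] //= h []; apply: val_inj.
Qed.
Lemma ptP u v : px u = px v -> py u = py v -> u = v.
Proof. by move=> hx hy; rewrite -(pt_coord u) -(pt_coord v) hx hy. Qed.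
Lemma pxD u v : px (u + v) = px u + px v. Proof. by rewrite /px mxE. Qed.
Lemma pyD u v : py (u + v) = py u + py v. Proof. by rewrite /py mxE. Qed.
Lemma pxN u : px (- u) = - px u. Proof. by rewrite /px mxE. Qed.
Lemma pyN u : py (- u) = - py u. Proof. by rewrite /py mxE. Qed.
Lemma pxZ t u : px (t *: u) = t * px u. Proof. by rewrite /px mxE. Qed.
Lemma pyZ t u : py (t *: u) = t * py u. Proof. by rewrite /py mxE. Qed.
Lemma px0 : px 0 = 0. Proof. by rewrite /px mxE. Qed.
Lemma py0 : py 0 = 0. Proof. by rewrite /py mxE. Qed.
Definition coordE := (px_pt, py_pt, pxD, pyD, pxN, pyN, pxZ, pyZ, px0, py0).

Lemma Z2P v : Z2 v <-> px v \is a Num.int /\ py v \is a Num.int.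
Proof.
split=> [/mxOverP h|[hx hy]]; first by split; exact: h.
apply/mxOverP => i j; rewrite ord1 -(pt_coord v) mxE.
by case: ifP.
Qed.

Lemma Z2_pt (a b : int) : Z2 (pt a%:~R b%:~R).
Proof. by apply/Z2P; rewrite !coordE !intr_int. Qed.

Lemma Z2_ex v : Z2 v -> exists a b : int, v = pt a%:~R b%:~R.
Proof. by move=> /Z2P[/intrP[a ha] /intrP[b hb]]; exists a, b; rewrite -ha -hb pt_coord. Qed.

Definition coords P x y := P (pt x y).

Definition int_coords v : int * int := (Num.floor (px v), Num.floor (py v)).

Lemma int_coordsK v : Z2 v -> pt (int_coords v).1%:~R (int_coords v).2%:~R = v.
Proof. by move=> /Z2_ex[a [b ->]]; rewrite /int_coords !coordE !intrKfloor. Qed.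

Lemma int_coords_pt (a b : int) : int_coords (pt a%:~R b%:~R) = (a, b).
Proof. by rewrite /int_coords !coordE !intrKfloor. Qed.

Lemma inner_coords P x y : inner (coords P) x y <-> interior P (pt x y).
Proof.
split=> [[e e0 h]|/nbhs_ballP[e /= e0 h]].
  apply/nbhs_ballP; exists e => //= v [_ hv].
  rewrite -(pt_coord v); apply: h; rewrite distrC.
    by have := hv ord0 ord0; rewrite -ball_normE /= mxE.
  by have := hv ord0 ord_max; rewrite -ball_normE /= mxE.
exists e => // x' y' hx hy; apply: h; rewrite -ball_normE /= /Num.Def.normr /= mx_normrE.
apply/bigmax_ltP; split=> // -[i j] _ /=; rewrite !mxE.
by case: ifP => _; rewrite distrC.
Qed.

End Plane.

(** * From planar sets to coordinates; primitive vectors and lattice length *)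

Section Bridge.
Variable R : realType.
Local Notation plane := 'rV[R]_2.
Implicit Types (P : set plane) (u v w p q r s c z : plane) (x y t : R).

Lemma coords_body P k : lattice_polygon P -> (interior_lattice_points P #= `I_k)%card ->
  exists S E, lattice_body (coords P) S E /\ size E = k.
Proof.
move=> [l [lZ PE]] cardP.
pose I := interior_lattice_points P.
have finI : finite_set I by exists k.
pose F := finmap.enum_fset (fset_set I).
have FI v : v \in F = (v \in I) by rewrite -(in_fset_set finI).
have IZ v : v \in F -> Z2 v by rewrite FI inE => -[].
exists (map (@int_coords R) l), (map (@int_coords R) F); split; last first.
  by rewrite size_map; exact: card_fset_set.
split.
- move=> x y x' y' t; rewrite /coords => h h' t01.
  have -> : pt (t * x + (1 - t) * x') (t * y + (1 - t) * y') =
    t *: pt x y + (1 - t) *: pt x' y' by apply: ptP; rewrite !coordE.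
  by rewrite PE in h h' *; exact: conv_convex.
- move=> _ /mapP[v vl ->]; rewrite /coords int_coordsK; last exact: lZ.
  by rewrite PE; exact: sub_conv.
- move=> a b d hl x y; rewrite /coords PE => Pxy.
  suff /(_ _ Pxy) : Defs.conv [set` l] `<=` [set v : plane | a * px v + b * py v <= d].
    by rewrite /= !coordE.
  apply: conv_sub => [v w t /= hv hw t01|v /= vl].
    by rewrite !coordE; nra.
  have e := int_coordsK (lZ v vl); have := hl _ (map_f _ vl).
  have <- : px v = (int_coords v).1%:~R by rewrite -{1}e px_pt.
  by have <- : py v = (int_coords v).2%:~R by rewrite -{1}e py_pt.
- rewrite map_inj_in_uniq ?finmap.fset_uniq // => v w /IZ vZ /IZ wZ e.
  by rewrite -(int_coordsK vZ) e int_coordsK.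
- move=> [a b] /=; rewrite inner_coords; split.
    move=> /mapP[v vF e]; have vZ := IZ v vF.
    have -> : pt a%:~R b%:~R = v by rewrite -[RHS](int_coordsK vZ) -e.
    by move: vF; rewrite FI inE => -[].
  move=> iv; apply/mapP; exists (pt a%:~R b%:~R); last by rewrite int_coords_pt.
  by rewrite FI inE; split=> //; exact: Z2_pt.
Qed.

Lemma covers_coords P (c : R) : 0 < c -> tcover (coords P) c -> covers c^-1 P.
Proof.
move=> c0 h; apply/seteqP; split=> // v _.
have [x [y [i [j [Pxy hx hy]]]]] := h (c * px v) (c * py v).
exists (pt x y) => //; exists (pt i%:~R j%:~R); first exact: Z2_pt.
apply: ptP; rewrite !coordE; apply: (mulfI (lt0r_neq0 c0)).
  by rewrite hx mulrDr mulVKf // lt0r_neq0.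
by rewrite hy mulrDr mulVKf // lt0r_neq0.
Qed.

Lemma segmentE p q : segment p q = [set t *: p + (1 - t) *: q | t in `[0, 1]].
Proof.
apply/seteqP; split; last first.
  move=> _ [t /= t01 <-]; apply: conv_convex.
  - by apply: sub_conv; left.
  - by apply: sub_conv; right.
  - by move: t01; rewrite in_itv.
apply: conv_sub => [_ _ l [t /= + <-] [t' /= + <-] l01|x [->|->]].
- rewrite !in_itv /= => t01 t01'.
  exists (l * t + (1 - l) * t'); first by rewrite /= in_itv /=; nra.
  by apply: ptP; rewrite !coordE; ring.
- by exists 1; rewrite /= ?in_itv /= ?ler01 ?lexx // scale1r subrr scale0r addr0.
- by exists 0; rewrite /= ?in_itv /= ?ler01 ?lexx // scale0r subr0 scale1r add0r.
Qed.

(** [w] generates the lattice on its line; the condition also forces [w] to be nonzero. *)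
Definition primitive w := Z2 w /\ forall t, Z2 (t *: w) -> t \is a Num.int.

Lemma primitive_neq0 w : primitive w -> w != 0.
Proof.
move=> [_ h]; apply/eqP => w0.
have /intrP[m mE] : (2^-1 : R) \is a Num.int.
  by apply: h; rewrite w0 scaler0; apply/Z2P; rewrite !coordE !rpred0.
have : (2 * m)%:~R = 1%:~R :> R by rewrite intrM -mE mulfV.
by move=> /eqP; rewrite eqr_int => /eqP; lia.
Qed.

Lemma Z2D u v : Z2 u -> Z2 v -> Z2 (u + v).
Proof. by move=> /Z2P[a b] /Z2P[c d]; apply/Z2P; rewrite !coordE !rpredD. Qed.

Lemma Z2N u : Z2 u -> Z2 (- u).
Proof. by move=> /Z2P[a b]; apply/Z2P; rewrite !coordE !rpredN. Qed.

Lemma Z2Z (m : int) u : Z2 u -> Z2 (m%:~R *: u).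
Proof. by move=> /Z2P[a b]; apply/Z2P; rewrite !coordE !rpredM ?intr_int. Qed.

Lemma lattice_length_primitive p w (m : nat) : Z2 p -> primitive w ->
  lattice_length (segment p (p + m%:R *: w)) m.
Proof.
move=> pZ pw; have [wZ wprim] := pw; rewrite /lattice_length.
have -> : segment p (p + m%:R *: w) `&` @Z2 R = [set p + i%:R *: w | i in `I_m.+1].
  apply/seteqP; split=> [z [+ zZ]|_ [i /= im <-]]; last first.
    split; last first.
      by apply: Z2D => //; rewrite pmulrn; exact: Z2Z.
    rewrite segmentE; have [m0|m0] := posnP m.
      exists 1; first by rewrite /= in_itv /= ler01 lexx.
      have -> : i = 0%N by lia.
      by apply: ptP; rewrite !coordE; ring.
    have mR : (0 : R) < m%:R by rewrite ltr0n.
    exists (1 - i%:R / m%:R).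
      rewrite /= in_itv /= subr_ge0 ler_pdivrMr // mul1r ler_nat -ltnS im /=.
      by rewrite lerBlDr lerDl divr_ge0.
    by apply: ptP; rewrite !coordE; field; exact: lt0r_neq0.
  rewrite segmentE => -[t /=]; rewrite in_itv /= => t01 zE.
  have zE' : z - p = ((1 - t) * m%:R) *: w by rewrite -zE; apply: ptP; rewrite !coordE; ring.
  have /intrP[i iE] : (1 - t) * m%:R \is a Num.int.
    by apply: wprim; rewrite -zE'; apply: Z2D => //; exact: Z2N.
  have m0 : (0 : R) <= m%:R by [].
  have i0 : 0 <= i by rewrite -(ler0z R) -iE mulr_ge0 //; lra.
  have im : i <= m%:Z.
    rewrite -(ler_int R) -iE -pmulrn; nra.
  exists (absz i); first by rewrite /=; lia.
  have -> : (absz i)%:R = i%:~R :> R by rewrite pmulrn; congr intr; lia.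
  by rewrite -iE -zE' addrC subrK.
apply: inj_card_eq => i j _ _ /addrI/eqP.
rewrite -subr_eq0 -scalerBl scaler_eq0 (negPf (primitive_neq0 pw)) orbF subr_eq0 eqr_nat.
by move/eqP.
Qed.

(** Cramer's rule writes [t] as an integer combination of the coordinates of [t] times the
    vector. *)
Lemma primitive_frame (a b a' b' : int) : (a * b' - b * a') ^+ 2 = 1 ->
  primitive (pt a%:~R b%:~R : plane).
Proof.
move=> d1; split=> [|t]; first exact: Z2_pt.
move=> /Z2P[]; rewrite !coordE => ta tb.
have -> : t = ((t * a%:~R) * b'%:~R - (t * b%:~R) * a'%:~R) * (a * b' - b * a')%:~R.
  transitivity (t * ((a * b' - b * a') ^+ 2)%:~R); first by rewrite d1 mulr1.
  by rewrite expr2 intrM !(intrB, intrM); ring.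
apply: rpredM; last exact: intr_int.
by apply: rpredB; apply: rpredM => //; exact: intr_int.
Qed.

Lemma primitive_multiple v : Z2 v -> v != 0 -> exists w (g : nat), primitive w /\ v = g%:R *: w.
Proof.
move=> /Z2_ex[a [b ->]] v0.
have ab : (0, 0) != (a, b).
  apply: contra v0 => /eqP[<- <-]; apply/eqP; apply: ptP; rewrite !coordE //.
have [T [g [uT g0 T0 Tg]]] := frame_through ab.
case: T uT T0 Tg => [[p1 p2] [u1 u2] [v1 v2]] /= uT.
rewrite /frame_app /= !(mul0r, addr0) => -[-> ->] [<- <-].
exists (pt u1%:~R u2%:~R), g; split.
  by apply: (@primitive_frame u1 u2 v1 v2); rewrite expr2; exact: uT.
by apply: ptP; rewrite !coordE add0r intrM.
Qed.

Lemma row_free_pairP u v : row_free (col_mx u v) <->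
  forall a b : R, a *: u + b *: v = 0 -> a = 0 /\ b = 0.
Proof.
have mulE (A B : 'rV[R]_1) : row_mx A B *m col_mx u v = A 0 0 *: u + B 0 0 *: v.
  by rewrite mul_row_col [A]mx11_scalar [B]mx11_scalar !mul_scalar_mx !mxE !eqxx.
split=> [fr a b ab|h].
  have : row_mx a%:M b%:M *m col_mx u v == 0 by rewrite mulE !mxE eqxx /= !mulr1n ab.
  rewrite mulmx_free_eq0 // row_mx_eq0 => /andP[/eqP a0 /eqP b0].
  move: (congr1 (fun A : 'M[R]_1 => A 0 0) a0) (congr1 (fun A : 'M[R]_1 => A 0 0) b0).
  by rewrite !mxE eqxx !mulr1n.
apply: inj_row_free => A; rewrite -(hsubmxK A) mulE => /h[a0 b0].
have z : scalar_mx 0 = 0 :> 'M[R]_1 by rewrite -scalemx1 scale0r.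
by rewrite [lsubmx A]mx11_scalar [rsubmx A]mx11_scalar a0 b0 z row_mx0.
Qed.

End Bridge.

(** * Covering radius and recognition of direct sums *)

Section DirectSums.
Variable R : realType.
Local Notation plane := 'rV[R]_2.
Implicit Types (P : set plane) (u v w p q r s c z : plane) (x y t : R).

(** [X] is the midpoint of the gap between the interval s0 [-l, m - l] and its translate by 1, so
    smaller scales cannot reach it modulo the integers either. *)
Lemma gauge_gap (m l s s0 e X : R) (i : int) : 0 <= l <= m -> s0 * m < 1 -> 0 <= s ->
  X = s0 * (m - l) + (1 - s0 * m) / 2 -> - l <= e <= m - l -> X = s * e + i%:~R -> s0 < s.
Proof.
move=> lm s0m s_0 X1 el X2; rewrite ltNge; apply/negP => ss.
have [h1 h2] : s * e <= s * (m - l) /\ - (s * l) <= s * e.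
  by rewrite -mulrN !ler_wpM2l //; lra.
have h3 : s * (m - l) <= s0 * (m - l) by rewrite ler_wpM2r //; lra.
have h4 : s * l <= s0 * l by rewrite ler_wpM2r //; lra.
have [i0|i0] := leP i 0.
  have : i%:~R <= 0 :> R by rewrite lerz0.
  by lra.
have : 1 <= i%:~R :> R by rewrite -[1]/(1%:~R) ler_int.
by lra.
Qed.

(** A point of the dilated sum has coordinates along the two segments scaled by mu t and mu (1 - t),
    which add up to mu. A target in both gaps forces each scale above its own bound. *)
Lemma direct_sum_lower_bound P (m n : nat) (mu : R) : (0 < m)%N -> (0 < n)%N ->
  direct_sum_of_lattice_segments P m n -> 0 <= mu -> covers mu P ->
  m%:R^-1 + n%:R^-1 <= mu.
Proof.
move=> m0 n0 [p [q [r [s [c [[pZ qZ rZ sZ] [lK lL] [fr spl] [Kc Lc] PE]]]]]] mu0 cov.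
have m0R : (0 : R) < m%:R by rewrite ltr0n.
have n0R : (0 : R) < n%:R by rewrite ltr0n.
have free := (row_free_pairP _ _).1 fr.
have step (p' q' : plane) (k : nat) : Z2 p' -> Z2 q' -> q' - p' != 0 ->
    lattice_length (segment p' q') k -> exists2 w, primitive w & q' = p' + k%:R *: w.
  move=> pZ' qZ' pq lk.
  have [w [g [pw gE]]] := primitive_multiple (Z2D qZ' (Z2N pZ')) pq.
  have qE : q' = p' + g%:R *: w by rewrite -gE addrC subrK.
  exists w => //; rewrite [LHS]qE; congr (_ + _%:R *: _).
  have := lattice_length_primitive g pZ' pw; rewrite -qE /lattice_length => h.
  rewrite /lattice_length card_eq_sym in lk.
  by have /card_eq_II[] := card_eq_trans lk h.
have qp0 : q - p != 0.
  apply/eqP => h; have [|/eqP] := free 1 0; last by rewrite oner_eq0.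
  by rewrite h scaler0 scale0r addr0.
have sr0 : s - r != 0.
  apply/eqP => h; have [|_ /eqP] := free 0 1; last by rewrite oner_eq0.
  by rewrite h scaler0 scale0r addr0.
have [w1 [w1Z w1p] qE] := step p q m pZ qZ qp0 lK.
have [w2 [w2Z w2p] sE] := step r s n rZ sZ sr0 lL.
have D1 : q - p = m%:R *: w1 by rewrite qE addrC addKr.
have D2 : s - r = n%:R *: w2 by rewrite sE addrC addKr.
have free' (a b a' b' : R) : a *: w1 + b *: w2 = a' *: w1 + b' *: w2 -> a = a' /\ b = b'.
  move=> h; have [|/eqP h1 /eqP h2] := free ((a - a') / m%:R) ((b - b') / n%:R).
    rewrite D1 D2 !scalerA !divfK ?lt0r_neq0 //.
    apply/eqP; rewrite !scalerBl addrACA -opprD subr_eq0; exact/eqP.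
  move: h1 h2; rewrite !mulf_eq0 !invr_eq0 !(gt_eqF m0R) !(gt_eqF n0R) !orbF !subr_eq0.
  by move=> /eqP -> /eqP ->.
(* [Z2_splits] is what makes the primitive vectors of the two segments a basis of Z^2. *)
have lat z : Z2 z -> exists i j : int, z = i%:~R *: w1 + j%:~R *: w2.
  move=> /spl[a [b [aZ bZ ->]]]; rewrite D1 D2 !scalerA in aZ bZ *.
  have /intrP[i ->] := w1p _ aZ; have /intrP[j ->] := w2p _ bZ.
  by exists i, j.
have onseg p' w (k : nat) v : segment p' (p' + k%:R *: w) v ->
    exists2 l : R, 0 <= l <= k%:R & v = p' + l *: w.
  rewrite segmentE => -[t /=]; rewrite in_itv /= => t01 <-.
  have k0 : (0 : R) <= k%:R by [].
  exists ((1 - t) * k%:R); first by nra.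
  by apply: ptP; rewrite !coordE; ring.
rewrite qE sE in Kc Lc PE.
have [l1 l1m cE1] := onseg _ _ _ _ Kc.
have [l2 l2n cE2] := onseg _ _ _ _ Lc.
rewrite leNgt; apply/negP => hmu.
(* Half the deficit is taken from each reciprocal, so that [s1 + s2 = mu]. *)
pose d := (m%:R^-1 + n%:R^-1 - mu) / 2.
have d0 : 0 < d by rewrite divr_gt0 //; lra.
pose s1 := m%:R^-1 - d; pose s2 := n%:R^-1 - d.
have s1m : s1 * m%:R < 1 by rewrite /s1 mulrBl mulVf ?gt_eqF // ltrBlDr ltrDl mulr_gt0.
have s2n : s2 * n%:R < 1 by rewrite /s2 mulrBl mulVf ?gt_eqF // ltrBlDr ltrDl mulr_gt0.
pose X := s1 * (m%:R - l1) + (1 - s1 * m%:R) / 2.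
pose Y := s2 * (n%:R - l2) + (1 - s2 * n%:R) / 2.
have [y Py [z /lat[i [j ->]] xE]] : [set mu *: y + z | y in P & z in @Z2 R]
    (mu *: c + (X *: w1 + Y *: w2)) by rewrite [X in X _]cov.
move: Py; rewrite PE => -[_ [a [b [t [[k1 Kk1 <-] [k2 Lk2 <-] t01 ->]]] yE]].
have [e1 e1m k1E] := onseg _ _ _ _ Kk1.
have [e2 e2n k2E] := onseg _ _ _ _ Lk2.
have [XE YE] : X = mu * t * (e1 - l1) + i%:~R /\ Y = mu * (1 - t) * (e2 - l2) + j%:~R.
  apply: free'; have -> : X *: w1 + Y *: w2 = (mu *: c + (X *: w1 + Y *: w2)) - mu *: c.
    by rewrite addrAC subrr add0r.
  have h1 : k1 - c = (e1 - l1) *: w1 by rewrite k1E cE1; apply: ptP; rewrite !coordE; ring.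
  have h2 : k2 - c = (e2 - l2) *: w2 by rewrite k2E cE2; apply: ptP; rewrite !coordE; ring.
  rewrite -xE -yE h1 h2.
  by apply: ptP; rewrite !coordE; ring.
have t1 : s1 < mu * t.
  by apply: (gauge_gap l1m s1m _ _ _ XE) => //; [apply: mulr_ge0; lra|lra].
have t2 : s2 < mu * (1 - t).
  by apply: (gauge_gap l2n s2n _ _ _ YE) => //; [apply: mulr_ge0; lra|lra].
by move: t1 t2; rewrite /s1 /s2 /d; lra.
Qed.

Lemma cross_direct_sum P k T : unimodular T -> cross_sum (pull T (coords P)) k ->
  direct_sum_of_lattice_segments P 2 k.+1.
Proof.
case: T => [[p1 p2] [u1 u2] [v1 v2]] uT [a ak crossE].
pose A (i j : int) : plane := pt (p1 + i * u1 + j * v1)%:~R (p2 + i * u2 + j * v2)%:~R.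
have AZ i j : Z2 (A i j) by exact: Z2_pt.
pose u : plane := pt u1%:~R u2%:~R; pose v : plane := pt v1%:~R v2%:~R.
have d1 : (u1 * v2 - u2 * v1) ^+ 2 = 1 by rewrite expr2.
have pu : primitive u by exact: (@primitive_frame _ u1 u2 v1 v2).
have pv : primitive v.
  by apply: (@primitive_frame _ v1 v2 u1 u2); rewrite -d1; ring.
pose D : R := (u1 * v2 - u2 * v1)%:~R.
have D1 : D * D = 1 by rewrite /D -intrM -expr2 d1.
have Dc : D = u1%:~R * v2%:~R - u2%:~R * v1%:~R by rewrite /D intrB !intrM.
have vE : A a 1 = A a (-1) + 2%:R *: v.
  by apply: ptP; rewrite !coordE !(intrD, intrM, intrN); ring.
have uE : A k%:Z 0 = A (-1) 0 + k.+1%:R *: u.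
  by apply: ptP; rewrite !coordE !(intrD, intrM, intrN) -natr1 -!pmulrn; ring.
have coef (x y : R) : x *: u + y *: v = 0 -> x = 0 /\ y = 0.
  move=> h; move: (congr1 (@px R) h) (congr1 (@py R) h); rewrite !coordE => hx hy.
  split.
    rewrite -[x]mulr1 -D1 Dc.
    transitivity (((x * u1%:~R + y * v1%:~R) * v2%:~R - (x * u2%:~R + y * v2%:~R) * v1%:~R) *
      (u1%:~R * v2%:~R - u2%:~R * v1%:~R)); first by ring.
    by rewrite hx hy; ring.
  rewrite -[y]mulr1 -D1 Dc.
  transitivity (((x * u2%:~R + y * v2%:~R) * u1%:~R - (x * u1%:~R + y * v1%:~R) * u2%:~R) *
      (u1%:~R * v2%:~R - u2%:~R * v1%:~R)); first by ring.
  by rewrite hx hy; ring.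
have kn : (k.+1%:R : R) != 0 by rewrite pnatr_eq0.
have Dv : A a 1 - A a (-1) = 2%:R *: v by rewrite vE addrC addKr.
have Du : A k%:Z 0 - A (-1) 0 = k.+1%:R *: u by rewrite uE addrC addKr.
have a1 : -1 <= a%:~R :> R by rewrite -[-1](intrN R 1) ler_int; lia.
have aK : a%:~R <= k%:R :> R by rewrite pmulrn ler_int; lia.
have k0 : (0 : R) <= k%:R by [].
have cK (x : R) : -1 <= x <= 1 -> segment (A a (-1)) (A a 1) (A a 0 + x *: v).
  move=> x1; rewrite segmentE; exists ((1 - x) / 2); first by rewrite /= in_itv /=; lra.
  by apply: ptP; rewrite !coordE !(intrD, intrM, intrN); field.
have cL (x : R) : -1 - a%:~R <= x <= k%:R - a%:~R ->
    segment (A (-1) 0) (A k%:Z 0) (A a 0 + x *: u).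
  move=> x1; rewrite segmentE; exists ((k%:R - a%:~R - x) / k.+1%:R).
    by rewrite /= in_itv /= divr_ge0 ?ler_pdivrMr ?ltr0n // -?natr1; lra.
  by apply: ptP; rewrite !coordE !(intrD, intrM, intrN) -natr1 -!pmulrn; field; rewrite natr1.
exists (A a (-1)), (A a 1), (A (-1) 0), (A k%:Z 0), (A a 0); split.
- by split; exact: AZ.
- split; first by rewrite vE; exact: lattice_length_primitive.
  by rewrite uE; exact: lattice_length_primitive.
- split.
    apply/row_free_pairP => x y; rewrite Dv Du !scalerA addrC => /coef[/eqP hy /eqP hx].
    move: hx hy; rewrite !mulf_eq0 (negPf kn) orbF pnatr_eq0 orbF.
    by move=> /eqP -> /eqP ->.
  move=> z /Z2_ex[b [b' ->]]; rewrite Dv Du.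
  pose i := (u1 * v2 - u2 * v1) * (b * v2 - b' * v1).
  pose j := (u1 * v2 - u2 * v1) * (u1 * b' - u2 * b).
  have zE : pt b%:~R b'%:~R = i%:~R *: u + j%:~R *: v.
    apply: ptP; rewrite !coordE -!intrM -!intrD; congr intr.
      by transitivity ((u1 * v2 - u2 * v1) ^+ 2 * b); [rewrite d1 mul1r|rewrite /i /j; ring].
    by transitivity ((u1 * v2 - u2 * v1) ^+ 2 * b'); [rewrite d1 mul1r|rewrite /i /j; ring].
  (* The differences of the end points are [2 v] and [(k + 1) u], hence the denominators. *)
  exists (j%:~R / 2), (i%:~R / k.+1%:R); rewrite !scalerA !divfK // [in RHS]addrC.
  by split=> //; apply: Z2Z; exact: Z2_pt.
- split.
    by have := cK 0; rewrite scale0r addr0; apply; lra.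
  by have := cL 0; rewrite scale0r addr0; apply; lra.
- have PE z : P z <-> exists t (e f : R), [/\ 0 <= t <= 1, -1 - a%:~R <= e <= k%:R - a%:~R,
      -1 <= f <= 1 & z = A a 0 + ((t * e) *: u + ((1 - t) * f) *: v)].
    pose x0 : R := D * ((px z - p1%:~R) * v2%:~R - (py z - p2%:~R) * v1%:~R).
    pose y0 : R := D * (u1%:~R * (py z - p2%:~R) - u2%:~R * (px z - p1%:~R)).
    have zE : z = pt (p1%:~R + x0 * u1%:~R + y0 * v1%:~R) (p2%:~R + x0 * u2%:~R + y0 * v2%:~R).
      apply: ptP; rewrite !coordE.
        transitivity (p1%:~R + D * D * (px z - p1%:~R)); first by rewrite D1; ring.
        by rewrite {2}Dc /x0 /y0; ring.
      transitivity (p2%:~R + D * D * (py z - p2%:~R)); first by rewrite D1; ring.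
      by rewrite {2}Dc /x0 /y0; ring.
    have PQ : P z <-> pull (Frame (p1, p2) (u1, u2) (v1, v2)) (coords P) x0 y0.
      by rewrite /pull /coords /= -zE.
    rewrite PQ crossE.
    have AaE t e f : A a 0 + ((t * e) *: u + ((1 - t) * f) *: v) =
        pt (p1%:~R + (a%:~R + t * e) * u1%:~R + (1 - t) * f * v1%:~R)
           (p2%:~R + (a%:~R + t * e) * u2%:~R + (1 - t) * f * v2%:~R).
      by apply: ptP; rewrite !coordE !(intrD, intrM); ring.
    split=> -[t [e [f [t01 ea f1]]]].
      move=> ex ey; exists t, e, f; split=> //; rewrite AaE -ex -ey; exact: zE.
    move=> h; exists t, e, f; split=> //.
      rewrite /x0 h AaE !coordE.
      transitivity (D * D * (a%:~R + t * e)); last by rewrite D1 mul1r.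
      by rewrite [in RHS]Dc; rewrite Dc; ring.
    rewrite /y0 h AaE !coordE.
    transitivity (D * D * ((1 - t) * f)); last by rewrite D1 mul1r.
    by rewrite [in RHS]Dc; rewrite Dc; ring.
  apply/seteqP; split=> [z /PE[t [e [f [t01 ea f1 ->]]]]|z].
    exists ((t * e) *: u + ((1 - t) * f) *: v) => //.
    (* In the direct sum the segment of length 2 comes first, while [t] in [cross_sum] weighs the
       long segment. *)
    exists (f *: v), (e *: u), (1 - t); split.
    + by exists (A a 0 + f *: v); [exact: cK|rewrite addrC addKr].
    + by exists (A a 0 + e *: u); [exact: cL|rewrite addrC addKr].
    + by lra.
    + by rewrite !scalerA addrC; congr (_ + _); congr (_ *: _); ring.
  move=> [_ [_ [_ [t [[y1 K1 <-] [y2 L2 <-] t01 ->]]]] <-].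
  move: K1 L2; rewrite !segmentE => -[t1 /=]; rewrite in_itv /= => t101 <- [t2 /=].
  rewrite in_itv /= => t201 <-; apply/PE.
  exists (1 - t), (-1 * t2 + (1 - t2) * k%:R - a%:~R), (1 - 2 * t1); split.
  + by lra.
  + by nra.
  + by lra.
  + by apply: ptP; rewrite !coordE !(intrD, intrM, intrN) -!pmulrn; ring.
Qed.

End DirectSums.

Theorem theorem6p3 (R : realType) (P : set 'rV[R]_2) (k : nat) :
  lattice_polygon P ->
  non_hollow P ->
  (2 <= k)%N ->
  (interior_lattice_points P #= `I_k)%card ->
  covering_radius P <= 2^-1 + k.+1%:R^-1 /\
  (covering_radius P = 2^-1 + k.+1%:R^-1 <->
   direct_sum_of_lattice_segments P 2 k.+1).
Proof.
move=> lP nP k2 cardP.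
have [r0 rcov rmin] := covering_radius_min lP nP.
have [S [E [lQ sE]]] := coords_body lP cardP.
have t0 := threshold_gt0 R k.
have tE : (threshold R k)^-1 = 2^-1 + k.+1%:R^-1.
  have k0 : (0 : R) <= k%:R by [].
  by rewrite /threshold -natr1; field; rewrite !lt0r_neq0 //; lra.
have ub c : 0 < c -> tcover (coords P) c -> covering_radius P <= c^-1.
  by move=> c0 /(covers_coords c0); apply: rmin; rewrite invr_ge0 ltW.
have lb : direct_sum_of_lattice_segments P 2 k.+1 -> 2^-1 + k.+1%:R^-1 <= covering_radius P.
  by move=> ds; apply: (direct_sum_lower_bound _ _ ds).
case: (small_or_cross_of_body lQ sE k2) => [[c tc cov]|[cov [T uT cr]]].
  have c0 : 0 < c by exact: lt_trans tc.
  have lt : covering_radius P < 2^-1 + k.+1%:R^-1.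
    by apply: le_lt_trans (ub _ c0 cov) _; rewrite -tE ltf_pV2.
  split; first exact: ltW.
  split=> [eq|/lb]; first by rewrite eq ltxx in lt.
  by rewrite leNgt lt.
have le := ub _ t0 cov; rewrite tE in le.
split=> //; split=> [_|/lb ge]; first exact: cross_direct_sum uT cr.
by apply/eqP; rewrite eq_le le.
Qed.
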